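(* Let $n\ge 1$, $2\le p<\infty$, and let $s\in\mathbb{R}$ satisfy $s<n(1-2/p)$. Then the weak-type maximal estimate $$\left\|\sup_{0<t<1}\left|e^{it\Delta} f\right|\right\|_{L^{p,\infty}(B(0,1))}\le C\, \|f\|_{L_{s}^{p}(\mathbb{R}^{n})}$$ fails: there is no finite constant $C$, independent of $f$, for which it holds for all $f\in L^p_s(\mathbb{R}^n)$.
   Context: Fourier transform conventions: $\widehat f(\xi)=\int_{\mathbb{R}^n}e^{-ix\cdot\xi}f(x)\,dx$ and $f^\vee(x)=(2\pi)^{-n}\int_{\mathbb{R}^n}e^{ix\cdot\xi}f(\xi)\,d\xi$, extended to tempered distributions. Bessel potential space: for $s\in\mathbb{R}$ and $1\le p\le\infty$, $L^p_s(\mathbb{R}^n)$ is the space of tempered distributions $f$ with $((1+|\xi|^2)^{s/2}\widehat f)^\vee\in L^p(\mathbb{R}^n)$, with norm $\|f\|_{L^p_s(\mathbb{R}^n)}=\|((1+|\cdot|^2)^{s/2}\widehat f)^\vee\|_{L^p(\mathbb{R}^n)}$. Schrödinger operator: $e^{it\Delta}f(x)=(2\pi)^{-n}\int_{\mathbb{R}^n}e^{ix\cdot\xi-it|\xi|^2}\widehat f(\xi)\,d\xi$. For Schwartz functions $f$ this integral converges absolutely. An estimate for all $f\in L^p_s(\mathbb{R}^n)$ with $1\le p<\infty$ is understood in the usual way as the estimate, with uniform constant, for all Schwartz functions $f$ on $\mathbb{R}^n$ (dense in $L^p_s(\mathbb{R}^n)$), then extended by density. $B(0,1)$ is the open unit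 ball of $\mathbb{R}^n$ centered at the origin, and $\|g\|_{L^{p,\infty}(B(0,1))}=\sup_{\alpha>0}\alpha\,|\{x\in B(0,1):|g(x)|>\alpha\}|^{1/p}$. *)

(* Defs.v *)
From HB Require Import structures.
From mathcomp Require Import all_boot all_order all_algebra.
From mathcomp Require Import complex.
From mathcomp Require Import all_classical all_reals all_analysis.

Set Implicit Arguments.
Unset Strict Implicit.
Unset Printing Implicit Defensive.

Import Order.TTheory GRing.Theory Num.Theory.
Import numFieldNormedType.Exports.
Import ComplexField.Normc.

Local Open Scope classical_set_scope.
Local Open Scope complex_scope.
Local Open Scope ring_scope.

Section measurable_rV.
Context {R : realType} (n : nat).

Let coord (i : 'I_n) (x : 'rV[R]_n) : R := x ord0 i.

Let rV_set0 : g_sigma_preimage coord set0.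
Proof. exact: sigma_algebra0. Qed.

Let rV_setC A : g_sigma_preimage coord A -> g_sigma_preimage coord (~` A).
Proof. exact: sigma_algebraC. Qed.

Let rV_bigcup (F : _^nat) : (forall i, g_sigma_preimage coord (F i)) ->
  g_sigma_preimage coord (\bigcup_i (F i)).
Proof. exact: sigma_algebra_bigcup. Qed.

(* The sigma-algebra generated by the coordinates, as for [n.-tuple R] in the
   library; it is the Borel sigma-algebra of R^n. *)
HB.instance Definition _ := @isMeasurable.Build default_measure_display
  'rV[R]_n (g_sigma_preimage coord) rV_set0 rV_setC rV_bigcup.

End measurable_rV.

Lemma measurable_rV_coord (R : realType) n (i : 'I_n) :
  measurable_fun [set: 'rV[R]_n] (fun x : 'rV[R]_n => x ord0 i).
Proof.
move=> _ Y mY; rewrite setTI; apply: sub_sigma_algebra => /=.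
rewrite -bigcup_seq/=; exists i => /=; first by rewrite mem_index_enum.
by exists Y => //; rewrite setTI.
Qed.

Lemma measurable_fun_rV d (T : measurableType d) (R : realType) n
    (f : T -> 'rV[R]_n) :
  (forall i, measurable_fun setT (fun t => f t ord0 i)) ->
  measurable_fun setT f.
Proof.
move=> mf _ A mA; rewrite setTI.
pose P := [set B : set 'rV[R]_n | measurable (f @^-1` B)].
suff : (@measurable _ 'rV[R]_n) `<=` P by apply.
apply: smallest_sub.
  split.
  - by rewrite /P /= preimage_set0.
  - by move=> B; rewrite /P /= setTD preimage_setC; exact: measurableC.
  - by move=> F mF; rewrite /P /= preimage_bigcup; exact: bigcupT_measurable.
rewrite -bigcup_seq => B [i /= _ [C mC <-]]; rewrite /P /= setTI.
by have := mf i measurableT C mC; rewrite setTI.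
Qed.

Section rV_cons.
Context {R : realType} {n : nat}.

Definition rV_cons (x : measurableTypeR R * 'rV[R]_n) : 'rV[R]_n.+1 :=
  row_mx (const_mx x.1 : 'rV[R]_1) x.2.

Definition rV_uncons (y : 'rV[R]_n.+1) : measurableTypeR R * 'rV[R]_n :=
  (y ord0 ord0, \row_i y ord0 (lift ord0 i)).

Lemma rV_cons0 x : rV_cons x ord0 ord0 = x.1.
Proof.
have -> : (ord0 : 'I_n.+1) = lshift n (ord0 : 'I_1) by exact/val_inj.
by rewrite [LHS]row_mxEl mxE.
Qed.

Lemma rV_consS x i : rV_cons x ord0 (lift ord0 i) = x.2 ord0 i.
Proof.
have -> : lift ord0 i = rshift 1 i by exact/val_inj.
by rewrite [LHS]row_mxEr.
Qed.

Lemma rV_consK : cancel rV_cons rV_uncons.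
Proof.
case=> a v; rewrite /rV_uncons rV_cons0; congr pair.
by apply/rowP => i; rewrite mxE rV_consS.
Qed.

Lemma rV_unconsK : cancel rV_uncons rV_cons.
Proof.
move=> y; apply/rowP => i; case: (unliftP ord0 i) => [j|] ->.
  by rewrite rV_consS mxE.
by rewrite rV_cons0.
Qed.

Lemma measurable_rV_cons : measurable_fun setT rV_cons.
Proof.
apply: measurable_fun_rV => i; case: (unliftP ord0 i) => [j|] ->.
  under eq_fun do rewrite rV_consS.
  apply: (@measurableT_comp _ _ _ _ _ _ (fun v : 'rV[R]_n => v ord0 j)) => //.
  exact: measurable_rV_coord.
under eq_fun do rewrite rV_cons0.
exact: measurable_fst.
Qed.

Lemma measurable_rV_uncons : measurable_fun setT rV_uncons.
Proof.
apply/measurable_fun_pairP; split; first exact: measurable_rV_coord.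
apply: measurable_fun_rV => i /=.
under eq_fun do rewrite mxE.
exact: measurable_rV_coord.
Qed.

Variable m : {sigma_finite_measure set 'rV[R]_n -> \bar R}.

Definition rV_cons_measure : set 'rV[R]_n.+1 -> \bar R :=
  pushforward (lebesgue_measure \x m)%E rV_cons.

Let rV_cons_measure0 : rV_cons_measure set0 = 0%E.
Proof. by apply: measure0; exact: measurable_rV_cons. Qed.

Let rV_cons_measure_ge0 A : (0 <= rV_cons_measure A)%E.
Proof. by apply: measure_ge0; exact: measurable_rV_cons. Qed.

Let rV_cons_measure_sigma_additive : semi_sigma_additive rV_cons_measure.
Proof.
by apply: measure_semi_sigma_additive; exact: measurable_rV_cons.
Qed.

HB.instance Definition _ := isMeasure.Build _ _ _ rV_cons_measure
  rV_cons_measure0 rV_cons_measure_ge0 rV_cons_measure_sigma_additive.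

Let rV_cons_measure_sigma_finite : sigma_finite setT rV_cons_measure.
Proof.
have /sigma_finiteP[F [TF ndF Foo]] :=
  sigma_finiteT (@lebesgue_measure R : {sigma_finite_measure set _ -> \bar R}).
have /sigma_finiteP[G [TG ndG Goo]] := sigma_finiteT m.
exists (fun k => rV_uncons @^-1` (F k `*` G k)).
  rewrite -preimage_bigcup -[LHS](preimage_setT rV_uncons); congr (_ @^-1` _).
  rewrite -setXTT TF TG predeqE => -[x y]; split.
    move=> [/= [k _ Fkx] [l _ Gly]]; exists (maxn k l) => //; split.
    - by move: x Fkx; exact/subsetPset/ndF/leq_maxl.
    - by move: y Gly; exact/subsetPset/ndG/leq_maxr.
  by move=> [k _ []/= ? ?]; split; exists k.
move=> k; have [mF Fk] := Foo k; have [mG Gk] := Goo k; split.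
  rewrite -[X in measurable X]setTI; apply: measurable_rV_uncons => //.
  exact: measurableX.
rewrite /rV_cons_measure /pushforward -comp_preimage.
rewrite (_ : rV_uncons \o rV_cons = id); last exact/funext/rV_consK.
by rewrite preimage_id product_measure1E// lte_mul_pinfty// ge0_fin_numE.
Qed.

HB.instance Definition _ := Measure_isSigmaFinite.Build _ _ _
  rV_cons_measure rV_cons_measure_sigma_finite.

End rV_cons.


Fixpoint lebesgue_rV {R : realType} (n : nat) :
    {sigma_finite_measure set 'rV[R]_n -> \bar R} :=
  match n with
  | 0 => \d_(0 : 'rV[R]_0)
  | n'.+1 => rV_cons_measure (lebesgue_rV n')
  end.

Lemma lebesgue_rV_box (R : realType) n (A : 'I_n -> set R) :
  (forall i, measurable (A i)) ->
  (lebesgue_rV n [set x : 'rV[R]_n | forall i, A i (x ord0 i)] =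
   \prod_(i < n) lebesgue_measure (A i))%E.
Proof.
elim: n A => [|n IHn] A mA.
  by rewrite big_ord0 /= diracE mem_set// => -[].
rewrite big_ord_recl -IHn//=.
rewrite /rV_cons_measure /pushforward.
transitivity ((lebesgue_measure \x lebesgue_rV n)%E
    (A ord0 `*` [set x : 'rV[R]_n | forall i, A (lift ord0 i) (x ord0 i)])).
  congr (_ _); apply/seteqP; split => -[a v] /=.
    move=> Aav; split=> [|i]; first by have := Aav ord0; rewrite rV_cons0.
    by have := Aav (lift ord0 i); rewrite rV_consS.
  move=> [Aa Av] i; case: (unliftP ord0 i) => [j|] ->.
    by rewrite rV_consS; exact: Av.
  by rewrite rV_cons0.
rewrite product_measure1E//; first exact: mA.
set B := (X in measurable X).
have -> : B = \bigcap_(i in [set: 'I_n])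
    ((fun x : 'rV[R]_n => x ord0 i) @^-1` A (lift ord0 i)).
  by apply/seteqP; split => x /= H i; [move=> _|]; exact: H.
apply: fin_bigcap_measurable => // i _; rewrite -[X in measurable X]setTI.
exact: measurable_rV_coord.
Qed.

Section Schwartz.
Context {R : realType} {n : nat}.
Implicit Types (g : 'rV[R]_n -> R) (f : 'rV[R]_n -> R[i]).

Definition partial (i : 'I_n) g : 'rV[R]_n -> R :=
  fun x => 'D_(delta_mx ord0 i) g x.

(* [foldr] puts the head of [l] outermost: [:: i; j] is d_i d_j g. *)
Definition iter_partial (l : seq 'I_n) g : 'rV[R]_n -> R := foldr partial g l.

Definition smooth g : Prop :=
  forall (l : seq 'I_n) (x : 'rV[R]_n), differentiable (iter_partial l g) x.

Definition real_schwartz g : Prop :=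
  smooth g /\
  forall (a : 'I_n -> nat) (l : seq 'I_n), exists M : R,
    forall x : 'rV[R]_n,
      `|(\prod_(i < n) x ord0 i ^+ a i) * iter_partial l g x| <= M.

Definition schwartz f : Prop :=
  real_schwartz (fun x => complex.Re (f x)) /\
  real_schwartz (fun x => complex.Im (f x)).

End Schwartz.

Section Schrodinger.
Context {R : realType} {n : nat}.
Implicit Types (f g : 'rV[R]_n -> R[i]) (x xi : 'rV[R]_n) (p s t : R).

Definition dotv x xi : R := \sum_(i < n) x ord0 i * xi ord0 i.

(* The norm [`|x|] of the library on ['rV[R]_n] is the sup norm. *)
Definition enorm x : R := Num.sqrt (dotv x x).

Definition unit_ball : set 'rV[R]_n := [set x | enorm x < 1].

Definition expi (theta : R) : R[i] := cos theta +i* sin theta.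

(* Meaningful when the real and imaginary parts are integrable. The operators
   below are meant for Schwartz [f], for which all integrals converge
   absolutely; Schwartz functions are dense in L^p_s for p < oo, and an
   estimate on L^p_s means that estimate, uniformly, on Schwartz functions. *)
Definition cintegral f : R[i] :=
  (\int[lebesgue_rV n]_x complex.Re (f x)) +i*
  (\int[lebesgue_rV n]_x complex.Im (f x)).

Definition fourier f : 'rV[R]_n -> R[i] :=
  fun xi => cintegral (fun x => expi (- dotv x xi) * f x).

Definition inv_fourier g : 'rV[R]_n -> R[i] :=
  fun x => ((2 * pi) ^- n)%:C * cintegral (fun xi => expi (dotv x xi) * g xi).

Definition bessel s f : 'rV[R]_n -> R[i] :=
  inv_fourier (fun xi => ((1 + enorm xi ^+ 2) `^ (s / 2))%:C * fourier f xi).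

Definition bessel_norm p s f : \bar R :=
  Lnorm (lebesgue_rV n) p%:E (fun x => (normc (bessel s f x))%:E).

Definition schrodinger t f : 'rV[R]_n -> R[i] :=
  fun x => ((2 * pi) ^- n)%:C *
    cintegral (fun xi => expi (dotv x xi - t * enorm xi ^+ 2) * fourier f xi).

Definition schrodinger_max f : 'rV[R]_n -> \bar R :=
  fun x => ereal_sup [set (normc (schrodinger t f x))%:E | t in `]0, 1[ ].

Definition weak_Lnorm p (B : set 'rV[R]_n) (h : 'rV[R]_n -> \bar R) : \bar R :=
  ereal_sup [set (alpha%:E *
      (lebesgue_rV n (B `&` [set x | alpha%:E < `|h x|])) `^ p^-1)%E
    | alpha in `]0, +oo[ ].

End Schrodinger.

(* Main.v *)
(* Put r = |xi|^2 and take f with Fourier transform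
   e^{i r / 2} e^{- d r} P(e^{- d r}), where the polynomial P is chosen by
   Weierstrass so that q P(q) is close to q^2 (1 + r)^{- s / 2} at q = e^{- d r},
   with an error of size eta q.  Such an f is a finite sum of Gaussians with
   complex width, hence Schwartz.  Its Bessel potential is close to a Gaussian
   dispersed for time 1/2: it has size about 1 on |x| <~ d^{- 1/2}, so that
   ||f||_{L^p_s} <~ d^{- n / (2 p)}.  At time t = 1/2 the phase cancels and the
   solution focuses to height about d^{(s - n) / 2} on |x| <~ d^{1/2}, so the
   weak norm is at least about d^{(s - n) / 2 + n / (2 p)}.  Letting d tend to 0
   forces s >= n (1 - 2 / p).  The error in the Bessel potential is controlled
   in L^oo by the L^1 norm of its Fourier transform and in L^2 by Plancherel;
   as p >= 2, these two bounds suffice. *)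
Require Import Defs.
From mathcomp Require Import all_boot all_order all_algebra.
From mathcomp Require Import complex.
From mathcomp Require Import all_classical all_reals all_analysis.
From mathcomp Require Import measurable_realfun.
From mathcomp Require Import ring lra.

Set Implicit Arguments.
Unset Strict Implicit.
Unset Printing Implicit Defensive.

Import Order.TTheory GRing.Theory Num.Theory.
Import numFieldNormedType.Exports.

Local Open Scope classical_set_scope.
Local Open Scope complex_scope.
Local Open Scope ring_scope.

(** * Weierstrass approximation *)

(** The Fourier side is prescribed and [f] is then written down explicitly, so no inversion theorem
    enters: [e^{- z |x|^2}] transforms into a constant times [e^{- |xi|^2 / (4 z)}], and
    [z -> 1 / (4 z)] is an involution. This also settles the Schwartz property, which for the exact
    multiplier [(1 + r)^{- s / 2}] would require estimates of all its derivatives. The two factors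
    [q] have different tasks: one makes [q (1 + r)^{- s / 2}] continuous at [q = 0], as Weierstrass
    requires; the other turns a uniform error into an error integrable in frequency. The tolerance
    is chosen after [d], so it may absorb any constant depending on [d]; only the main terms must be
    uniform. Those are an explicit Gaussian for the Bessel potential and, at the focus, an integral
    with a positive profile, where the tail on which [cos (x . xi)] may be negative is beaten by
    taking [|x|] a small multiple of [d^{1/2}]. Crude factors, such as the 2 lost by treating real
    and imaginary parts apart, are harmless, since the contradiction comes from exponents alone. *)

Section Bernstein.
Context {R : realType}.
Implicit Types (g : nat -> R) (phi : R -> R) (q : R).

(* The Bernstein polynomial [\sum_k 'C(n, k) g(k) X^k (1 - X)^(n-k)], generated
   by its degree-raising recurrence. *)
Fixpoint bernstein (n : nat) g : {poly R} :=
  if n is m.+1 then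
    (1 - 'X) * bernstein m g + 'X * bernstein m (fun k => g k.+1)
  else (g 0%N)%:P.

Lemma bernsteinS n g q : (bernstein n.+1 g).[q] =
  (1 - q) * (bernstein n g).[q] + q * (bernstein n (fun k => g k.+1)).[q].
Proof. by rewrite /= !hornerE. Qed.

Lemma bernstein_lin n (c : R) g1 g2 q :
  (bernstein n (fun k => g1 k + c * g2 k)).[q] =
  (bernstein n g1).[q] + c * (bernstein n g2).[q].
Proof.
elim: n g1 g2 => [|n IHn] g1 g2; first by rewrite /= !hornerE.
by rewrite !bernsteinS !IHn; ring.
Qed.

Lemma bernstein_cst n (c q : R) : (bernstein n (fun=> c)).[q] = c.
Proof.
elim: n => [|n IHn]; first by rewrite /= hornerE.
by rewrite bernsteinS IHn; ring.
Qed.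

(** On [[0, 1]] each step of the recurrence is a convex combination, so order is preserved. *)
Lemma bernstein_le n g1 g2 q : 0 <= q <= 1 ->
  (forall k, (k <= n)%N -> g1 k <= g2 k) ->
  (bernstein n g1).[q] <= (bernstein n g2).[q].
Proof.
move=> /andP[q0 q1]; elim: n g1 g2 => [|n IHn] g1 g2 g12.
  by rewrite /= !hornerE g12.
rewrite !bernsteinS lerD// ler_wpM2l ?subr_ge0//; apply: IHn => k kn; apply: g12.
  exact: leqW.
by [].
Qed.

(** Second moment of the binomial law about [c]. The centre is free because the index shift in the
    recurrence moves it to [c - 1]; at [c = n q] only the variance is left. *)
Lemma bernstein_var n (c q : R) :
  (bernstein n (fun k => (k%:R - c) ^+ 2)).[q] =
  (n%:R * q - c) ^+ 2 + n%:R * q * (1 - q).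
Proof.
elim: n c => [|n IHn] c; first by rewrite /= hornerE; ring.
rewrite bernsteinS IHn.
have -> : (fun k => (k.+1%:R - c) ^+ 2) = (fun k : nat => (k%:R - (c - 1)) ^+ 2).
  by apply/funext => k; rewrite -natr1; congr (_ ^+ 2); ring.
by rewrite IHn -[n.+1%:R]natr1; ring.
Qed.

(** Heine's theorem by near covering: the filter [0^'+] carries the modulus [d], and halving the
    radius at [x] keeps both [x'] and [y] in the ball where [phi] stays within [eta / 2] of
    [phi x]. *)
Lemma segment_uniform_bound phi (eta : R) : 0 < eta ->
  (forall x : R, 0 <= x <= 1 -> {for x, continuous phi}) ->
  exists2 d : R, 0 < d & forall x y : R, 0 <= x <= 1 -> 0 <= y <= 1 ->
    `|x - y| < d -> `|phi x - phi y| <= eta.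
Proof.
move=> eta0 cphi.
have /compact_near_coveringP cov := @segment_compact R 0 1.
have := @cov R 0^'+ (fun d x => forall y, 0 <= y <= 1 ->
    `|x - y| < d -> `|phi x - phi y| <= eta) _.
case=> [x /= |d /= d0 H].
  rewrite in_itv /= => x01.
  have /cvgrPdist_lt /(_ (eta / 2)) := cphi x x01.
  case=> [|r /= r0 H]; first by rewrite divr_gt0.
  exists (ball x (r / 2), [set d | d < r / 2]).
    split; first by apply: nbhsx_ballx; rewrite divr_gt0.
    by apply: nbhs_right_lt; rewrite divr_gt0.
  move=> [x' d'] /= [xx' dr] y _ x'y.
  have /H : ball x r x' by apply: (le_ball _ xx'); lra.
  have : ball x r y.
    rewrite /ball /= (@le_lt_trans _ _ (`|x - x'| + `|x' - y|))//.
      by rewrite -[x - y](subrKA x') ler_normD.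
    by move: xx' x'y dr; rewrite /ball/=; lra.
  move=> /H /= Hy /= Hx'.
  rewrite -[phi x' - phi y](subrKA (phi x)) (le_trans (ler_normD _ _))//.
  by move: Hx' Hy; rewrite (distrC (phi x')); lra.
exists (d / 2); first by rewrite divr_gt0.
move=> x y x01 y01 xy; apply: (H (d / 2) _ _ x _ y y01 xy) => /=.
- by rewrite sub0r normrN gtr0_norm ?divr_gt0// ; lra.
- by rewrite divr_gt0.
- by rewrite in_itv.
Qed.

Lemma segment_bounded phi :
  (forall x : R, 0 <= x <= 1 -> {for x, continuous phi}) ->
  exists2 M : R, 0 < M & forall x : R, 0 <= x <= 1 -> `|phi x| <= M.
Proof.
move=> cphi.
have /compact_near_coveringP cov := @segment_compact R 0 1.
have := @cov R +oo%R (fun M x => `|phi x| <= M) _.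
case=> [x /= |M [Mr HM]].
  rewrite in_itv /= => x01.
  have /cvgrPdist_lt /(_ 1 ltr01) H := cphi x x01.
  exists ([set x' | `|phi x - phi x'| < 1], [set M | `|phi x| + 1 <= M]).
    by split => //; exact: nbhs_pinfty_ge.
  move=> [x' M] /= [Hx' HM]; apply: le_trans HM.
  rewrite -[phi x'](subrK (phi x)) (le_trans (ler_normD _ _))// addrC lerD2l.
  by rewrite distrC ltW.
exists (`|M| + 1); first by rewrite ltr_wpDl.
move=> x x01; apply: (HM (`|M| + 1)); last by rewrite /= in_itv.
by rewrite (le_lt_trans (ler_norm _))// ltrDl.
Qed.

(** Bernstein's proof in the manner of Chebyshev: the deviation from [phi q] is majorised by a
    parabola in [k], and the Bernstein polynomial of a parabola is known. *)
Theorem weierstrass phi (eta : R) : 0 < eta ->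
  (forall x : R, 0 <= x <= 1 -> {for x, continuous phi}) ->
  exists p : {poly R}, forall q : R, 0 <= q <= 1 -> `|p.[q] - phi q| <= eta.
Proof.
move=> eta0 cphi.
have eta20 : 0 < eta / 2 by rewrite divr_gt0.
have [d d0 Hd] := segment_uniform_bound eta20 cphi.
have [M M0 HM] := segment_bounded cphi.
(* Chosen so that the variance term, at most [M / (2 d^2 n)], does not exceed [eta / 2]. *)
pose n := (Num.truncn (M / (d ^+ 2 * eta))).+1.
have n0 : 0 < n%:R :> R by rewrite ltr0n.
have Hn : M <= n%:R * (d ^+ 2 * eta).
  by rewrite -ler_pdivrMr ?mulr_gt0 ?exprn_gt0// ltW// truncnS_gt.
pose L := 2 * M / (d ^+ 2 * n%:R ^+ 2).
have L0 : 0 <= L by rewrite divr_ge0 ?mulr_ge0 ?exprn_ge0 ?ltW.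
exists (bernstein n (fun k => phi (k%:R / n%:R))) => q q01.
(* Near indices use uniform continuity; far ones cost at most [2 M], which [(k / n - q)^2 >= d^2]
   turns into the parabola. *)
have key k : (k <= n)%N ->
    `|phi (k%:R / n%:R) - phi q| <= eta / 2 + L * (k%:R - n%:R * q) ^+ 2.
  move=> kn.
  have kn01 : 0 <= (k%:R / n%:R : R) <= 1.
    by apply/andP; split; [apply: divr_ge0; rewrite ?ler0n|rewrite ler_pdivrMr// mul1r ler_nat].
  have [lt|ge] := ltP `|k%:R / n%:R - q| d.
    by rewrite (le_trans (Hd _ _ kn01 q01 lt))// lerDl mulr_ge0// ?sqr_ge0.
  rewrite (@le_trans _ _ (2 * M))//.
    rewrite (le_trans (ler_normB _ _))//.
    by have := HM _ kn01; have := HM _ q01; lra.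
  rewrite (_ : L * _ = 2 * M * ((k%:R / n%:R - q) ^+ 2 / d ^+ 2)); last first.
    by rewrite /L; field; rewrite (gt_eqF d0) (gt_eqF n0).
  have : 1 <= (k%:R / n%:R - q) ^+ 2 / d ^+ 2.
    rewrite ler_pdivlMr ?exprn_gt0// mul1r -[leRHS]real_normK ?num_real//.
    by rewrite lerXn2r ?nnegrE// ltW.
  by nra.
have tot : eta / 2 + L * (n%:R * q * (1 - q)) <= eta.
  have -> : L * (n%:R * q * (1 - q)) = 2 * M * (q * (1 - q)) / (d ^+ 2 * n%:R).
    by rewrite /L; field; rewrite (gt_eqF d0) (gt_eqF n0).
  suff : 2 * M * (q * (1 - q)) / (d ^+ 2 * n%:R) <= eta / 2 by lra.
  rewrite ler_pdivrMr ?mulr_gt0 ?exprn_gt0//.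
  have : q * (1 - q) <= 4^-1 by have := sqr_ge0 (q - 2^-1); rewrite expr2; lra.
  have : 0 <= M by exact: ltW.
  by nra.
have E (e : R) : (bernstein n (fun k => phi q + e * (eta / 2 + L * (k%:R - n%:R * q) ^+ 2))).[q]
    = phi q + e * (eta / 2 + L * (n%:R * q * (1 - q))).
  by rewrite bernstein_lin bernstein_lin !bernstein_cst bernstein_var subrr expr0n add0r.
rewrite ler_norml; apply/andP; split.
  rewrite lerBrDl; apply: le_trans (bernstein_le (g1 := fun k => phi q + (-1) * (eta / 2 + L * (k%:R - n%:R * q) ^+ 2)) q01 _).
    by rewrite E; lra.
  by move=> k /key; rewrite ler_norml => /andP[]; lra.
rewrite lerBlDl; apply: le_trans (bernstein_le (g2 := fun k => phi q + 1 * (eta / 2 + L * (k%:R - n%:R * q) ^+ 2)) q01 _) _.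
  by move=> k /key; rewrite ler_norml => /andP[]; lra.
by rewrite E; lra.
Qed.

End Bernstein.

(** * Complex-valued integrals *)

Notation Re := complex.Re.
Notation Im := complex.Im.
Notation normc := ComplexField.Normc.normc.

Section ComplexNumbers.
Context {R : realType}.
Implicit Types z w : R[i].

Lemma ReM z w : Re (z * w) = Re z * Re w - Im z * Im w.
Proof. by case: z w => [a b] [c d]. Qed.

Lemma ImM z w : Im (z * w) = Re z * Im w + Im z * Re w.
Proof. by case: z w => [a b] [c d]. Qed.

Lemma ReD z w : Re (z + w) = Re z + Re w.
Proof. by case: z w => [a b] [c d]. Qed.

Lemma ImD z w : Im (z + w) = Im z + Im w.
Proof. by case: z w => [a b] [c d]. Qed.

Lemma eqReIm z w : Re z = Re w -> Im z = Im w -> z = w.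
Proof. by case: z w => [a b] [c d] /= -> ->. Qed.

Lemma normc_ge0 z : 0 <= normc z.
Proof. by case: z => a b; exact: sqrtr_ge0. Qed.

Lemma sqr_normc z : normc z ^+ 2 = Re z ^+ 2 + Im z ^+ 2.
Proof. by case: z => a b; rewrite /= sqr_sqrtr// addr_ge0 ?sqr_ge0. Qed.

Lemma normc_ge_Re z : `|Re z| <= normc z.
Proof.
by case: z => a b; rewrite /= -sqrtr_sqr ler_wsqrtr// lerDl sqr_ge0.
Qed.

Lemma normc_ge_Im z : `|Im z| <= normc z.
Proof.
by case: z => a b; rewrite /= -sqrtr_sqr ler_wsqrtr// lerDr sqr_ge0.
Qed.

Lemma normc_le_ReIm z : normc z <= `|Re z| + `|Im z|.
Proof.
rewrite -(@ler_pXn2r _ 2) ?nnegrE ?normc_ge0 ?addr_ge0//.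
rewrite sqr_normc sqrrD !real_normK ?num_real// -addrA lerD2l lerDr.
by rewrite mulrn_wge0// mulr_ge0.
Qed.

Lemma normc_real (a : R) : normc a%:C = `|a|.
Proof. by rewrite /= expr0n addr0 sqrtr_sqr. Qed.

Lemma normc_expi (t : R) : normc (expi t) = 1.
Proof. by rewrite /= cos2Dsin2 sqrtr1. Qed.

Lemma expiD (s t : R) : expi (s + t) = expi s * expi t.
Proof.
by apply: eqReIm; rewrite ?ReM ?ImM /= ?cosD ?sinD//; ring.
Qed.

Lemma expi0 : expi 0 = 1 :> R[i].
Proof. by apply: eqReIm; rewrite /= ?cos0 ?sin0. Qed.

Lemma normcX z n : normc (z ^+ n) = normc z ^+ n.
Proof.
elim: n => [|n IHn]; first by rewrite !expr0 ComplexField.Normc.normc1.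
by rewrite !exprS ComplexField.Normc.normcM IHn.
Qed.

End ComplexNumbers.

Section RealIntegral.
Context d (T : measurableType d) (R : realType) (mu : {measure set T -> \bar R}).
Implicit Types f g : T -> R.

Definition rintegrable f := mu.-integrable setT (EFin \o f).

Lemma rintegrable_measurable f : rintegrable f -> measurable_fun setT f.
Proof. by move=> /measurable_int /measurable_EFinP. Qed.

Lemma rintegrable_le f g : measurable_fun setT f -> rintegrable g ->
  (forall x, `|f x| <= g x) -> rintegrable f.
Proof.
move=> mf ig fg; apply: (@le_integrable _ _ _ mu setT measurableT _ (EFin \o g)) => //.
  exact/measurable_EFinP.
by move=> x _ /=; rewrite lee_fin (le_trans (fg x))// ler_norm.
Qed.

Lemma rintegrableD f g : rintegrable f -> rintegrable g ->
  rintegrable (fun x => f x + g x).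
Proof. by move=> fi gi; apply: (integrableD measurableT fi gi). Qed.

Lemma rintegrableZ c f : rintegrable f -> rintegrable (fun x => c * f x).
Proof. by move=> fi; apply: (integrableZl measurableT c fi). Qed.

Lemma rintegrableB f g : rintegrable f -> rintegrable g ->
  rintegrable (fun x => f x - g x).
Proof. by move=> fi gi; apply: (integrableB measurableT fi gi). Qed.

Lemma rintegrable_bounded (M : R) f g : measurable_fun setT f ->
  (forall x, `|f x| <= M) -> rintegrable g -> rintegrable (fun x => f x * g x).
Proof.
move=> mf fM gi; apply: (@rintegrable_le _ (fun x => M * `|g x|)).
- by apply: measurable_funM => //; exact: rintegrable_measurable.
- by apply: rintegrableZ; exact: (integrable_norm gi).
- by move=> x; rewrite normrM ler_wpM2r.
Qed.

Lemma Rint_ge0 f : (forall x, 0 <= f x) -> 0 <= \int[mu]_x f x.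
Proof. by move=> f0; apply: Rintegral_ge0. Qed.

Lemma Rint_le f g : rintegrable f -> rintegrable g -> (forall x, f x <= g x) ->
  \int[mu]_x f x <= \int[mu]_x g x.
Proof. by move=> fi gi fg; apply: le_Rintegral. Qed.

Lemma RintE f : rintegrable f -> (\int[mu]_x (f x)%:E)%E = (\int[mu]_x f x)%:E.
Proof. by move=> fi; rewrite /Rintegral fineK//; exact: integrable_fin_num. Qed.

Lemma RintD f g : rintegrable f -> rintegrable g ->
  \int[mu]_x (f x + g x) = \int[mu]_x f x + \int[mu]_x g x.
Proof. by move=> fi gi; apply: RintegralD. Qed.

Lemma RintB f g : rintegrable f -> rintegrable g ->
  \int[mu]_x (f x - g x) = \int[mu]_x f x - \int[mu]_x g x.
Proof. by move=> fi gi; apply: RintegralB. Qed.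

Lemma RintZ c f : rintegrable f -> \int[mu]_x (c * f x) = c * \int[mu]_x f x.
Proof. by move=> fi; apply: RintegralZl. Qed.

Lemma eq_Rint f g : f =1 g -> \int[mu]_x f x = \int[mu]_x g x.
Proof. by move=> fg; apply: eq_Rintegral => x _. Qed.

Lemma Rint_norm_le f g : measurable_fun setT f -> rintegrable g ->
  (forall x, `|f x| <= g x) -> `|\int[mu]_x f x| <= \int[mu]_x g x.
Proof.
move=> mf gi fg; have fi := rintegrable_le mf gi fg.
rewrite (le_trans (le_normr_Rintegral measurableT fi))//.
by apply: Rint_le => //; exact: (integrable_norm fi).
Qed.

End RealIntegral.

Section ComplexIntegral.
Context d (T : measurableType d) (R : realType) (mu : {measure set T -> \bar R}).
Implicit Types f g : T -> R[i].

Definition cmeasurable f :=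
  measurable_fun setT (fun x => Re (f x)) /\ measurable_fun setT (fun x => Im (f x)).

Definition cintegrable f :=
  rintegrable mu (fun x => Re (f x)) /\ rintegrable mu (fun x => Im (f x)).

(** [cintegral] with the measure as a parameter. At [lebesgue_rV n] the two are convertible, so
    lemmas on [cint] apply to [fourier], [bessel] and [schrodinger]; at [lebesgue_measure] it serves
    the one-dimensional computations. *)
Definition cint f : R[i] := (\int[mu]_x Re (f x)) +i* (\int[mu]_x Im (f x)).

Lemma eq_cint f g : f =1 g -> cint f = cint g.
Proof. by move=> /funext ->. Qed.

Lemma cintD f g : cintegrable f -> cintegrable g ->
  cint (fun x => f x + g x) = cint f + cint g.
Proof.
move=> [f1 f2] [g1 g2]; apply: eqReIm => /=; rewrite -RintD//;
by apply: eq_Rint => x; rewrite ?ReD ?ImD.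
Qed.

Lemma cintegrableD f g : cintegrable f -> cintegrable g ->
  cintegrable (fun x => f x + g x).
Proof.
move=> [f1 f2] [g1 g2]; split.
  by under eq_fun do rewrite ReD; exact: rintegrableD.
by under eq_fun do rewrite ImD; exact: rintegrableD.
Qed.

Lemma cintegrableZ c f : cintegrable f -> cintegrable (fun x => c * f x).
Proof.
move=> [f1 f2]; split.
  by under eq_fun do rewrite ReM; apply: rintegrableB; exact: rintegrableZ.
by under eq_fun do rewrite ImM; apply: rintegrableD; exact: rintegrableZ.
Qed.

Lemma cintZ c f : cintegrable f -> cint (fun x => c * f x) = c * cint f.
Proof.
move=> [f1 f2]; apply: eqReIm; rewrite ?ReM ?ImM /=.
  rewrite -!RintZ// -RintB; [|exact: rintegrableZ..].
  by apply: eq_Rint => x; rewrite ReM.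
rewrite -!RintZ// -RintD; [|exact: rintegrableZ..].
by apply: eq_Rint => x; rewrite ImM.
Qed.

Lemma cintegrable0 : cintegrable (fun=> 0).
Proof. by split; apply: integrable0. Qed.

Lemma cint0 : cint (fun=> 0) = 0.
Proof.
by apply: eqReIm; rewrite /= /Rintegral integral0_eq.
Qed.

Lemma cintegrable_sum (I : Type) (s : seq I) (F : I -> T -> R[i]) :
  (forall i, cintegrable (F i)) ->
  cintegrable (fun x => \sum_(i <- s) F i x) /\
  cint (fun x => \sum_(i <- s) F i x) = \sum_(i <- s) cint (F i).
Proof.
move=> iF; elim: s => [|i s [IH1 IH2]].
  rewrite big_nil; under eq_fun do rewrite big_nil.
  by split; [exact: cintegrable0|exact: cint0].
rewrite big_cons -IH2.
rewrite (_ : (fun x => _) = (fun x => F i x + \sum_(j <- s) F j x)); last first.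
  by apply/funext => x; rewrite big_cons.
by split; [exact: cintegrableD|exact: cintD].
Qed.

Lemma cintegrable_le f (g : T -> R) : cmeasurable f -> rintegrable mu g ->
  (forall x, normc (f x) <= g x) -> cintegrable f.
Proof.
move=> [m1 m2] gi fg; split; apply: (rintegrable_le _ gi) => // x.
  exact: le_trans (normc_ge_Re _) (fg x).
exact: le_trans (normc_ge_Im _) (fg x).
Qed.

(** The constant 2 comes from bounding real and imaginary parts separately. *)
Lemma normc_cint_le f (g : T -> R) : cmeasurable f -> rintegrable mu g ->
  (forall x, normc (f x) <= g x) -> normc (cint f) <= 2 * \int[mu]_x g x.
Proof.
move=> [m1 m2] gi fg; rewrite (le_trans (normc_le_ReIm _))//= mulrDl mul1r.
apply: lerD; apply: Rint_norm_le => // x.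
  exact: le_trans (normc_ge_Re _) (fg x).
exact: le_trans (normc_ge_Im _) (fg x).
Qed.

Lemma cmeasurableM f g : cmeasurable f -> cmeasurable g ->
  cmeasurable (fun x => f x * g x).
Proof.
move=> [f1 f2] [g1 g2]; split.
  under eq_fun do rewrite ReM.
  by apply: measurable_funB; exact: measurable_funM.
under eq_fun do rewrite ImM.
by apply: measurable_funD; exact: measurable_funM.
Qed.

Lemma cmeasurable_real (g : T -> R) : measurable_fun setT g ->
  cmeasurable (fun x => (g x)%:C).
Proof. by move=> mg; split => //=; exact: measurable_cst. Qed.

Lemma cmeasurable_expi (g : T -> R) : measurable_fun setT g ->
  cmeasurable (fun x => expi (g x)).
Proof.
move=> mg; split => /=; apply: measurableT_comp => //.
  by apply: continuous_measurable_fun; exact: continuous_cos.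
by apply: continuous_measurable_fun; exact: continuous_sin.
Qed.

End ComplexIntegral.

(** * Fubini's theorem for real-valued integrals *)

Section ProductIntegral.
Context d1 d2 (T1 : measurableType d1) (T2 : measurableType d2) (R : realType).
Variables (m1 : {sigma_finite_measure set T1 -> \bar R})
          (m2 : {sigma_finite_measure set T2 -> \bar R}).

Lemma rintegrable_prod (u : T1 -> R) (v : T2 -> R) :
  rintegrable m1 u -> rintegrable m2 v ->
  rintegrable (m1 \x m2)%E (fun z => u z.1 * v z.2).
Proof.
move=> ui vi; have mu := rintegrable_measurable ui; have mv := rintegrable_measurable vi.
apply/integrable12ltyP.
  apply/measurable_EFinP; apply: measurable_funM.
    exact: measurableT_comp.
  exact: measurableT_comp.
have uni := integrable_norm ui; have vni := integrable_norm vi.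
under eq_integral.
  move=> x _ /=.
  under eq_integral do rewrite normrM EFinM.
  rewrite integralZl//.
  over.
rewrite /= (RintE vni) integralZr//.
by rewrite (RintE uni) -EFinM ltry.
Qed.

Lemma Rint_prod (u : T1 -> R) (v : T2 -> R) :
  rintegrable m1 u -> rintegrable m2 v ->
  \int[(m1 \x m2)%E]_z (u z.1 * v z.2) = (\int[m1]_x u x) * (\int[m2]_y v y).
Proof.
move=> ui vi; rewrite /Rintegral -integral12_prod_meas1; last exact: rintegrable_prod.
rewrite -fineM; [|exact: integrable_fin_num..]; congr fine.
rewrite /fubini_F /=.
under eq_integral.
  move=> x _ /=; under eq_integral do rewrite EFinM.
  rewrite integralZl//.
  over.
by rewrite /= (RintE vi) integralZr.
Qed.

Lemma Rint_Fubini (f : T1 -> T2 -> R) :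
  rintegrable (m1 \x m2)%E (fun z => f z.1 z.2) ->
  (forall x, rintegrable m2 (f x)) -> (forall y, rintegrable m1 (f ^~ y)) ->
  \int[m1]_x \int[m2]_y f x y = \int[m2]_y \int[m1]_x f x y.
Proof.
move=> fi f1 f2; have := Fubini fi; rewrite /Rintegral /=.
under eq_integral do rewrite (RintE (f1 _)).
by under [X in _ = X -> _]eq_integral do rewrite (RintE (f2 _)); move=> /= ->.
Qed.

End ProductIntegral.

Section IntegralRV.
Context {R : realType}.

(** The measure on dimension [n.+1] is by construction a pushforward along [rV_cons], so this is a
    change of variables. *)
Lemma integral_rV_cons n (f : 'rV[R]_n.+1 -> R) :
  rintegrable (lebesgue_measure \x lebesgue_rV n)%E (fun z => f (rV_cons z)) ->
  measurable_fun setT f ->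
  rintegrable (lebesgue_rV n.+1) f /\
  \int[lebesgue_rV n.+1]_x f x =
    \int[(lebesgue_measure \x lebesgue_rV n)%E]_z f (rV_cons z).
Proof.
move=> fi mf; split.
  apply: (@integrable_pushforward _ _ _ _ _ rV_cons) => //.
  - exact: measurable_rV_cons.
  - exact/measurable_EFinP.
rewrite /Rintegral; congr fine.
rewrite [LHS](@integral_pushforward _ _ _ _ _ rV_cons)//.
- exact: measurable_rV_cons.
- exact/measurable_EFinP.
Qed.

(** Induction on the dimension, peeling off one coordinate; the complex product splits into four
    real ones, each a product integral. All Gaussian integrals on R^n reduce to dimension one
    through this. *)
Lemma cint_prod_rV n (g : 'I_n -> R -> R[i]) :
  (forall i, cintegrable (@lebesgue_measure R) (g i)) ->
  cintegrable (lebesgue_rV n) (fun x => \prod_(i < n) g i (x ord0 i)) /\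
  cint (lebesgue_rV n) (fun x => \prod_(i < n) g i (x ord0 i)) =
    \prod_(i < n) cint (@lebesgue_measure R) (g i).
Proof.
elim: n g => [|n IHn] g gi.
  rewrite big_ord0; under eq_fun do rewrite big_ord0.
  (* In dimension 0 the measure is a Dirac mass, so constants are integrable and the empty product
     integrates to 1. *)
  have fin (c : R) : rintegrable (lebesgue_rV 0) (fun=> c).
    apply/integrableP; split; first exact: measurable_cst.
    by rewrite integral_dirac//= diracT mul1e ltry.
  split; first by split; exact: fin.
  by apply: eqReIm; rewrite /= /Rintegral integral_dirac//= indicT ?mulr0 ?mulr1.
rewrite big_ord_recl.
have [H1 H2] := IHn (fun i => g (lift ord0 i)) (fun i => gi _).
rewrite -H2.
set G := fun x : 'rV[R]_n => _ in H1 H2 *.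
have E : (fun x : 'rV[R]_n.+1 => \prod_(i < n.+1) g i (x ord0 i)) =
    (fun x => g ord0 (rV_uncons x).1 * G (rV_uncons x).2).
  apply/funext => x; rewrite big_ord_recl; congr (_ * _).
  by apply: eq_bigr => i _; rewrite /= mxE.
rewrite E.
have [g1 g2] := gi ord0; have [G1 G2] := H1.
have mg1 := rintegrable_measurable g1; have mg2 := rintegrable_measurable g2.
have mG1 := rintegrable_measurable G1; have mG2 := rintegrable_measurable G2.
have [ma mb] : cmeasurable (fun x : 'rV[R]_n.+1 => g ord0 (rV_uncons x).1 * G (rV_uncons x).2).
  have mu1 : measurable_fun setT (fun x : 'rV[R]_n.+1 => (rV_uncons x).1).
    by apply: measurableT_comp => //; exact: measurable_rV_uncons.
  have mu2 : measurable_fun setT (fun x : 'rV[R]_n.+1 => (rV_uncons x).2).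
    by apply: measurableT_comp => //; exact: measurable_rV_uncons.
  apply: cmeasurableM; split.
  - exact: (measurableT_comp mg1 mu1).
  - exact: (measurableT_comp mg2 mu1).
  - exact: (measurableT_comp mG1 mu2).
  - exact: (measurableT_comp mG2 mu2).
have [|i1 e1] := @integral_rV_cons n _ _ ma.
  under eq_fun do rewrite rV_consK ReM.
  by apply: rintegrableB; [exact: (rintegrable_prod g1 G1)|exact: (rintegrable_prod g2 G2)].
have [|i2 e2] := @integral_rV_cons n _ _ mb.
  under eq_fun do rewrite rV_consK ImM.
  by apply: rintegrableD; [exact: (rintegrable_prod g1 G2)|exact: (rintegrable_prod g2 G1)].
split; first by split.
apply: eqReIm; rewrite /= ?ReM ?ImM /=.
  rewrite [LHS]e1 -(Rint_prod g1 G1) -(Rint_prod g2 G2) -RintB;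
    [|exact: (rintegrable_prod g1 G1)|exact: (rintegrable_prod g2 G2)].
  by apply: eq_Rint => x; rewrite rV_consK ReM.
rewrite [LHS]e2 -(Rint_prod g1 G2) -(Rint_prod g2 G1) -RintD;
  [|exact: (rintegrable_prod g1 G2)|exact: (rintegrable_prod g2 G1)].
by apply: eq_Rint => x; rewrite rV_consK ImM.
Qed.

End IntegralRV.

(** * The Fourier transform of a complex Gaussian *)

Section RealDerivatives.
Context {R : realType}.
Implicit Types (f g : R -> R) (x : R).

(** Lets instance inference find a derivative [df] and leaves only its comparison with the wanted
    form. *)
Lemma is_derive_ptE f x (df df' : R) : is_derive x 1 f df -> df = df' ->
  is_derive x 1 f df'.
Proof. by move=> h <-. Qed.

(* Pointwise forms of the [is_derive] instances, which the library states for
   the ring operations on functions. *)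
Lemma is_derive_ptM f g x df dg : is_derive x 1 f df -> is_derive x 1 g dg ->
  is_derive x 1 (fun y => f y * g y) (f x * dg + g x * df).
Proof. by move=> hf hg; exact: is_deriveM. Qed.

Lemma is_derive_ptX f n x df : is_derive x 1 f df ->
  is_derive x 1 (fun y => f y ^+ n.+1) (n.+1%:R * f x ^+ n * df).
Proof.
move=> hf; elim: n => [|n IHn].
  by under eq_fun do rewrite expr1; rewrite expr0 !mul1r.
under eq_fun do rewrite exprS.
apply: is_derive_ptE (is_derive_ptM hf IHn) _.
by rewrite exprS -[n.+2%:R]natr1; ring.
Qed.

Lemma is_derive_ptid x : is_derive x 1 (fun y : R => y) 1.
Proof. exact: is_derive_id. Qed.

Lemma is_derive_cont f x df : is_derive x 1 f df -> {for x, continuous f}.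
Proof.
by move=> [hf _]; apply: differentiable_continuous; exact/derivable1_diffP.
Qed.

End RealDerivatives.

(** * Gaussian integrals and decay in dimension one *)

Section GaussianBounds.
Context {R : realType}.

Lemma expR_ge_pow k (y : R) : 0 <= y -> y ^+ k <= k`!%:R * expR y.
Proof.
move=> y0; case: k => [|k].
  by rewrite expr0 fact0 mul1r -expR0 ler_expR.
have := expR_ge1Dxn k y0.
have f0 : 0 < k.+1`!%:R :> R by rewrite ltr0n fact_gt0.
by rewrite -ler_pdivrMl// mulrC => H; apply: le_trans H; rewrite lerDr.
Qed.

Lemma expR_absorb (c : R) k : 0 < c -> exists2 M : R, 0 < M &
  forall y : R, 0 <= y -> (1 + y) ^+ k <= M * expR (c * y).
Proof.
move=> c0; exists (k`!%:R / c ^+ k * expR c).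
  by rewrite !mulr_gt0 ?invr_gt0 ?exprn_gt0 ?expR_gt0// ltr0n fact_gt0.
move=> y y0; have cy : 0 <= c * (1 + y) by rewrite mulr_ge0 ?addr_ge0// ltW.
have := expR_ge_pow k cy.
rewrite exprMn mulrDr mulr1 expRD => H.
rewrite [X in _ <= X](_ : _ = k`!%:R * (expR c * expR (c * y)) / c ^+ k); last by ring.
by rewrite ler_pdivlMr ?exprn_gt0// mulrC.
Qed.

(** Half of the decay pays for the power, through [|x| <= 1 + x^2]. *)
Lemma gauss_absorb (a : R) k : 0 < a -> exists2 M : R, 0 < M &
  forall x : R, `|x| ^+ k * expR (- (a * x ^+ 2)) <= M * expR (- (a / 2 * x ^+ 2)).
Proof.
move=> a0; have a20 : 0 < a / 2 by rewrite divr_gt0.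
have [M M0 HM] := expR_absorb k a20; exists M => // x.
have E : expR (- (a * x ^+ 2)) * expR (a / 2 * x ^+ 2) = expR (- (a / 2 * x ^+ 2)).
  by rewrite -expRD; congr expR; field.
rewrite -E mulrA mulrAC ler_wpM2r ?expR_ge0//.
apply: le_trans (HM (x ^+ 2) (sqr_ge0 _)).
rewrite lerXn2r ?nnegrE ?addr_ge0 ?sqr_ge0// -(real_normK (num_real x)).
by have := sqr_ge0 (`|x| - 2^-1); have := normr_ge0 x; nra.
Qed.

Local Notation mu := (@lebesgue_measure R).

Lemma measurable_gauss (a m : R) :
  measurable_fun setT (fun x : R => expR (- (a * (x - m) ^+ 2))).
Proof.
apply: measurableT_comp => //; apply: measurableT_comp => //.
by apply: measurable_funM => //; apply: measurable_funX; apply: measurable_funB.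
Qed.

(** A multiple of the normal density with mean [m] and variance [1 / (2 a)], whose total mass is
    1. *)
Lemma gauss_int (a m : R) : 0 < a ->
  rintegrable mu (fun x : R => expR (- (a * (x - m) ^+ 2))) /\
  \int[mu]_x expR (- (a * (x - m) ^+ 2)) = Num.sqrt (pi / a).
Proof.
move=> a0; pose s : R := Num.sqrt ((2 * a)^-1).
have s2 : s ^+ 2 = (2 * a)^-1 by rewrite sqr_sqrtr// invr_ge0 mulr_ge0// ltW.
have s0 : s != 0 by rewrite gt_eqF// sqrtr_gt0 invr_gt0 mulr_gt0.
have pa0 : 0 < pi / a by rewrite divr_gt0// pi_gt0.
have E (x : R) : expR (- (a * (x - m) ^+ 2)) = Num.sqrt (pi / a) * normal_pdf m s x.
  rewrite normal_pdfE//= /normal_peak /normal_fun s2.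
  rewrite (_ : _ *+ 2 = pi / a); last first.
    by rewrite -mulr_natr; field; rewrite gt_eqF.
  rewrite [RHS]mulVKf ?gt_eqF ?sqrtr_gt0//.
  by congr expR; rewrite -mulr_natr; field; rewrite gt_eqF.
have i0 : rintegrable mu (normal_pdf m s) by exact: integrable_normal_pdf.
split.
  by under eq_fun do rewrite E; exact: rintegrableZ.
under eq_Rint do rewrite E.
rewrite RintZ//.
by rewrite /Rintegral integral_normal_pdf/= mulr1.
Qed.

Lemma gauss_int0 (a : R) : 0 < a ->
  rintegrable mu (fun x : R => expR (- (a * x ^+ 2))) /\
  \int[mu]_x expR (- (a * x ^+ 2)) = Num.sqrt (pi / a).
Proof.
move=> a0; have [] := gauss_int 0 a0.
by under eq_fun do rewrite subr0.
Qed.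

Lemma rintegrable_moment (a : R) k (h : R -> R) : 0 < a ->
  measurable_fun setT h -> (forall x, `|h x| <= 1) ->
  rintegrable mu (fun x => x ^+ k * (expR (- (a * x ^+ 2)) * h x)).
Proof.
move=> a0 mh h1; have [M M0 HM] := gauss_absorb k a0.
have a20 : 0 < a / 2 by rewrite divr_gt0.
apply: (@rintegrable_le _ _ _ mu _ (fun x : R => M * expR (- (a / 2 * x ^+ 2)))).
- have := measurable_gauss a 0; under eq_fun do rewrite subr0.
  by move=> mg; apply: measurable_funM => //; apply: measurable_funM.
- by apply: rintegrableZ; have [] := gauss_int0 a20.
- move=> x; apply: le_trans (HM x).
  rewrite !normrM normrX (ger0_norm (expR_ge0 _)) mulrA.
  by rewrite ler_piMr// mulr_ge0 ?exprn_ge0 ?expR_ge0.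
Qed.

(** The fundamental theorem of calculus on growing symmetric intervals: the boundary terms vanish
    and dominated convergence restores the full integral. This is the source of every integration by
    parts below. *)
Lemma Rint_derive_eq0 (F f : R -> R) (c M : R) : 0 < c ->
  (forall x : R, is_derive x 1 F (f x)) -> continuous f -> rintegrable mu f ->
  (forall x, `|F x| <= M * expR (- (c * x ^+ 2))) -> \int[mu]_x f x = 0.
Proof.
move=> c0 dF cf fi FM.
have mf := rintegrable_measurable fi.
pose fn n := (EFin \o f) \_ `[(- n.+1%:R : R), n.+1%:R].
have lt n : (- n.+1%:R : R) < n.+1%:R by rewrite gtrN// ltr0n.
have fnE n : (\int[mu]_x fn n x = (F n.+1%:R - F (- n.+1%:R))%:E)%E.
  rewrite -integral_mkcond (@continuous_FTC2 _ f F)// ?lt//.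
  - exact: continuous_subspaceT.
  - split.
    + by move=> x _; have [] := dF x.
    + apply: cvg_at_right_filter; exact: is_derive_cont (dF _).
    + apply: cvg_at_left_filter; exact: is_derive_cont (dF _).
  - by move=> x _; rewrite derive1E; have [_ ->] := dF x.
have cv1 : (\int[mu]_x fn n x)%E @[n --> \oo] --> (\int[mu]_x (f x)%:E)%E.
  have := @dominated_cvg _ (measurableTypeR R) R mu setT measurableT fn (EFin \o f) (fun x => `|f x|%:E). apply => //.
  - move=> n; rewrite /fn; apply/(measurable_restrictT _ _).1 => //.
    by apply: measurable_funTS; exact: (measurable_int mu fi).
  - move=> x _; apply: cvg_near_cst; exists (Num.truncn `|x|) => // n /= xn.
    rewrite /fn patchE; case: ifPn => //; rewrite notin_setE /= in_itv /= => -[].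
    rewrite -ler_norml (le_trans (ltW (truncnS_gt _)))// ler_nat ltnS; exact: xn.
  - exact: (integrable_norm fi).
  - move=> n x _; rewrite /fn patchE; case: ifPn => //= _.
    by rewrite lee_fin ?normr0.
have cv2 : (\int[mu]_x fn n x)%E @[n --> \oo] --> 0%:E.
  under eq_fun do rewrite fnE.
  apply/fine_cvgP; split; first by near=> n.
  rewrite (_ : _ \o _ = fun n => F n.+1%:R - F (- n.+1%:R)); last by apply/funext.
  apply: norm_cvg0.
  (* With [N = n.+1], [e^{c N^2} >= 1 + c N^2 >= c N] bounds each boundary term by [|M| / (c N)]. *)
  apply: (@squeeze_cvgr _ _ _ _ (fun=> 0) (fun n : nat => (2 * `|M| / c) * n.+1%:R^-1)).
  - near=> n; rewrite normr_ge0/= (le_trans (ler_normB _ _))//.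
    have H (y : R) : y ^+ 2 = n.+1%:R ^+ 2 -> `|F y| <= `|M| / c * n.+1%:R^-1.
      move=> y2; rewrite (le_trans (FM y))// y2.
      rewrite (@le_trans _ _ (`|M| * expR (- (c * n.+1%:R ^+ 2))))//.
        by rewrite ler_wpM2r ?expR_ge0// ler_norm.
      rewrite -mulrA ler_wpM2l// expRN -invfM lef_pV2 ?posrE ?expR_gt0 ?mulr_gt0//.
      rewrite (le_trans _ (expR_ge1Dx _))//.
      have : 1 <= n.+1%:R :> R by rewrite ler1n.
      by nra.
    have := H n.+1%:R erefl; have := H (- n.+1%:R) (sqrrN _).
    by move=> H1 H2; rewrite (le_trans (lerD H2 H1))// le_eqVlt; apply/orP; left; apply/eqP; ring.
  - exact: cvg_cst.
  - rewrite -[X in _ --> X](mulr0 (2 * `|M| / c)); apply: cvgMl_tmp.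
    exact: cvg_harmonic.
by rewrite /Rintegral (cvg_unique _ cv1 cv2).
Unshelve. all: by end_near. Qed.

End GaussianBounds.

(** * Moments of an oscillating Gaussian: differentiation and integration by parts *)

Section OscillatoryGaussian.
Context {R : realType}.
Local Notation mu := (@lebesgue_measure R).
Implicit Types (a b xi c : R) (k j : nat).

(** Differentiating a cosine is a quarter turn of its phase. One family of cosine integrals with a
    free phase [c] thus covers sines too and is closed under differentiation. *)
Lemma cosD_pihalf (t : R) : - sin t = cos (t + pi / 2).
Proof. by rewrite cosDpihalf. Qed.

(** As [|cos| <= 1], one Gaussian moment dominates the derivative for all values of the parameter.
    The exponent [j] is 1 for the frequency and 2 for the chirp. *)
Lemma is_derive_under a k j (u : R -> R) (t : R) : 0 < a ->
  measurable_fun setT u ->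
  is_derive t 1
    (fun t => \int[mu]_x (x ^+ k * (expR (- (a * x ^+ 2)) * cos (u x + t * x ^+ j))))
    (\int[mu]_x (x ^+ (k + j) * (expR (- (a * x ^+ 2)) * cos (u x + t * x ^+ j + pi / 2)))).
Proof.
move=> a0 m_u.
pose f t x := x ^+ k * (expR (- (a * x ^+ 2)) * cos (u x + t * x ^+ j)) : R.
have mcos (s c : R) : measurable_fun setT (fun x => cos (u x + s * x ^+ j + c)).
  apply: measurableT_comp => //.
    by apply: continuous_measurable_fun; exact: continuous_cos.
  by apply: measurable_funD => //; apply: measurable_funD => //; apply: measurable_funM.
have mcos0 (s : R) : measurable_fun setT (fun x => cos (u x + s * x ^+ j)).
  by have := mcos s 0; under eq_fun do rewrite addr0.
have fi s : rintegrable mu (f s).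
  by apply: rintegrable_moment => // x; exact: cos_max.
have df (s x : R) : is_derive s 1 (f ^~ x)
    (x ^+ (k + j) * (expR (- (a * x ^+ 2)) * cos (u x + s * x ^+ j + pi / 2))).
  rewrite /f /=; apply: is_derive_ptE.
  by rewrite -cosD_pihalf exprD /GRing.scale/=; ring.
have d1E (s x : R) : partial1of2 f s x =
    x ^+ (k + j) * (expR (- (a * x ^+ 2)) * cos (u x + s * x ^+ j + pi / 2)).
  by rewrite partial1of2E; have [_ ->] := df s x.
pose G x := `|x ^+ (k + j) * (expR (- (a * x ^+ 2)) * 1)|.
have Gi : rintegrable mu G.
  apply: integrable_norm; apply: (@rintegrable_moment _ _ _ (fun=> 1)) => // x.
  by rewrite normr1.
have t0 : (`]t - 1, t + 1[%classic : set R) t by rewrite /= in_itv/=; apply/andP; split; lra.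
have Gub (s y : R) : (`]t - 1, t + 1[%classic : set R) s -> setT y -> `|partial1of2 f s y| <= G y.
  move=> _ _; rewrite d1E /G mulr1 !normrM mulrA ler_piMr//.
  by rewrite cos_max.
have H1 := @derivable_under_integral R _ (measurableTypeR R) mu f setT measurableT
  t (t - 1) (t + 1) t0 (fun x _ => fi x) (fun x y _ _ => @ex_derive _ _ _ _ _ _ _ (df x y))
  G (fun y => normr_ge0 _) Gi Gub.
have H2 := @differentiation_under_integral R _ (measurableTypeR R) mu f setT measurableT
  t (t - 1) (t + 1) t0 (fun x _ => fi x) (fun x y _ _ => @ex_derive _ _ _ _ _ _ _ (df x y))
  G (fun y => normr_ge0 _) Gi Gub.
split; first exact: H1.
rewrite -derive1E [LHS]H2; apply: eq_Rint => x; exact: d1E.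
Qed.

(** For [k = 0] this is the real part of [e^{- (a + i b) x^2 - i xi x}] when [c = 0] and its
    imaginary part when [c = pi / 2]; [k] counts moments. *)
Definition osc a b xi k c (x : R) :=
  x ^+ k * (expR (- (a * x ^+ 2)) * cos (b * x ^+ 2 + xi * x + c)).

Definition osc_int a b xi k c : R := \int[mu]_x osc a b xi k c x.

Lemma measurable_phase b xi c :
  measurable_fun setT (fun x : R => cos (b * x ^+ 2 + xi * x + c)).
Proof.
apply: measurableT_comp; first by apply: continuous_measurable_fun; exact: continuous_cos.
by do 2?apply: measurable_funD => //; apply: measurable_funM.
Qed.

Lemma rintegrable_osc a b xi k c : 0 < a -> rintegrable mu (osc a b xi k c).
Proof.
move=> a0; apply: rintegrable_moment => //; first exact: measurable_phase.
by move=> x; exact: cos_max.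
Qed.

Lemma is_derive_osc a b xi k c (x : R) : is_derive x 1 (osc a b xi k c)
  (k%:R * osc a b xi k.-1 c x - 2 * a * osc a b xi k.+1 c x
   + (2 * b * osc a b xi k.+1 (c + pi / 2) x + xi * osc a b xi k (c + pi / 2) x)).
Proof.
rewrite /osc.
have d1 : is_derive x 1 (fun y : R => expR (- (a * y ^+ 2)) * cos (b * y ^+ 2 + xi * y + c))
    (expR (- (a * x ^+ 2)) * (- sin (b * x ^+ 2 + xi * x + c) * (2 * b * x + xi))
     - 2 * a * x * expR (- (a * x ^+ 2)) * cos (b * x ^+ 2 + xi * x + c)).
  apply: is_derive_ptE.
  by rewrite /GRing.scale/=; ring.
rewrite !(addrA _ c) -!cosD_pihalf; case: k => [|k].
  apply: is_derive_ptE; first by under eq_fun do rewrite expr0 mul1r; exact: d1.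
  by rewrite expr0 expr1; ring.
apply: is_derive_ptE.
  by apply: is_derive_ptM d1; apply: is_derive_ptX; exact: is_derive_ptid.
by rewrite /= !exprS; ring.
Qed.

Lemma continuous_osc a b xi k c : continuous (osc a b xi k c).
Proof. move=> x; exact: is_derive_cont (is_derive_osc _ _ _ _ _ _). Qed.

(** The left side integrates the derivative of [osc a b xi k c]. At [k = 0] the default [k.-1 = 0]
    is multiplied by zero. *)
Lemma osc_by_parts a b xi k c : 0 < a ->
  k%:R * osc_int a b xi k.-1 c - 2 * a * osc_int a b xi k.+1 c
   + (2 * b * osc_int a b xi k.+1 (c + pi / 2) + xi * osc_int a b xi k (c + pi / 2)) = 0.
Proof.
move=> a0; have [M M0 HM] := gauss_absorb k a0.
have i k c := rintegrable_osc b xi k c a0.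
rewrite /osc_int -!RintZ//.
rewrite -RintB ?rintegrableZ// -[X in _ + X]RintD ?rintegrableZ//.
rewrite -RintD; [|by apply: rintegrableB; exact: rintegrableZ|by apply: rintegrableD; exact: rintegrableZ].
apply: (@Rint_derive_eq0 _ (osc a b xi k c) _ (a / 2) M).
- by rewrite divr_gt0.
- exact: is_derive_osc.
- move=> x; have C j c' e : {for x, continuous (fun x => e * osc a b xi j c' x)}.
    by apply: cvgMl_tmp; exact: continuous_osc.
  by apply: cvgD; [apply: cvgB|apply: cvgD]; exact: C.
- apply: rintegrableD; [apply: rintegrableB|apply: rintegrableD]; exact: rintegrableZ.
- move=> x; apply: le_trans (HM x); rewrite /osc !normrM normrX (ger0_norm (expR_ge0 _)).
  by rewrite mulrA ler_piMr ?cos_max// mulr_ge0 ?exprn_ge0 ?expR_ge0.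
Qed.

Lemma osc_intDpi a b xi k c : 0 < a ->
  osc_int a b xi k (c + pi / 2 + pi / 2) = - osc_int a b xi k c.
Proof.
move=> a0; rewrite /osc_int -mulN1r -RintZ; last exact: rintegrable_osc.
apply: eq_Rint => x; rewrite /osc (_ : c + _ + _ = c + pi); last by field.
by rewrite addrA cosDpi; ring.
Qed.

End OscillatoryGaussian.

(** * The one-dimensional complex Gaussian through its differential equations *)

Section ComplexGaussian.
Context {R : realType}.
Local Notation mu := (@lebesgue_measure R).
Implicit Types (a b xi c : R) (k j : nat).

Lemma is_derive_osc_freq a b k c xi : 0 < a ->
  is_derive xi 1 (fun t => osc_int a b t k c) (osc_int a b xi k.+1 (c + pi / 2)).
Proof.
move=> a0.
have mu : measurable_fun setT (fun x : R => b * x ^+ 2 + c).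
  by apply: measurable_funD => //; apply: measurable_funM.
rewrite (_ : (fun t => _) = fun t => \int[lebesgue_measure]_x
  (x ^+ k * (expR (- (a * x ^+ 2)) * cos (b * x ^+ 2 + c + t * x ^+ 1)))); last first.
  apply/funext => t; apply: eq_Rint => x; rewrite /osc; congr (_ * (_ * cos _)).
  by rewrite expr1; ring.
apply: is_derive_ptE (is_derive_under _ _ _ a0 mu) _.
apply: eq_Rint => x; rewrite /osc addn1; congr (_ * (_ * cos _)).
by rewrite expr1; ring.
Qed.

Lemma is_derive_osc_chirp a b k c : 0 < a ->
  is_derive b 1 (fun t => osc_int a t 0 k c) (osc_int a b 0 k.+2 (c + pi / 2)).
Proof.
move=> a0.
have mu : measurable_fun setT (fun x : R => c) by exact: measurable_cst.
rewrite (_ : (fun t => _) = fun t => \int[lebesgue_measure]_x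
  (x ^+ k * (expR (- (a * x ^+ 2)) * cos (c + t * x ^+ 2)))); last first.
  apply/funext => t; apply: eq_Rint => x; rewrite /osc; congr (_ * (_ * cos _)).
  by ring.
apply: is_derive_ptE (is_derive_under _ _ _ a0 mu) _.
apply: eq_Rint => x; rewrite /osc addn2; congr (_ * (_ * cos _)).
by ring.
Qed.

(** The system reads [2 (a + i b) (p + i r) = u + i v] and is solved by multiplying by the
    conjugate. *)
Lemma rotation_solve a b (p r u v : R) :
  2 * a * p - 2 * b * r = u -> 2 * b * p + 2 * a * r = v ->
  (a ^+ 2 + b ^+ 2) * r = (a * v - b * u) / 2 /\
  (a ^+ 2 + b ^+ 2) * p = (a * u + b * v) / 2.
Proof. by move=> <- <-; split; field. Qed.

(** Integration by parts with [k = 0] at the phases 0 and [pi / 2]. The moments listed are the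
    derivatives of [C] and [T] in [xi], hence the shift of the phases. *)
Lemma osc_first_moments a b xi : 0 < a ->
  let C := osc_int a b xi 0 0 in let T := osc_int a b xi 0 (0 + pi / 2) in
  (a ^+ 2 + b ^+ 2) * osc_int a b xi 1 (0 + pi / 2) = - xi / 2 * (a * C + b * T) /\
  (a ^+ 2 + b ^+ 2) * osc_int a b xi 1 (0 + pi / 2 + pi / 2) =
    - xi / 2 * (a * T - b * C).
Proof.
move=> a0 C T; rewrite osc_intDpi//.
have := osc_by_parts b xi 0 0 a0; have := osc_by_parts b xi 0 (0 + pi / 2) a0.
rewrite !osc_intDpi// -/C -/T /=.
set p := osc_int a b xi 1 0; set r := osc_int a b xi 1 (0 + pi / 2) => e1 e2.
have [||er ep] := @rotation_solve a b p r (xi * T) (- (xi * C)).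
- by apply/eqP; rewrite -subr_eq0 -[X in _ == X]oppr0 -e2; apply/eqP; ring.
- by apply/eqP; rewrite -subr_eq0 -[X in _ == X]oppr0 -e1; apply/eqP; ring.
- by rewrite mulrN ep er; split; ring.
Qed.

(** The same with [k = 1] at [xi = 0]; these second moments are the derivatives of [C] and [T] in
    the chirp [b]. *)
Lemma osc_second_moments a b : 0 < a ->
  let C := osc_int a b 0 0 0 in let T := osc_int a b 0 0 (0 + pi / 2) in
  (a ^+ 2 + b ^+ 2) * osc_int a b 0 2 (0 + pi / 2) = (a * T - b * C) / 2 /\
  (a ^+ 2 + b ^+ 2) * osc_int a b 0 2 (0 + pi / 2 + pi / 2) = - (a * C + b * T) / 2.
Proof.
move=> a0 C T; rewrite osc_intDpi//.
have := osc_by_parts b 0 1 0 a0; have := osc_by_parts b 0 1 (0 + pi / 2) a0.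
rewrite !osc_intDpi// -/C -/T /=.
set p := osc_int a b 0 2 0; set r := osc_int a b 0 2 (0 + pi / 2) => e1 e2.
have [||er ep] := @rotation_solve a b p r C T.
- by apply/eqP; rewrite -subr_eq0 -[X in _ == X]oppr0 -e2; apply/eqP; ring.
- by apply/eqP; rewrite -subr_eq0 -[X in _ == X]oppr0 -e1; apply/eqP; ring.
- by rewrite mulrN ep er; split; ring.
Qed.

(** The complex Gaussian [e^{- (a + i b) r}] taken as a function of [r = |x|^2], so that sums over
    coordinates become products. *)
Definition cgauss a b (r : R) : R[i] := (expR (- (a * r)))%:C * expi (- (b * r)).

(** A square root of [pi / (a + i b)]. Keeping it as an integral avoids choosing a branch; for
    [b <> 0] its modulus and its nonvanishing suffice. *)
Definition gauss_const a b : R[i] := cint mu (fun x => cgauss a b (x ^+ 2)).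

Lemma ReIm_cgauss_wave a b xi x :
  Re (expi (- (x * xi)) * cgauss a b (x ^+ 2)) = osc a b xi 0 0 x /\
  Im (expi (- (x * xi)) * cgauss a b (x ^+ 2)) = osc a b xi 0 (0 + pi / 2) x.
Proof.
rewrite /cgauss mulrCA -expiD.
rewrite (_ : - (x * xi) + - (b * x ^+ 2) = - (b * x ^+ 2 + xi * x)); last by ring.
rewrite ReM ImM /= !mul0r subr0 addr0 /osc !expr0 !mul1r !addr0 add0r.
by rewrite cosN sinN cosD_pihalf.
Qed.

Lemma cintegrable_wave a b xi : 0 < a ->
  cintegrable mu (fun x => expi (- (x * xi)) * cgauss a b (x ^+ 2)).
Proof.
move=> a0; split.
  under eq_fun do rewrite (ReIm_cgauss_wave _ _ _ _).1.
  exact: rintegrable_osc.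
under eq_fun do rewrite (ReIm_cgauss_wave _ _ _ _).2.
exact: rintegrable_osc.
Qed.

Lemma cint_wave a b xi :
  cint mu (fun x => expi (- (x * xi)) * cgauss a b (x ^+ 2)) =
  osc_int a b xi 0 0 +i* osc_int a b xi 0 (0 + pi / 2).
Proof.
apply: eqReIm => /=; apply: eq_Rint => x.
  exact: (ReIm_cgauss_wave _ _ _ _).1.
exact: (ReIm_cgauss_wave _ _ _ _).2.
Qed.

Lemma gauss_constE a b :
  gauss_const a b = osc_int a b 0 0 0 +i* osc_int a b 0 0 (0 + pi / 2).
Proof.
rewrite -cint_wave; apply: eq_cint => x.
by rewrite mulr0 oppr0 expi0 mul1r.
Qed.

(* The integral solves [K' = - xi / (2 (a + i b)) K] in the frequency. *)
Lemma cint_gauss_wave a b xi : 0 < a ->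
  cint mu (fun x => expi (- (x * xi)) * cgauss a b (x ^+ 2)) =
  gauss_const a b *
    cgauss (a / (4 * (a ^+ 2 + b ^+ 2))) (- (b / (4 * (a ^+ 2 + b ^+ 2)))) (xi ^+ 2).
Proof.
move=> a0; rewrite cint_wave gauss_constE.
set D := a ^+ 2 + b ^+ 2.
have D0 : D != 0 by rewrite gt_eqF// ltr_pwDl ?exprn_gt0// sqr_ge0.
set al := a / (4 * D); set be := b / (4 * D).
pose C t := osc_int a b t 0 0; pose T t := osc_int a b t 0 (0 + pi / 2).
have dC (t : R) : is_derive t 1 C (- 2 * t * (al * C t + be * T t)).
  apply: is_derive_ptE (is_derive_osc_freq _ _ _ _ a0) _.
  apply: (mulfI D0); rewrite /al /be.
  have -> : D * (-2 * t * (a / (4 * D) * C t + b / (4 * D) * T t)) =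
    - t / 2 * (a * C t + b * T t) by field.
  exact: (osc_first_moments b t a0).1.
have dT (t : R) : is_derive t 1 T (- 2 * t * (al * T t - be * C t)).
  apply: is_derive_ptE (is_derive_osc_freq _ _ _ _ a0) _.
  apply: (mulfI D0); rewrite /al /be.
  have -> : D * (-2 * t * (a / (4 * D) * T t - b / (4 * D) * C t)) =
    - t / 2 * (a * T t - b * C t) by field.
  exact: (osc_first_moments b t a0).2.
(* [A + i B] is the transform [C + i T] multiplied by [e^{(al - i be) t^2}], the inverse of the
   expected Gaussian; zero derivatives make the quotient constant. *)
pose A t := expR (al * t ^+ 2) * (C t * cos (be * t ^+ 2) + T t * sin (be * t ^+ 2)).
pose B t := expR (al * t ^+ 2) * (T t * cos (be * t ^+ 2) - C t * sin (be * t ^+ 2)).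
have dA (t : R) : is_derive t 1 A 0.
  have h1 := dC t; have h2 := dT t.
  rewrite /A; apply: is_derive_ptE.
  by rewrite /GRing.scale/=; ring.
have dB (t : R) : is_derive t 1 B 0.
  have h1 := dC t; have h2 := dT t.
  rewrite /B; apply: is_derive_ptE.
  by rewrite /GRing.scale/=; ring.
have A0 : A xi = C 0.
  have -> : A xi = A 0 by exact: is_derive_0_is_cst.
  rewrite /A expr0n !mulr0 expR0 cos0 sin0.
  by ring.
have B0 : B xi = T 0.
  have -> : B xi = B 0 by exact: is_derive_0_is_cst.
  rewrite /B expr0n !mulr0 expR0 cos0 sin0.
  by ring.
rewrite -/(C 0) -/(T 0) -A0 -B0 -/(C xi) -/(T xi).
have ee : expR (- (al * xi ^+ 2)) * expR (al * xi ^+ 2) = 1.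
  by rewrite -expRD addNr expR0.
have := cos2Dsin2 (be * xi ^+ 2).
rewrite /cgauss /A /B mulNr opprK => cs.
apply: eqReIm; rewrite !(ReM, ImM) /= !mul0r ?subr0 ?addr0.
  transitivity ((expR (- (al * xi ^+ 2)) * expR (al * xi ^+ 2)) *
    (cos (be * xi ^+ 2) ^+ 2 + sin (be * xi ^+ 2) ^+ 2) * C xi); first by rewrite ee cs !mul1r.
  by ring.
transitivity ((expR (- (al * xi ^+ 2)) * expR (al * xi ^+ 2)) *
  (cos (be * xi ^+ 2) ^+ 2 + sin (be * xi ^+ 2) ^+ 2) * T xi); first by rewrite ee cs !mul1r.
by ring.
Qed.

(* With [N = |gauss_const a b|^2], [N^2 (a^2 + b^2)] does not depend on [b]. *)
Lemma normc_gauss_const a b : 0 < a ->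
  normc (gauss_const a b) ^+ 4 * (a ^+ 2 + b ^+ 2) = pi ^+ 2.
Proof.
move=> a0; rewrite (_ : normc _ ^+ 4 = (normc (gauss_const a b) ^+ 2) ^+ 2); last by rewrite -exprM.
rewrite sqr_normc gauss_constE /=.
pose C t := osc_int a t 0 0 0; pose T t := osc_int a t 0 0 (0 + pi / 2).
pose D t := a ^+ 2 + t ^+ 2.
have D0 t : D t != 0 by rewrite gt_eqF// ltr_pwDl ?exprn_gt0// sqr_ge0.
have dC (t : R) : is_derive t 1 C ((a * T t - t * C t) / (2 * D t)).
  apply: is_derive_ptE (is_derive_osc_chirp _ _ _ a0) _.
  apply: (mulfI (D0 t)).
  have -> : D t * ((a * T t - t * C t) / (2 * D t)) = (a * T t - t * C t) / 2 by field.
  exact: (osc_second_moments t a0).1.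
have dT (t : R) : is_derive t 1 T (- (a * C t + t * T t) / (2 * D t)).
  apply: is_derive_ptE (is_derive_osc_chirp _ _ _ a0) _.
  apply: (mulfI (D0 t)).
  have -> : D t * (- (a * C t + t * T t) / (2 * D t)) = - (a * C t + t * T t) / 2 by field.
  exact: (osc_second_moments t a0).2.
(* With [K = C + i T], [K' = - i K / (2 (a + i t))], so [|K|^2] has logarithmic derivative
   [- t / (a^2 + t^2)], which cancels the one of the square root of [a^2 + t^2]. *)
pose A t := (C t ^+ 2 + T t ^+ 2) ^+ 2 * (a ^+ 2 + t ^+ 2).
have dA (t : R) : is_derive t 1 A 0.
  have h1 := dC t; have h2 := dT t.
  rewrite /A; apply: is_derive_ptE.
  by have := D0 t; rewrite /GRing.scale/= /D => D1; field.
have Ab : A b = A 0 by exact: is_derive_0_is_cst.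
rewrite -[LHS]/(A b) Ab /A.
have -> : C 0 = Num.sqrt (pi / a).
  have [_ <-] := gauss_int0 a0; apply: eq_Rint => x.
  by rewrite /osc !mul0r !addr0 cos0 expr0 mul1r mulr1.
have -> : T 0 = 0.
  rewrite /T /osc_int /Rintegral integral0_eq// => x _.
  by rewrite /osc !mul0r !add0r cos_pihalf !mulr0.
rewrite expr0n !addr0 sqr_sqrtr ?divr_ge0 ?pi_ge0 ?ltW//.
by field; rewrite gt_eqF.
Qed.

End ComplexGaussian.

(** * Gaussians on R^n *)

Section GaussianRV.
Context {R : realType} {n : nat}.
Implicit Types (x y xi : 'rV[R]_n) (a b : R).

Lemma cgauss_sum a b (I : Type) (s : seq I) (r : I -> R) :
  cgauss a b (\sum_(i <- s) r i) = \prod_(i <- s) cgauss a b (r i).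
Proof.
have cgauss0 : cgauss a b 0 = 1.
  by rewrite /cgauss !mulr0 !oppr0 expR0 expi0 mulr1.
have cgaussD u v : cgauss a b (u + v) = cgauss a b u * cgauss a b v.
  rewrite /cgauss !mulrDr !opprD expRD expiD rmorphM/=; ring.
by elim/big_rec2: _ => // i u v _ <-; rewrite cgaussD.
Qed.

Lemma expi_sum (I : Type) (s : seq I) (r : I -> R) :
  expi (\sum_(i <- s) r i) = \prod_(i <- s) expi (r i).
Proof. by elim/big_rec2: _ => [|i u v _ <-]; [exact: expi0|exact: expiD]. Qed.

Lemma dotv_ge0 x : 0 <= dotv x x.
Proof. by apply: sumr_ge0 => i _; rewrite -expr2 sqr_ge0. Qed.

Lemma enorm_sqr x : enorm x ^+ 2 = dotv x x.
Proof. by rewrite /enorm sqr_sqrtr// dotv_ge0. Qed.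

Lemma dotvC x y : dotv x y = dotv y x.
Proof. by apply: eq_bigr => i _; rewrite mulrC. Qed.

Lemma measurable_dotv d (T : measurableType d) (f g : T -> 'rV[R]_n) :
  measurable_fun setT f -> measurable_fun setT g ->
  measurable_fun setT (fun t => dotv (f t) (g t)).
Proof.
move=> mf mg; rewrite /dotv; apply: measurable_sum => i.
apply: measurable_funM.
  exact: (measurableT_comp (measurable_rV_coord i) mf).
exact: (measurableT_comp (measurable_rV_coord i) mg).
Qed.

Lemma measurable_dotvv : measurable_fun setT (fun x => dotv x x).
Proof. by apply: measurable_dotv; exact: measurable_id. Qed.

(** Wave and Gaussian both factor over the coordinates. The formula is used three times: to build
    [f], to produce the heat kernel in Plancherel's inequality, and to bound the dispersed main part
    of the Bessel potential. *)
Lemma cint_gauss_rV a b xi : 0 < a ->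
  cintegrable (lebesgue_rV n) (fun x => expi (- dotv x xi) * cgauss a b (dotv x x)) /\
  cint (lebesgue_rV n) (fun x => expi (- dotv x xi) * cgauss a b (dotv x x)) =
  gauss_const a b ^+ n *
    cgauss (a / (4 * (a ^+ 2 + b ^+ 2))) (- (b / (4 * (a ^+ 2 + b ^+ 2)))) (dotv xi xi).
Proof.
move=> a0.
have [|i1 i2] := @cint_prod_rV R n (fun i t => expi (- (t * xi ord0 i)) * cgauss a b (t ^+ 2)).
  by move=> i; exact: cintegrable_wave.
have E : (fun x : 'rV[R]_n => expi (- dotv x xi) * cgauss a b (dotv x x)) =
    (fun x => \prod_(i < n) (expi (- (x ord0 i * xi ord0 i)) * cgauss a b (x ord0 i ^+ 2))).
  apply/funext => x; rewrite big_split -expi_sum -cgauss_sum /dotv -sumrN.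
  by congr (_ * cgauss _ _ _); apply: eq_bigr => i _; rewrite expr2.
rewrite E; split => //; rewrite i2.
under eq_bigr do rewrite cint_gauss_wave//.
by rewrite big_split/= -cgauss_sum prodr_const card_ord.
Qed.

Lemma Rint_prod_rV (g : 'I_n -> R -> R) :
  (forall i, rintegrable (@lebesgue_measure R) (g i)) ->
  rintegrable (lebesgue_rV n) (fun x => \prod_(i < n) g i (x ord0 i)) /\
  \int[lebesgue_rV n]_x (\prod_(i < n) g i (x ord0 i)) =
    \prod_(i < n) \int[lebesgue_measure]_t g i t.
Proof.
move=> gi.
have [|[i1 _] i2] := @cint_prod_rV R n (fun i t => (g i t)%:C).
  by move=> i; split => //=; exact: integrable0.
have E x : Re (\prod_(i < n) (g i (x ord0 i))%:C) = \prod_(i < n) g i (x ord0 i).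
  by rewrite -rmorph_prod.
split; first by move: i1; under eq_fun do rewrite E.
under eq_Rint do rewrite -E.
have := congr1 (fun z => Re z) i2; rewrite /= => ->.
rewrite (_ : \prod_(i < n) _ = (\prod_(i < n) \int[lebesgue_measure]_t g i t)%:C)//.
rewrite rmorph_prod; apply: eq_bigr => i _; apply: eqReIm => //=.
by rewrite /Rintegral integral0_eq.
Qed.

(** The centre [y] serves the translates of the heat kernel. *)
Lemma gauss_int_rV a y : 0 < a ->
  rintegrable (lebesgue_rV n) (fun x => expR (- (a * dotv (x - y) (x - y)))) /\
  \int[lebesgue_rV n]_x expR (- (a * dotv (x - y) (x - y))) = Num.sqrt (pi / a) ^+ n.
Proof.
move=> a0.
have [|i1 i2] := @Rint_prod_rV (fun i t => expR (- (a * (t - y ord0 i) ^+ 2))).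
  by move=> i; have [] := gauss_int (y ord0 i) a0.
have E x : expR (- (a * dotv (x - y) (x - y))) =
    \prod_(i < n) expR (- (a * (x ord0 i - y ord0 i) ^+ 2)).
  rewrite /dotv mulr_sumr -sumrN expR_sum; apply: eq_bigr => i _.
  by rewrite !mxE expr2.
split; first by under eq_fun do rewrite E.
under eq_Rint do rewrite E.
rewrite i2; under eq_bigr do rewrite (gauss_int _ a0).2.
by rewrite prodr_const card_ord.
Qed.

Lemma gauss_int0_rV a : 0 < a ->
  rintegrable (lebesgue_rV n) (fun x => expR (- (a * dotv x x))) /\
  \int[lebesgue_rV n]_x expR (- (a * dotv x x)) = Num.sqrt (pi / a) ^+ n.
Proof.
by move=> a0; have [] := gauss_int_rV 0 a0; under eq_fun do rewrite subr0.
Qed.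

End GaussianRV.

(** * Gaussians are Schwartz functions *)

Section SchwartzGaussians.
Context {R : realType} {n : nat}.
Implicit Types (x v : 'rV[R]_n) (g : 'rV[R]_n -> R) (i : 'I_n).

Lemma is_derive_chain g (h : R -> R) x v (dg dh : R) : differentiable g x ->
  is_derive x v g dg -> is_derive (g x) 1 h dh ->
  is_derive x v (fun y => h (g y)) (dh * dg).
Proof.
move=> diffg [_ dgE] [hder dhE].
have diffh : differentiable h (g x) by exact/derivable1_diffP.
have diffhg : differentiable (h \o g) x by exact: differentiable_comp.
split; first exact: diff_derivable.
rewrite -[LHS]/('D_v (h \o g) x) deriveE// diff_comp//=.
rewrite -(deriveE _ diffg) dgE (_ : 'd h (g x) dg = dg *: 'd h (g x) 1).
  by rewrite -(deriveE _ diffh) dhE /GRing.scale/= mulrC.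
by rewrite -linearZ/= /GRing.scale/= mulr1.
Qed.

Lemma is_derive_coord i j x :
  is_derive x (delta_mx ord0 i) (fun y : 'rV[R]_n => y ord0 j) (i == j)%:R.
Proof.
have dc := @differentiable_coord R 1 n x ord0 j.
split; first exact: diff_derivable.
rewrite /derive; apply/cvg_lim => //.
have E h : h != 0 -> h^-1 *: (((fun y : 'rV[R]_n => y ord0 j) \o shift x)
    (h *: delta_mx ord0 i) - x ord0 j) = (i == j)%:R :> R.
  by move=> h0; rewrite /= !mxE addrK eqxx /= /GRing.scale/= mulKf// eq_sym.
apply: cvg_near_cst; near=> h; apply: E; near: h; exact: nbhs_dnbhs_neq.
Unshelve. all: by end_near. Qed.

Lemma differentiable_dotvv x : differentiable (fun y : 'rV[R]_n => dotv y y) x.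
Proof.
rewrite (_ : (fun y => _) = \sum_(i < n) ((fun y : 'rV[R]_n => y ord0 i) * (fun y : 'rV[R]_n => y ord0 i))).
  apply: differentiable_sum => i.
  by apply: differentiableM; exact: differentiable_coord.
by apply/funext => y; rewrite fct_sumE.
Qed.

Lemma is_derive_dotvv i x :
  is_derive x (delta_mx ord0 i) (fun y : 'rV[R]_n => dotv y y) (2 * x ord0 i).
Proof.
split; first by apply: diff_derivable; exact: differentiable_dotvv.
have h (j : 'I_n) := is_derive_coord i j x.
rewrite (_ : (fun y => _) = \sum_(i < n) ((fun y : 'rV[R]_n => y ord0 i) * (fun y : 'rV[R]_n => y ord0 i))); last first.
  by apply/funext => y; rewrite fct_sumE.
rewrite derive_val (bigD1 i)//= big1 => [|j /negPf ji].
  by rewrite eqxx addr0 /GRing.scale/=; ring.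
by rewrite eq_sym ji /GRing.scale/=; ring.
Qed.

(** The phase [c] plays the same part as in [osc]: derivatives shift it by [pi / 2], and the values
    0 and [pi / 2] give the real and imaginary parts of [cgauss]. *)
Definition chirp (a b c : R) : 'rV[R]_n -> R :=
  fun x => expR (- (a * dotv x x)) * cos (b * dotv x x + c).

(* Contains the real and imaginary parts of chirped Gaussians and is stable
   under [partial]. *)
Inductive gaussian_class : ('rV[R]_n -> R) -> Prop :=
| gc_chirp a b c : 0 < a -> gaussian_class (chirp a b c)
| gc_coord i g : gaussian_class g -> gaussian_class (fun x => x ord0 i * g x)
| gc_add g1 g2 : gaussian_class g1 -> gaussian_class g2 ->
    gaussian_class (fun x => g1 x + g2 x)
| gc_scale (k : R) g : gaussian_class g -> gaussian_class (fun x => k * g x).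

Lemma differentiable_chirp a b c x : differentiable (chirp a b c) x.
Proof.
have dq := differentiable_dotvv x.
have c1 (h : R -> R) : (forall t, derivable h t 1) -> differentiable (fun y => h (dotv y y)) x.
  move=> hd; apply: (@differentiable_comp _ _ _ _ (fun y : 'rV[R]_n => dotv y y) h) => //.
  exact/derivable1_diffP.
apply: differentiableM.
  by apply: (c1 (fun t => expR (- (a * t)))) => t; exact: ex_derive.
by apply: (c1 (fun t => cos (b * t + c))) => t; exact: ex_derive.
Qed.

Lemma is_derive_chirp a b c i x : is_derive x (delta_mx ord0 i) (chirp a b c)
  (- (2 * a) * (x ord0 i * chirp a b c x) +
   2 * b * (x ord0 i * chirp a b (c + pi / 2) x)).
Proof.
pose h t := expR (- (a * t)) * cos (b * t + c) : R.
have dh (t : R) : is_derive t 1 h (- a * h t + b * (expR (- (a * t)) * cos (b * t + c + pi / 2))).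
  rewrite /h; apply: is_derive_ptE.
  by rewrite -cosD_pihalf /GRing.scale/=; ring.
have := is_derive_chain (differentiable_dotvv x) (is_derive_dotvv i x) (dh _).
move=> H; apply: is_derive_eq H _.
by rewrite /h /chirp addrA; ring.
Qed.

Lemma gaussian_class_differentiable g x : gaussian_class g -> differentiable g x.
Proof.
elim=> {g} [a b c a0|i g _ IHg|g1 g2 _ IH1 _ IH2|k g _ IHg].
- exact: differentiable_chirp.
- by apply: differentiableM => //; exact: differentiable_coord.
- exact: differentiableD.
- exact: differentiableZ.
Qed.

Lemma gaussian_class_partial i g : gaussian_class g -> gaussian_class (partial i g).
Proof.
have gcE g1 g2 : gaussian_class g1 -> g2 = g1 -> gaussian_class g2 by move=> + ->.
elim=> {g} [a b c a0|j g gg IHg|g1 g2 gg1 IH1 gg2 IH2|k g gg IHg].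
- apply: (gcE (fun x => - (2 * a) * (x ord0 i * chirp a b c x) +
     2 * b * (x ord0 i * chirp a b (c + pi / 2) x))).
    by apply: gc_add; apply: gc_scale; apply: gc_coord; exact: gc_chirp.
  by apply/funext => x; have [_ <-] := is_derive_chirp a b c i x.
- have D x := is_derive_coord i j x.
  have dg x : derivable g x (delta_mx ord0 i).
    by apply: diff_derivable; exact: gaussian_class_differentiable.
  apply: (gcE (fun x => x ord0 j * partial i g x + (i == j)%:R * g x)).
    by apply: gc_add; [exact: gc_coord|exact: gc_scale].
  apply/funext => x; rewrite /partial.
  have := is_deriveM (D x) (derivableP (dg x)) => -[_ ->].
  by rewrite /GRing.scale/=; ring.
- apply: (gcE (fun x => partial i g1 x + partial i g2 x)); first exact: gc_add.
  apply/funext => x; rewrite /partial; apply: deriveD; apply: diff_derivable;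
    exact: gaussian_class_differentiable.
- apply: (gcE (fun x => k * partial i g x)); first exact: gc_scale.
  apply/funext => x; rewrite /partial; apply: deriveZ; apply: diff_derivable;
    exact: gaussian_class_differentiable.
Qed.

(** Each factor [x ord0 i] is absorbed by half of the decay rate, and a sum keeps the smaller of two
    rates; the rate stays positive since the construction is finite. *)
Lemma gaussian_class_bound g : gaussian_class g ->
  exists2 a : R, 0 < a & exists M : R, forall x, `|g x| <= M * expR (- (a * dotv x x)).
Proof.
elim=> {g} [a b c a0|i g _ [a a0 [M HM]]|g1 g2 _ [a a0 [M HM]] _ [a' a0' [M' HM']]|k g _ [a a0 [M HM]]].
- exists a => //; exists 1 => x.
  by rewrite mul1r normrM (ger0_norm (expR_ge0 _)) ler_piMr ?expR_ge0// cos_max.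
- have a20 : 0 < a / 2 by rewrite divr_gt0.
  exists (a / 2) => //; have [L L0 HL] := expR_absorb 1 a20.
  exists (L * `|M|) => x; rewrite normrM.
  have xi : `|x ord0 i| <= 1 + dotv x x.
    have : x ord0 i ^+ 2 <= dotv x x.
      rewrite /dotv (bigD1 i)//= -expr2 lerDl sumr_ge0// => j _.
      by rewrite -expr2 sqr_ge0.
    rewrite -(real_normK (num_real (x ord0 i))).
    by have := sqr_ge0 (`|x ord0 i| - 2^-1); have := normr_ge0 (x ord0 i); nra.
  rewrite (@le_trans _ _ ((L * expR (a / 2 * dotv x x)) * (`|M| * expR (- (a * dotv x x)))))//.
    apply: ler_pM => //.
      by rewrite (le_trans xi)//; have := HL _ (dotv_ge0 x); rewrite expr1.
    by rewrite (le_trans (HM x))// ler_wpM2r ?expR_ge0// ler_norm.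
  rewrite (_ : - (a / 2 * dotv x x) = a / 2 * dotv x x + - (a * dotv x x)); last by field.
  by rewrite expRD le_eqVlt; apply/orP; left; apply/eqP; ring.
- have m0 : 0 < Num.min a a' by rewrite lt_min a0.
  exists (Num.min a a') => //; exists (`|M| + `|M'|) => x.
  have H m L b (h : R) : m <= b -> `|h| <= L * expR (- (b * dotv x x)) ->
      `|h| <= `|L| * expR (- (m * dotv x x)).
    move=> mb /le_trans; apply; rewrite (@le_trans _ _ (`|L| * expR (- (b * dotv x x))))//.
      by rewrite ler_wpM2r ?expR_ge0// ler_norm.
    by rewrite ler_wpM2l// ler_expR lerN2 ler_wpM2r// dotv_ge0.
  rewrite mulrDl (le_trans (ler_normD _ _))// lerD//.
    by apply: H (HM x); rewrite ge_min lexx.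
  by apply: H (HM' x); rewrite ge_min lexx orbT.
- exists a => //; exists (`|k| * M) => x.
  by rewrite normrM -mulrA ler_wpM2l.
Qed.

(** Derivatives and monomial weights both stay in the class, so every Schwartz seminorm is bounded
    by one Gaussian estimate. *)
Lemma gaussian_class_schwartz g : gaussian_class g -> real_schwartz g.
Proof.
move=> gg.
have ig l : gaussian_class (iter_partial l g).
  by elim: l => //= i l; exact: gaussian_class_partial.
split=> [l x|al l]; first exact: gaussian_class_differentiable.
have pX i m k : gaussian_class k -> gaussian_class (fun x => x ord0 i ^+ m * k x).
  move=> gk; elim: m => [|m IHm]; first exact: gc_scale.
  rewrite (_ : (fun x => _) = fun x => x ord0 i * (x ord0 i ^+ m * k x)).
    exact: gc_coord.
  by apply/funext => x; rewrite exprS mulrA.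
have ps (s : seq 'I_n) h : gaussian_class h ->
    gaussian_class (fun x => (\prod_(i <- s) x ord0 i ^+ al i) * h x).
  move=> gh; elim: s => [|i s IHs].
    by under eq_fun do rewrite big_nil; exact: gc_scale.
  under eq_fun do rewrite big_cons -mulrA.
  exact: pX.
have [a a0 [M HM]] := gaussian_class_bound (ps (index_enum 'I_n) _ (ig l)).
exists `|M| => x; apply: le_trans (HM x) _.
rewrite (@le_trans _ _ (`|M| * expR (- (a * dotv x x))))//.
  by rewrite ler_wpM2r ?expR_ge0// ler_norm.
by rewrite ler_piMr// -expR0 ler_expR oppr_le0 mulr_ge0 ?dotv_ge0// ltW.
Qed.

Lemma schwartz_sum_cgauss (N : nat) (c : nat -> R[i]) (a b : nat -> R) :
  (forall k, 0 < a k) ->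
  schwartz (fun x : 'rV[R]_n => \sum_(k < N) c k * cgauss (a k) (b k) (dotv x x)).
Proof.
move=> a0.
suff H : gaussian_class (fun x => Re (\sum_(k < N) c k * cgauss (a k) (b k) (dotv x x)))
    /\ gaussian_class (fun x => Im (\sum_(k < N) c k * cgauss (a k) (b k) (dotv x x))).
  by split; apply: gaussian_class_schwartz; have [] := H.
elim: N => [|N [IH1 IH2]].
  split; under eq_fun do rewrite big_ord0; rewrite /=.
    (* The zero function enters the class as zero times a chirp. *)
    by under eq_fun => x do rewrite -(mul0r (chirp 1 0 0 x)); apply/gc_scale/gc_chirp.
  by under eq_fun => x do rewrite -(mul0r (chirp 1 0 0 x)); apply/gc_scale/gc_chirp.
have re x : Re (c N * cgauss (a N) (b N) (dotv x x)) =
    Re (c N) * chirp (a N) (b N) 0 x + - Im (c N) * chirp (a N) (b N) (0 + pi / 2) x.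
  by rewrite /cgauss !(ReM, ImM) /chirp addrA addr0 -cosD_pihalf /= cosN sinN; ring.
have im x : Im (c N * cgauss (a N) (b N) (dotv x x)) =
    Im (c N) * chirp (a N) (b N) 0 x + Re (c N) * chirp (a N) (b N) (0 + pi / 2) x.
  by rewrite /cgauss !(ReM, ImM) /chirp addrA addr0 -cosD_pihalf /= cosN sinN; ring.
split; under eq_fun do rewrite big_ord_recr /= ?ReD ?ImD ?re ?im.
  by apply: gc_add => //; apply: gc_add; apply: gc_scale; exact: gc_chirp.
by apply: gc_add => //; apply: gc_add; apply: gc_scale; exact: gc_chirp.
Qed.

End SchwartzGaussians.

(** * Plancherel's inequality *)

Section ParametricMeasurability.
Context d1 d2 (T1 : measurableType d1) (T2 : measurableType d2) (R : realType).
Variable m2 : {sigma_finite_measure set T2 -> \bar R}.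

(** Tonelli's measurability concerns nonnegative functions, so the positive and negative parts of
    [f] are integrated apart. *)
Lemma measurable_Rint (f : T1 -> T2 -> R) :
  measurable_fun setT (fun z : T1 * T2 => f z.1 z.2) ->
  measurable_fun setT (fun x => \int[m2]_y f x y).
Proof.
move=> mf; pose g (z : T1 * T2) := (f z.1 z.2)%:E.
have mg : measurable_fun setT g by exact/measurable_EFinP.
rewrite /Rintegral; apply: measurableT_comp => //.
rewrite (_ : (fun x => _) = (fun x => (\int[m2]_y g^\+ (x, y) - \int[m2]_y g^\- (x, y))%E)).
  apply: emeasurable_funB; apply: measurable_fun_fubini_tonelli_F => //.
    exact: measurable_funepos.
  exact: measurable_funeneg.
apply/funext => x; rewrite integralE; congr (_ - _)%E.
  by apply: eq_integral => y _; rewrite !funeposE.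
by apply: eq_integral => y _; rewrite !funenegE.
Qed.

End ParametricMeasurability.

Section Plancherel.
Context {R : realType} {n : nat}.
Local Notation mu := (@lebesgue_rV R n).
Implicit Types (x xi eta : 'rV[R]_n) (rho : 'rV[R]_n -> R).

Lemma dotvBr x xi eta : dotv x (xi - eta) = dotv x xi - dotv x eta.
Proof.
by rewrite /dotv -sumrB; apply: eq_bigr => i _; rewrite !mxE mulrBr.
Qed.

Lemma dotvNr x xi : dotv x (- xi) = - dotv x xi.
Proof. by rewrite /dotv -sumrN; apply: eq_bigr => i _; rewrite !mxE mulrN. Qed.

Lemma dotvBB xi eta :
  dotv (xi - eta) (xi - eta) = dotv xi xi - 2 * dotv xi eta + dotv eta eta.
Proof.
rewrite dotvBr dotvC dotvBr [X in _ - X]dotvC dotvBr (dotvC eta xi); ring.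
Qed.

Lemma measurable_dotv2 :
  measurable_fun setT (fun z : 'rV[R]_n * 'rV[R]_n => dotv z.1 z.2).
Proof. by apply: measurable_dotv; [exact: measurable_fst|exact: measurable_snd]. Qed.

Lemma measurable_fun1 (f : 'rV[R]_n -> R) : measurable_fun setT f ->
  measurable_fun setT (fun z : 'rV[R]_n * 'rV[R]_n => f z.1).
Proof. by move=> mf; apply: (measurableT_comp mf); exact: measurable_fst. Qed.

Lemma measurable_fun2 (f : 'rV[R]_n -> R) : measurable_fun setT f ->
  measurable_fun setT (fun z : 'rV[R]_n * 'rV[R]_n => f z.2).
Proof. by move=> mf; apply: (measurableT_comp mf); exact: measurable_snd. Qed.

Lemma measurable_cosf d (T : measurableType d) (f : T -> R) :
  measurable_fun setT f -> measurable_fun setT (fun t => cos (f t)).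
Proof.
move=> mf; apply: measurableT_comp => //.
by apply: continuous_measurable_fun; exact: continuous_cos.
Qed.

Lemma measurable_sinf d (T : measurableType d) (f : T -> R) :
  measurable_fun setT f -> measurable_fun setT (fun t => sin (f t)).
Proof.
move=> mf; apply: measurableT_comp => //.
by apply: continuous_measurable_fun; exact: continuous_sin.
Qed.

(** With [sin_transform], the real and imaginary parts of the integral of [e^{i x . xi} rho(xi)];
    Plancherel is first proved for real densities. *)
Definition cos_transform rho x : R := \int[mu]_xi (cos (dotv x xi) * rho xi).
Definition sin_transform rho x : R := \int[mu]_xi (sin (dotv x xi) * rho xi).

Lemma measurable_dotvr x : measurable_fun setT (dotv x).
Proof. by apply: measurable_dotv; [exact: measurable_cst|exact: measurable_id]. Qed.

Lemma rintegrable_cos rho x : rintegrable mu rho ->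
  rintegrable mu (fun xi => cos (dotv x xi) * rho xi).
Proof.
move=> ri; apply: (@rintegrable_bounded _ _ _ _ 1) => //.
  by apply: measurable_cosf; exact: measurable_dotvr.
by move=> xi; exact: cos_max.
Qed.

Lemma rintegrable_sin rho x : rintegrable mu rho ->
  rintegrable mu (fun xi => sin (dotv x xi) * rho xi).
Proof.
move=> ri; apply: (@rintegrable_bounded _ _ _ _ 1) => //.
  by apply: measurable_sinf; exact: measurable_dotvr.
by move=> xi; exact: sin_max.
Qed.

Lemma measurable_cos_transform rho : measurable_fun setT rho ->
  measurable_fun setT (cos_transform rho).
Proof.
move=> mr; apply: (@measurable_Rint _ _ _ _ _ mu (fun x xi => cos (dotv x xi) * rho xi)).
apply: measurable_funM; last exact: measurable_fun2.
by apply: measurable_cosf; exact: measurable_dotv2.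
Qed.

Lemma measurable_sin_transform rho : measurable_fun setT rho ->
  measurable_fun setT (sin_transform rho).
Proof.
move=> mr; apply: (@measurable_Rint _ _ _ _ _ mu (fun x xi => sin (dotv x xi) * rho xi)).
apply: measurable_funM; last exact: measurable_fun2.
by apply: measurable_sinf; exact: measurable_dotv2.
Qed.

Lemma cos_gauss_rV (e : R) xi : 0 < e ->
  \int[mu]_x (expR (- (e * dotv x x)) * cos (dotv x xi)) =
  Num.sqrt (pi / e) ^+ n * expR (- ((4 * e)^-1 * dotv xi xi)).
Proof.
move=> e0; have [_ H] := @cint_gauss_rV R n e 0 xi e0.
have gc : gauss_const e 0 = (Num.sqrt (pi / e))%:C.
  rewrite /gauss_const; apply: eqReIm => /=.
    have [_ <-] := gauss_int0 e0; apply: eq_Rint => t.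
    by rewrite /= !mul0r oppr0 cos0 mulr1 addr0.
  by rewrite /Rintegral integral0_eq// => t _; rewrite !mul0r oppr0 sin0 mulr0 addr0.
have Ex : cgauss (e / (4 * (e ^+ 2 + 0 ^+ 2))) (- (0 / (4 * (e ^+ 2 + 0 ^+ 2))))
    (dotv xi xi) = (expR (- ((4 * e)^-1 * dotv xi xi)))%:C.
  rewrite /cgauss mul0r oppr0 mul0r oppr0 expi0 mulr1 expr0n addr0.
  suff -> : e / (4 * e ^+ 2) = (4 * e)^-1 by [].
  by field; rewrite gt_eqF.
rewrite gc Ex -rmorphXn -rmorphM in H.
have := congr1 (fun z => Re z) H => /= <-; apply: eq_Rint => x.
by rewrite !(mul0r, mulr0, oppr0, cos0, sin0, cosN, addr0, subr0, mulr1) mulrC.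
Qed.

(** The Fourier transform of [e^{- e |x|^2}]: a heat kernel of mass [(2 pi)^n], whatever [e]. *)
Definition heat (e : R) xi := Num.sqrt (pi / e) ^+ n * expR (- ((4 * e)^-1 * dotv xi xi)).

Lemma heat_ge0 e xi : 0 <= heat e xi.
Proof. by rewrite mulr_ge0 ?exprn_ge0 ?expR_ge0. Qed.

Lemma heatC e xi eta : heat e (xi - eta) = heat e (eta - xi).
Proof. by rewrite /heat -(opprB eta xi) dotvNr dotvC dotvNr opprK. Qed.

Lemma heat_int e eta : 0 < e ->
  rintegrable mu (fun xi => heat e (xi - eta)) /\
  \int[mu]_xi heat e (xi - eta) = (2 * pi) ^+ n.
Proof.
move=> e0; have e4 : 0 < (4 * e)^-1 by rewrite invr_gt0 mulr_gt0.
have [i1 i2] := @gauss_int_rV R n _ eta e4.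
rewrite /heat; split; first exact: rintegrableZ.
rewrite RintZ// i2 -exprMn -sqrtrM; last by rewrite divr_ge0 ?pi_ge0// ltW.
congr (_ ^+ n); rewrite [X in Num.sqrt X](_ : _ = (2 * pi) ^+ 2); last by field; rewrite gt_eqF.
by rewrite sqrtr_sqr ger0_norm// mulr_ge0 ?pi_ge0.
Qed.

Lemma measurable_heat2 e :
  measurable_fun setT (fun z : 'rV[R]_n * 'rV[R]_n => heat e (z.1 - z.2)).
Proof.
under eq_fun do rewrite /heat dotvBB.
apply: measurable_funM => //; apply: measurableT_comp => //; apply: measurableT_comp => //.
apply: measurable_funM => //; apply: measurable_funD; last by exact: (measurable_fun2 measurable_dotvv).
apply: measurable_funB; first by exact: (measurable_fun1 measurable_dotvv).
by apply: measurable_funM => //; exact: measurable_dotv2.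
Qed.

Lemma heat_int_sym e xi : 0 < e ->
  rintegrable mu (fun eta => heat e (xi - eta)) /\
  \int[mu]_eta heat e (xi - eta) = (2 * pi) ^+ n.
Proof.
move=> e0; have [i1 i2] := heat_int xi e0; split.
  by under eq_fun do rewrite heatC.
by under eq_Rint do rewrite heatC.
Qed.

(** One half of Schur's test: integrating in [xi] first, the kernel has the same mass for each
    [eta]. The bound on [g] makes every section integrable. *)
Lemma heat_convolution_int e (g : 'rV[R]_n -> R) : 0 < e -> (forall x, 0 <= g x) ->
  rintegrable mu g -> measurable_fun setT g -> (exists M, forall x, g x <= M) ->
  [/\ rintegrable mu (fun xi => \int[mu]_eta (g eta * heat e (xi - eta))),
      forall xi, rintegrable mu (fun eta => g eta * heat e (xi - eta)) &
      \int[mu]_xi \int[mu]_eta (g eta * heat e (xi - eta)) =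
        (2 * pi) ^+ n * \int[mu]_eta g eta].
Proof.
move=> e0 g0 gi mg [M gM].
have sec xi : rintegrable mu (fun eta => g eta * heat e (xi - eta)).
  apply: (@rintegrable_bounded _ _ _ _ M) => //; last exact: (heat_int_sym xi e0).1.
  by move=> x; rewrite ger0_norm.
have sec' eta : rintegrable mu (fun xi => g eta * heat e (xi - eta)).
  by apply: rintegrableZ; exact: (heat_int eta e0).1.
have mF : measurable_fun setT (fun z : 'rV[R]_n * 'rV[R]_n => (g z.2 * heat e (z.1 - z.2))%:E).
  apply/measurable_EFinP; apply: measurable_funM; last exact: measurable_heat2.
  exact: measurable_fun2.
have inner eta : (\int[mu]_xi `|g eta * heat e (xi - eta)|%:E)%E = ((2 * pi) ^+ n * g eta)%:E.
  under eq_integral do rewrite ger0_norm ?mulr_ge0 ?heat_ge0//.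
  rewrite (RintE (sec' eta)) RintZ; last exact: (heat_int eta e0).1.
  by rewrite (heat_int eta e0).2 mulrC.
have Fi : rintegrable (mu \x mu)%E (fun z => g z.2 * heat e (z.1 - z.2)).
  apply/integrable21ltyP => //=; under eq_integral do rewrite inner.
  by rewrite RintE ?ltry//; exact: rintegrableZ.
split => //.
  have := integrable_fubini_F Fi; rewrite /fubini_F /=.
  by under [X in _.-integrable _ X -> _]eq_fun do rewrite (RintE (sec _)).
rewrite (Rint_Fubini (f := fun xi eta => g eta * heat e (xi - eta)) Fi sec sec').
under eq_Rint.
  move=> eta; rewrite RintZ; last exact: (heat_int eta e0).1.
  rewrite (heat_int eta e0).2 mulrC; over.
by rewrite /= RintZ.
Qed.

End Plancherel.

Section DominatedFubini.
Context d1 d2 (T1 : measurableType d1) (T2 : measurableType d2) (R : realType).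
Variables (m1 : {sigma_finite_measure set T1 -> \bar R})
          (m2 : {sigma_finite_measure set T2 -> \bar R}).

(** Domination by a product of integrable functions yields integrability on the product and on every
    section at once. *)
Lemma Fubini_dominated (f : T1 -> T2 -> R) (u : T1 -> R) (v : T2 -> R) :
  measurable_fun setT (fun z : T1 * T2 => f z.1 z.2) ->
  rintegrable m1 u -> rintegrable m2 v ->
  (forall x y, `|f x y| <= u x * v y) ->
  [/\ forall x, rintegrable m2 (f x),
      forall y, rintegrable m1 (f ^~ y),
      rintegrable m2 (fun y => \int[m1]_x f x y) &
      \int[m1]_x \int[m2]_y f x y = \int[m2]_y \int[m1]_x f x y].
Proof.
move=> mf ui vi fuv.
have fi : rintegrable (m1 \x m2)%E (fun z => f z.1 z.2).
  by apply: rintegrable_le (rintegrable_prod ui vi) _ => // z; exact: fuv.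
have f1 x : rintegrable m2 (f x).
  apply: (@rintegrable_le _ _ _ m2 _ (fun y => u x * v y)) => //.
    exact: (measurableT_comp mf (pair1_measurable x)).
  exact: rintegrableZ.
have f2 y : rintegrable m1 (f ^~ y).
  apply: (@rintegrable_le _ _ _ m1 _ (fun x => v y * u x)).
  - exact: (measurableT_comp mf (pair2_measurable y)).
  - exact: rintegrableZ.
  - by move=> x; rewrite mulrC.
split => //; last exact: Rint_Fubini.
have fi' : rintegrable (m2 \x m1)%E (fun z => f z.2 z.1).
  apply: rintegrable_le (rintegrable_prod vi ui) _.
    have msw : measurable_fun setT (fun z : T2 * T1 => (z.2, z.1)).
      by apply: measurable_fun_pair; [exact: measurable_snd|exact: measurable_fst].
    exact: (measurableT_comp mf msw).
  by move=> z; rewrite mulrC.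
have := integrable_fubini_F fi'; rewrite /fubini_F /=.
by under [X in _.-integrable _ X -> _]eq_fun do rewrite (RintE (f2 _)).
Qed.

End DominatedFubini.

Lemma norm_damped (R : realDomainType) (a b c : R) : 0 <= a -> `|b| <= 1 ->
  `|a * (b * c)| <= a * `|c|.
Proof. by move=> a0 b1; rewrite !normrM (ger0_norm a0) ler_wpM2l// ler_piMl. Qed.

Section GaussianPlancherel.
Context {R : realType} {n : nat}.
Local Notation mu := (@lebesgue_rV R n).
Implicit Types (x xi eta : 'rV[R]_n) (rho : 'rV[R]_n -> R).

Lemma cos_transform_bound rho x : rintegrable mu rho ->
  `|cos_transform rho x| <= \int[mu]_xi `|rho xi|.
Proof.
move=> ri; apply: Rint_norm_le.
- exact: rintegrable_measurable (rintegrable_cos x ri).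
- exact: (integrable_norm ri).
- by move=> xi; rewrite normrM ler_piMl// cos_max.
Qed.

Lemma sin_transform_bound rho x : rintegrable mu rho ->
  `|sin_transform rho x| <= \int[mu]_xi `|rho xi|.
Proof.
move=> ri; apply: Rint_norm_le.
- exact: rintegrable_measurable (rintegrable_sin x ri).
- exact: (integrable_norm ri).
- by move=> xi; rewrite normrM ler_piMl// sin_max.
Qed.

(* Writing the square as a double integral, the Gaussian weight turns the
   oscillating factor into a heat kernel, to which Schur's test applies. *)
Lemma plancherel_gauss rho (e M : R) : 0 < e -> rintegrable mu rho ->
  (forall xi, `|rho xi| <= M) ->
  rintegrable mu (fun x => expR (- (e * dotv x x)) *
    (cos_transform rho x ^+ 2 + sin_transform rho x ^+ 2)) /\
  \int[mu]_x (expR (- (e * dotv x x)) *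
    (cos_transform rho x ^+ 2 + sin_transform rho x ^+ 2)) <=
  (2 * pi) ^+ n * \int[mu]_xi (rho xi ^+ 2).
Proof.
move=> e0 ri rM.
pose g x := expR (- (e * dotv x x)).
have g0 x : 0 <= g x by exact: expR_ge0.
pose c := cos_transform rho; pose s := sin_transform rho.
pose N := \int[mu]_xi `|rho xi|.
have N0 : 0 <= N by exact: Rint_ge0.
have cN x : `|c x| <= N by exact: cos_transform_bound.
have sN x : `|s x| <= N by exact: sin_transform_bound.
have AN x : `|c x ^+ 2 + s x ^+ 2| <= N ^+ 2 + N ^+ 2.
  rewrite ger0_norm; last by apply: addr_ge0; exact: sqr_ge0.
  by apply: lerD; rewrite -[X in X <= _]real_normK ?num_real//; apply: lerXn2r;
    rewrite ?nnegrE.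
have mr := rintegrable_measurable ri.
have mc : measurable_fun setT c by exact: measurable_cos_transform.
have ms : measurable_fun setT s by exact: measurable_sin_transform.
have [gi _] := @gauss_int0_rV R n e e0.
have mg := rintegrable_measurable gi.
have rni : rintegrable mu (fun xi => `|rho xi|) by exact: (integrable_norm ri).
have r2i : rintegrable mu (fun xi => rho xi ^+ 2).
  by under eq_fun do rewrite expr2; exact: rintegrable_bounded rM ri.
have mr2 := rintegrable_measurable r2i.
(* The real part of [e^{- i x . xi} (c x + i s x)]; integrated against [rho] it returns
   [c^2 + s^2]. *)
pose H x xi := cos (dotv x xi) * c x + sin (dotv x xi) * s x.
have mcos2 : measurable_fun setT (fun z : 'rV[R]_n * 'rV[R]_n => cos (dotv z.1 z.2)).
  by apply: measurable_cosf; exact: measurable_dotv2.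
have msin2 : measurable_fun setT (fun z : 'rV[R]_n * 'rV[R]_n => sin (dotv z.1 z.2)).
  by apply: measurable_sinf; exact: measurable_dotv2.
have HN x xi : `|H x xi| <= 2 * N.
  rewrite /H (le_trans (ler_normD _ _))// mulr2n mulrDl mul1r !normrM.
  apply: lerD; rewrite -[leRHS]mul1r; apply: ler_pM => //; [exact: cos_max|exact: sin_max].
have A_E x : c x ^+ 2 + s x ^+ 2 = \int[mu]_xi (rho xi * H x xi).
  rewrite !expr2 {1}/c /cos_transform {2}/s /sin_transform mulrC.
  have h1 := rintegrable_cos x ri; have h2 := rintegrable_sin x ri.
  rewrite -!RintZ// -RintD; [|exact: rintegrableZ..].
  by apply: eq_Rint => xi; rewrite /H; ring.
(* [H x xi] is the cosine transform of [rho] recentred at [xi]; by Fubini the Gaussian weight meets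
   the cosine alone and gives the kernel. *)
have B_E xi : \int[mu]_x (g x * H x xi) = \int[mu]_eta (rho eta * heat e (xi - eta)).
  have ic x : rintegrable mu (fun eta => cos (dotv x (xi - eta)) * rho eta).
    apply: (@rintegrable_bounded _ _ _ _ 1) => //; last by move=> eta; exact: cos_max.
    apply: measurable_cosf; under eq_fun do rewrite dotvBr.
    by apply: measurable_funB; [exact: measurable_cst|exact: measurable_dotvr].
  have Hx x : H x xi = \int[mu]_eta (cos (dotv x (xi - eta)) * rho eta).
    have h1 := rintegrable_cos x ri; have h2 := rintegrable_sin x ri.
    rewrite -[LHS]/(_ * cos_transform rho x + _ * sin_transform rho x).
    rewrite -(RintZ (cos (dotv x xi)) h1) -(RintZ (sin (dotv x xi)) h2).
    rewrite -RintD; [|exact: rintegrableZ..].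
    by apply: eq_Rint => eta; rewrite dotvBr cosB; ring.
  have ig eta : rintegrable mu (fun x => g x * cos (dotv x (xi - eta))).
    apply: (@rintegrable_le _ _ _ mu _ g) => //.
      apply: measurable_funM => //; apply: measurable_cosf.
      by apply: measurable_dotv; [exact: measurable_id|exact: measurable_cst].
    move=> x; rewrite normrM (ger0_norm (g0 _)).
    by apply: ler_piMr; [exact: g0|exact: cos_max].
  have Geta eta : \int[mu]_x (g x * (cos (dotv x (xi - eta)) * rho eta)) =
      rho eta * heat e (xi - eta).
    rewrite -[heat e _](cos_gauss_rV (xi - eta) e0) -(RintZ (rho eta) (ig eta)).
    by apply: eq_Rint => x; rewrite mulrA mulrC.
  have mK : measurable_fun setT (fun z : 'rV[R]_n * 'rV[R]_n =>
      g z.1 * (cos (dotv z.1 (xi - z.2)) * rho z.2)).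
    apply: measurable_funM; first exact: (measurable_fun1 mg).
    apply: measurable_funM; last exact: (measurable_fun2 mr).
    apply: measurable_cosf; under eq_fun do rewrite dotvBr.
    apply: measurable_funB; last exact: measurable_dotv2.
    by apply: measurable_dotv; [exact: measurable_fst|exact: measurable_cst].
  have Kb x eta : `|g x * (cos (dotv x (xi - eta)) * rho eta)| <= g x * `|rho eta|.
    by apply: norm_damped; [exact: g0|exact: cos_max].
  have [_ _ _ K4] := Fubini_dominated (f := fun x eta => g x * (cos (dotv x (xi - eta)) * rho eta)) mK gi rni Kb.
  transitivity (\int[mu]_x \int[mu]_eta (g x * (cos (dotv x (xi - eta)) * rho eta))).
    by apply: eq_Rint => x; rewrite Hx; exact: (esym (RintZ (g x) (ic x))).
  by rewrite K4; apply: eq_Rint => eta; exact: Geta.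
have mF : measurable_fun setT (fun z : 'rV[R]_n * 'rV[R]_n => g z.1 * (rho z.2 * H z.1 z.2)).
  apply: measurable_funM; first exact: (measurable_fun1 mg).
  apply: measurable_funM; first exact: (measurable_fun2 mr).
  by apply: measurable_funD; apply: measurable_funM => //; exact: measurable_fun1.
have Fb x xi : `|g x * (rho xi * H x xi)| <= 2 * N * g x * `|rho xi|.
  rewrite !normrM (ger0_norm (g0 _)).
  rewrite [X in _ <= X](_ : _ = g x * (`|rho xi| * (2 * N))); last by ring.
  by rewrite ler_wpM2l ?g0// ler_wpM2l.
have iH x : rintegrable mu (fun xi => rho xi * H x xi).
  apply: (@rintegrable_le _ _ _ mu _ (fun xi => 2 * N * `|rho xi|)).
  - apply: measurable_funM => //; apply: measurable_funD; apply: measurable_funM => //.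
      by apply: measurable_cosf; exact: measurable_dotvr.
    by apply: measurable_sinf; exact: measurable_dotvr.
  - exact: rintegrableZ.
  - by move=> xi; rewrite normrM mulrC ler_wpM2r.
have igH xi : rintegrable mu (fun x => g x * H x xi).
  apply: (@rintegrable_le _ _ _ mu _ (fun x => 2 * N * g x)).
  - apply: measurable_funM => //; apply: measurable_funD; apply: measurable_funM => //.
      by apply: measurable_cosf; apply: measurable_dotv; [exact: measurable_id|exact: measurable_cst].
    by apply: measurable_sinf; apply: measurable_dotv; [exact: measurable_id|exact: measurable_cst].
  - exact: rintegrableZ.
  - by move=> x; rewrite normrM (ger0_norm (g0 _)) mulrC ler_wpM2r ?g0.
have uNi : rintegrable mu (fun x => 2 * N * g x) by exact: rintegrableZ.
have [_ _ F3 F4] := Fubini_dominated (f := fun x xi => g x * (rho xi * H x xi)) mF uNi rni Fb.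
pose B xi := \int[mu]_eta (rho eta * heat e (xi - eta)).
have FB xi : \int[mu]_x (g x * (rho xi * H x xi)) = rho xi * B xi.
  rewrite /B -B_E -(RintZ (rho xi) (igH xi)).
  by apply: eq_Rint => x; rewrite mulrCA.
have tot : \int[mu]_x (g x * (c x ^+ 2 + s x ^+ 2)) = \int[mu]_xi (rho xi * B xi).
  transitivity (\int[mu]_x \int[mu]_xi (g x * (rho xi * H x xi))).
    by apply: eq_Rint => x; rewrite A_E; exact: (esym (RintZ (g x) (iH x))).
  by rewrite F4; apply: eq_Rint => xi; exact: FB.
have BI : rintegrable mu (fun xi => rho xi * B xi).
  by move: F3; under eq_fun do rewrite FB.
have Ai : rintegrable mu (fun x => g x * (c x ^+ 2 + s x ^+ 2)).
  have mcs : measurable_fun setT (fun x => c x ^+ 2 + s x ^+ 2).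
    by apply: measurable_funD; exact: measurable_funX.
  apply: (@rintegrable_le _ _ _ mu _ (fun x => (N ^+ 2 + N ^+ 2) * g x)).
  - exact: measurable_funM.
  - exact: rintegrableZ.
  - move=> x; rewrite normrM (ger0_norm (g0 _)) mulrC.
    by apply: ler_wpM2r; [exact: g0|exact: AN].
split; first exact: Ai.
rewrite [X in X <= _]tot.
move: {mF Fb iH igH F3 F4 FB A_E B_E tot Ai uNi HN} BI => BI.
have r2M xi : rho xi ^+ 2 <= M ^+ 2.
  by rewrite -(real_normK (num_real (rho xi))) lerXn2r ?nnegrE// (le_trans _ (rM xi)).
have [W1 W2 W3] := heat_convolution_int e0 (fun x => sqr_ge0 (rho x)) r2i mr2 (ex_intro _ _ r2M).
(* [2 u v <= u^2 + v^2] under the kernel: the [u^2] term sees its full mass [(2 pi)^n], the [v^2]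
   term is left to [heat_convolution_int]. *)
have key xi : rho xi * B xi <= 2^-1 * (2 * pi) ^+ n * rho xi ^+ 2 +
    2^-1 * \int[mu]_eta (rho eta ^+ 2 * heat e (xi - eta)).
  have [h1 h2] := heat_int_sym xi e0.
  have i1 : rintegrable mu (fun eta => rho eta * heat e (xi - eta)).
    exact: rintegrable_bounded rM h1.
  rewrite /B -h2 -mulrA (mulrC (\int[mu]_eta _)) -!RintZ//; last exact: rintegrableZ.
  rewrite -RintD; [|by do 2!apply: rintegrableZ|exact: rintegrableZ].
  apply: Rint_le; [exact: rintegrableZ|by apply: rintegrableD; do 2?apply: rintegrableZ|].
  move=> eta; have h0 := heat_ge0 e (xi - eta).
  move: (heat e (xi - eta)) (rho xi) (rho eta) h0 => h u v h0.
  rewrite mulrA [X in _ <= X](_ : _ = (2^-1 * (u ^+ 2 + v ^+ 2)) * h); last by ring.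
  rewrite ler_wpM2r//; have := sqr_ge0 (u - v).
  by rewrite sqrrB; lra.
apply: (le_trans (Rint_le BI _ key)).
  by apply: rintegrableD; exact: rintegrableZ.
rewrite RintD; [|exact: rintegrableZ..].
rewrite RintZ// [X in _ + X]RintZ// W3.
by rewrite le_eqVlt; apply/orP; left; apply/eqP; field.
Qed.

End GaussianPlancherel.

Section PlancherelInequality.
Context {R : realType} {n : nat}.
Local Notation mu := (@lebesgue_rV R n).
Implicit Types (x xi eta : 'rV[R]_n) (rho : 'rV[R]_n -> R).

(** The Gaussian weight increases to 1 along [e = 1 / (k + 1)], and monotone convergence passes the
    uniform bound to the limit. *)
Lemma plancherel_le rho (M : R) : rintegrable mu rho ->
  (forall xi, `|rho xi| <= M) ->
  (\int[mu]_x (cos_transform rho x ^+ 2 + sin_transform rho x ^+ 2)%:E <=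
   ((2 * pi) ^+ n * \int[mu]_xi (rho xi ^+ 2))%:E)%E.
Proof.
move=> ri rM.
pose A x := cos_transform rho x ^+ 2 + sin_transform rho x ^+ 2.
have A0 x : 0 <= A x by apply: addr_ge0; exact: sqr_ge0.
have mr := rintegrable_measurable ri.
have mA : measurable_fun setT A.
  apply: measurable_funD; apply: measurable_funX.
    exact: measurable_cos_transform.
  exact: measurable_sin_transform.
pose e (k : nat) : R := k.+1%:R^-1.
have e0 k : 0 < e k by rewrite invr_gt0 ltr0n.
pose g (k : nat) x := (expR (- (e k * dotv x x)) * A x)%:E.
have mg k : measurable_fun setT (g k).
  apply/measurable_EFinP; apply: measurable_funM => //.
  by have [/rintegrable_measurable] := @gauss_int0_rV R n _ (e0 k).
have g0 k x : [set: 'rV[R]_n] x -> (0 <= g k x)%E.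
  by move=> _; rewrite lee_fin mulr_ge0 ?expR_ge0.
have ndg x : [set: 'rV[R]_n] x -> {homo g ^~ x : k m / (k <= m)%N >-> (k <= m)%E}.
  move=> _ k m km; rewrite lee_fin ler_wpM2r// ler_expR lerN2 ler_wpM2r ?dotv_ge0//.
  by rewrite lef_pV2 ?posrE ?ltr0n// ler_nat.
have lg x : limn (g ^~ x) = (A x)%:E.
  apply/cvg_lim => //; apply: cvg_EFin; first by near=> k.
  rewrite (_ : _ \o _ = fun k => expR (- (e k * dotv x x)) * A x)//.
  have c0 : (fun k => - (e k * dotv x x)) @ \oo --> (0 : R).
    rewrite -[X in _ --> X]oppr0; apply: cvgN.
    rewrite -[X in _ --> X](mul0r (dotv x x)); apply: cvgMr_tmp.
    exact: cvg_harmonic.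
  have c1 := cvg_comp _ _ c0 (@continuous_expR R 0).
  rewrite expR0 in c1.
  by rewrite -[X in _ --> X]mul1r; apply: cvgMr_tmp; exact: c1.
have := @cvg_monotone_convergence _ _ _ mu _ measurableT g mg g0 ndg.
under eq_integral do rewrite lg.
move=> cv; rewrite -(cvg_lim _ cv)//.
apply: lime_le; first by apply/cvg_ex; eexists; exact: cv.
apply: nearW => k; have [i1 i2] := plancherel_gauss (e0 k) ri rM.
by rewrite (RintE i1) lee_fin.
Unshelve. all: by end_near. Qed.

Lemma cint_waveE (t : R) rho x :
  cint mu (fun xi => expi (dotv x xi) * (expi (t * dotv xi xi) * (rho xi)%:C)) =
  (\int[mu]_xi (cos (dotv x xi + t * dotv xi xi) * rho xi)) +i*
  (\int[mu]_xi (sin (dotv x xi + t * dotv xi xi) * rho xi)).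
Proof.
transitivity (cint mu (fun xi => expi (dotv x xi + t * dotv xi xi) * (rho xi)%:C)).
  by apply: eq_cint => xi; rewrite mulrA -expiD.
by apply: eqReIm => /=; apply: eq_Rint => xi; rewrite mulr0 ?subr0 ?add0r.
Qed.

Lemma measurable_wave_phase (t : R) x :
  measurable_fun setT (fun xi : 'rV[R]_n => dotv x xi + t * dotv xi xi).
Proof.
apply: measurable_funD; first exact: measurable_dotvr.
by apply: measurable_funM => //; exact: measurable_dotvv.
Qed.

Lemma cmeasurable_wave (t : R) rho x : measurable_fun setT rho ->
  cmeasurable (fun xi => expi (dotv x xi) * (expi (t * dotv xi xi) * (rho xi)%:C)).
Proof.
move=> mr; apply: cmeasurableM.
  by apply: cmeasurable_expi; exact: measurable_dotvr.
apply: cmeasurableM; last exact: cmeasurable_real.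
by apply: cmeasurable_expi; apply: measurable_funM => //; exact: measurable_dotvv.
Qed.

Lemma normc_wave (t : R) rho x xi :
  normc (expi (dotv x xi) * (expi (t * dotv xi xi) * (rho xi)%:C)) = `|rho xi|.
Proof.
by rewrite !ComplexField.Normc.normcM !normc_expi !mul1r normc_real.
Qed.

(** The chirped density is [r1 + i r2] with [r1^2 + r2^2 = rho^2], so the chirp costs nothing in
    L^2. The factor 2 comes from [(u - z)^2 + (v + w)^2 <= 2 (u^2 + v^2 + w^2 + z^2)], when the
    transforms of [r1] and [r2] are recombined. *)
Lemma plancherel_wave (t : R) rho (M : R) : rintegrable mu rho ->
  (forall xi, `|rho xi| <= M) ->
  (\int[mu]_x (normc (cint mu (fun xi =>
     expi (dotv x xi) * (expi (t * dotv xi xi) * (rho xi)%:C))) ^+ 2)%:E <=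
   (2 * ((2 * pi) ^+ n * \int[mu]_xi (rho xi ^+ 2)))%:E)%E.
Proof.
move=> ri rM.
pose r1 xi := cos (t * dotv xi xi) * rho xi.
pose r2 xi := sin (t * dotv xi xi) * rho xi.
have mt : measurable_fun setT (fun xi : 'rV[R]_n => t * dotv xi xi).
  by apply: measurable_funM => //; exact: measurable_dotvv.
have r1i : rintegrable mu r1.
  apply: (@rintegrable_bounded _ _ _ _ 1) => //; first exact: measurable_cosf.
  by move=> xi; exact: cos_max.
have r2i : rintegrable mu r2.
  apply: (@rintegrable_bounded _ _ _ _ 1) => //; first exact: measurable_sinf.
  by move=> xi; exact: sin_max.
have r1M xi : `|r1 xi| <= M.
  by rewrite normrM (le_trans _ (rM xi))//; apply: ler_piMl => //; exact: cos_max.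
have r2M xi : `|r2 xi| <= M.
  by rewrite normrM (le_trans _ (rM xi))//; apply: ler_piMl => //; exact: sin_max.
have P1 := plancherel_le r1i r1M; have P2 := plancherel_le r2i r2M.
pose A1 x := cos_transform r1 x ^+ 2 + sin_transform r1 x ^+ 2.
pose A2 x := cos_transform r2 x ^+ 2 + sin_transform r2 x ^+ 2.
have mA1 : measurable_fun setT A1.
  have mr := rintegrable_measurable r1i.
  apply: measurable_funD; apply: measurable_funX.
    exact: measurable_cos_transform.
  exact: measurable_sin_transform.
have mA2 : measurable_fun setT A2.
  have mr := rintegrable_measurable r2i.
  apply: measurable_funD; apply: measurable_funX.
    exact: measurable_cos_transform.
  exact: measurable_sin_transform.
have A10 x : 0 <= A1 x by apply: addr_ge0; exact: sqr_ge0.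
have A20 x : 0 <= A2 x by apply: addr_ge0; exact: sqr_ge0.
have bound x : normc (cint mu (fun xi => expi (dotv x xi) *
    (expi (t * dotv xi xi) * (rho xi)%:C))) ^+ 2 <= 2 * (A1 x + A2 x).
  rewrite cint_waveE sqr_normc /=.
  have c1 := rintegrable_cos x r1i; have c2 := rintegrable_cos x r2i.
  have s1 := rintegrable_sin x r1i; have s2 := rintegrable_sin x r2i.
  rewrite (_ : \int[mu]_xi (cos _ * rho xi) = cos_transform r1 x - sin_transform r2 x); last first.
    by rewrite -RintB//; apply: eq_Rint => xi; rewrite cosD /r1 /r2; ring.
  rewrite (_ : \int[mu]_xi (sin _ * rho xi) = cos_transform r2 x + sin_transform r1 x); last first.
    by rewrite -RintD//; apply: eq_Rint => xi; rewrite sinD /r1 /r2; ring.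
  rewrite /A1 /A2; move: (cos_transform r1 x) (cos_transform r2 x) (sin_transform r1 x) (sin_transform r2 x) => u v w z.
  by have := sqr_ge0 (u + z); have := sqr_ge0 (v - w); rewrite !(sqrrB, sqrrD); lra.
have r2sq : rintegrable mu (fun xi => r2 xi ^+ 2).
  by under eq_fun do rewrite expr2; exact: rintegrable_bounded (rintegrable_measurable r2i) r2M r2i.
have r1sq : rintegrable mu (fun xi => r1 xi ^+ 2).
  by under eq_fun do rewrite expr2; exact: rintegrable_bounded (rintegrable_measurable r1i) r1M r1i.
have tot : \int[mu]_xi (rho xi ^+ 2) = \int[mu]_xi (r1 xi ^+ 2) + \int[mu]_xi (r2 xi ^+ 2).
  rewrite -RintD//; apply: eq_Rint => xi; rewrite /r1 /r2 !exprMn -mulrDl.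
  by rewrite cos2Dsin2 mul1r.
apply: (@le_trans _ _ (\int[mu]_x (2 * (A1 x + A2 x))%:E)%E).
  have mS : measurable_fun setT (fun x => 2 * (A1 x + A2 x)).
    by apply: measurable_funM => //; exact: measurable_funD.
  apply: ge0_le_integral => //.
  - by move=> x _; rewrite lee_fin sqr_ge0.
  - apply/measurable_EFinP.
    rewrite (_ : (fun x => _) = (fun x =>
      (\int[mu]_xi (cos (dotv x xi + t * dotv xi xi) * rho xi)) ^+ 2 +
      (\int[mu]_xi (sin (dotv x xi + t * dotv xi xi) * rho xi)) ^+ 2)); last first.
      by apply/funext => x; rewrite cint_waveE sqr_normc.
    have mph : measurable_fun setT (fun z : 'rV[R]_n * 'rV[R]_n => dotv z.1 z.2 + t * dotv z.2 z.2).
      apply: measurable_funD; first exact: measurable_dotv2.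
      by apply: measurable_funM => //; exact: (measurable_fun2 measurable_dotvv).
    have mr2 := measurable_fun2 (rintegrable_measurable ri).
    apply: measurable_funD; apply: measurable_funX.
      apply: (@measurable_Rint _ _ _ _ _ mu (fun x xi => cos (dotv x xi + t * dotv xi xi) * rho xi)).
      by apply: measurable_funM => //; exact: measurable_cosf.
    apply: (@measurable_Rint _ _ _ _ _ mu (fun x xi => sin (dotv x xi + t * dotv xi xi) * rho xi)).
    by apply: measurable_funM => //; exact: measurable_sinf.
  - exact/measurable_EFinP.
  - by move=> x _; rewrite lee_fin.
under eq_integral do rewrite EFinM EFinD.
have mA1E : measurable_fun setT (fun x => (A1 x)%:E) by exact/measurable_EFinP.
have mA2E : measurable_fun setT (fun x => (A2 x)%:E) by exact/measurable_EFinP.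
have g1 x : [set: 'rV[R]_n] x -> (0 <= (A1 x)%:E)%E by rewrite lee_fin.
have g2 x : [set: 'rV[R]_n] x -> (0 <= (A2 x)%:E)%E by rewrite lee_fin.
have g12 x : [set: 'rV[R]_n] x -> (0 <= (A1 x)%:E + (A2 x)%:E)%E.
  by move=> _; rewrite -EFinD lee_fin addr_ge0.
rewrite (ge0_integralZl_EFin mu measurableT g12 (emeasurable_funD mA1E mA2E))//.
rewrite ge0_integralD//.
rewrite EFinM lee_wpmul2l ?lee_fin// tot mulrDr EFinD.
exact: leeD.
Qed.

End PlancherelInequality.

(** * The test function *)

Section PowerBounds.
Context {R : realType}.

Lemma powR_bounds (y : R) : exists m : nat, forall z, 1 <= z -> z `^ y <= z ^+ m.
Proof.
exists (Num.truncn `|y|).+1 => z z1; have z0 : 0 <= z by exact: le_trans z1.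
rewrite -powR_mulrn// ler_powR//.
by rewrite (le_trans (ler_norm _))// ltW// truncnS_gt.
Qed.

Lemma powR_exp_absorb (y c : R) : 0 < c ->
  exists2 M : R, 0 < M & forall r, 0 <= r -> (1 + r) `^ y <= M * expR (c * r).
Proof.
move=> c0; have [m Hm] := powR_bounds y.
have [M M0 HM] := expR_absorb m c0; exists M => // r r0.
by apply: le_trans (HM r r0); apply: Hm; rewrite lerDl.
Qed.

(* The multiplier [(1 + r)^y] in the variable [q = exp (- d r)], damped by [q]
   so that it extends continuously to [q = 0]. *)
Definition damped_power (d y q : R) : R :=
  if 0 < q then q * expR (y * ln (1 - ln q / d)) else 0.

Lemma damped_power_exp (d y r : R) : 0 < d -> 0 <= r ->
  damped_power d y (expR (- (d * r))) = expR (- (d * r)) * (1 + r) `^ y.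
Proof.
move=> d0 r0; rewrite /damped_power expR_gt0 expRK; congr (_ * _).
rewrite (_ : 1 - - (d * r) / d = 1 + r); last by field; rewrite gt_eqF.
by rewrite /powR gt_eqF// ltr_wpDr.
Qed.

(** The point 0 is the delicate one: half of the decay absorbs the power, so the value is at most
    [M q^{1/2}] for small [q > 0], whatever the sign of [y]. *)
Lemma damped_power_continuous (d y x : R) : 0 < d -> 0 <= x <= 1 ->
  {for x, continuous (damped_power d y)}.
Proof.
move=> d0 /andP[]; rewrite le_eqVlt => /predU1P[<- _|x0 x1].
  rewrite /prop_for /continuous_at [X in _ --> X](_ : _ = 0); last first.
    by rewrite /damped_power ltxx.
  have d20 : 0 < d / 2 by rewrite divr_gt0.
  have [M M0 HM] := powR_exp_absorb y d20.
  apply/cvgrPdist_lt => e e0.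
  (* This threshold inverts [M q^{1/2} < e]; the threshold 1 next to it makes [r = - ln q / d]
     nonnegative. *)
  have em0 : 0 < (e / M) ^+ 2 by rewrite exprn_gt0// divr_gt0.
  exists (Num.min 1 ((e / M) ^+ 2)); first by rewrite /= lt_min ltr01.
  move=> q; rewrite /ball_ /= sub0r normrN lt_min => /andP[q1 qe].
  rewrite sub0r normrN; have [q0|q0] := ltP 0 q; last first.
    by rewrite /damped_power ifF ?normr0//; apply/negbTE; rewrite -leNgt.
  pose r := - ln q / d.
  have r0 : 0 <= r.
    rewrite divr_ge0 ?(ltW d0)// oppr_ge0 ln_le0//.
    by rewrite (le_trans (ler_norm _))// ltW.
  have qE : q = expR (- (d * r)).
    rewrite /r (_ : - (d * (- ln q / d)) = ln q); last by field; rewrite gt_eqF.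
    by rewrite lnK// posrE.
  rewrite qE damped_power_exp// ger0_norm; last by rewrite mulr_ge0 ?expR_ge0 ?powR_ge0.
  apply: (@le_lt_trans _ _ (M * expR (- (d / 2 * r)))).
    rewrite (_ : - (d / 2 * r) = - (d * r) + d / 2 * r); last by field.
    by rewrite expRD [X in _ <= X]mulrCA ler_wpM2l ?expR_ge0// HM.
  rewrite mulrC -ltr_pdivlMr//.
  rewrite -(@ltr_pXn2r _ 2) ?nnegrE ?expR_ge0 ?divr_ge0 ?(ltW e0) ?(ltW M0)//.
  rewrite -expRM_natl (_ : 2 * - (d / 2 * r) = - (d * r)); last by field.
  by rewrite -qE; apply: le_lt_trans qe; exact: ler_norm.
have near_pos : \forall q \near x, 0 < (q : R) by exact: lt_nbhsr.
have arg0 : 0 < 1 - ln x / d.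
  by rewrite ltr_wpDr// oppr_ge0 pmulr_lle0 ?invr_gt0// ln_le0.
suff : {for x, continuous (fun q : R => q * expR (y * ln (1 - ln q / d)))}.
  rewrite /prop_for /continuous_at => H.
  rewrite [X in _ --> X](_ : _ = x * expR (y * ln (1 - ln x / d))); last first.
    by rewrite /damped_power x0.
  apply: cvg_trans H; apply: near_eq_cvg.
  by near=> q; rewrite /damped_power ifT//; near: q.
apply: cvgM; first exact: cvg_id.
apply: continuous_comp; last exact: continuous_expR.
apply: cvgMl_tmp; apply: continuous_comp; last exact: continuous_ln.
by apply: cvgB; [exact: cvg_cst|apply: cvgMr_tmp; exact: continuous_ln].
Unshelve. all: by end_near. Qed.

(** With [q = e^{- d r}], the uniform error [eta] on [P.[q]] becomes [eta q] after the
    multiplication by [q] in [profile], hence integrable in frequency. *)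
Lemma power_approx (d y eta : R) : 0 < d -> 0 < eta ->
  exists P : {poly R}, forall r, 0 <= r ->
    `|P.[expR (- (d * r))] - expR (- (d * r)) * (1 + r) `^ y| <= eta.
Proof.
move=> d0 eta0.
have [P HP] := weierstrass eta0 (fun x => @damped_power_continuous d y x d0).
exists P => r r0; rewrite -damped_power_exp//; apply: HP.
by rewrite expR_ge0/= -expR0 ler_expR oppr_le0 mulr_ge0// ltW.
Qed.

End PowerBounds.

Section TestFunction.
Context {R : realType} {n : nat}.
Local Notation mu := (@lebesgue_rV R n).
Implicit Types (x xi : 'rV[R]_n).

Lemma gauss_const_neq0 (a b : R) : 0 < a -> gauss_const a b != 0.
Proof.
move=> a0; apply/eqP => E; have := normc_gauss_const b a0.
rewrite E ComplexField.Normc.normc0 expr0n mul0r => /eqP.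
by rewrite eq_sym expf_eq0 /= gt_eqF// pi_gt0.
Qed.

(** In the variable [z = a + i b] the Gaussian transform acts by [z -> 1 / (4 z)]. Each monomial of
    [q P(q)] times the chirp is a Gaussian with [z = A k - i t]; its preimage [1 / (4 z)] has real
    part [a k > 0], and [c k] divides out the constant. *)
Lemma fourier_surj (P : {poly R}) (d t : R) : 0 < d ->
  exists2 f : 'rV[R]_n -> R[i], schwartz f &
    forall xi, fourier f xi = expi (t * dotv xi xi) *
      (expR (- (d * dotv xi xi)) * P.[expR (- (d * dotv xi xi))])%:C.
Proof.
move=> d0.
(* [k.+1] because of the factor [q] in front of [P]: even the constant term of [P] gives a decaying
   Gaussian. *)
pose A (k : nat) := k.+1%:R * d.
have A0 k : 0 < A k by rewrite mulr_gt0// ltr0n.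
pose S k := 4 * (A k ^+ 2 + t ^+ 2).
have S0 k : 0 < S k by rewrite mulr_gt0// ltr_pwDl ?exprn_gt0// sqr_ge0.
pose a k := A k / S k; pose b k := t / S k.
have a0 k : 0 < a k by rewrite divr_gt0.
pose c k := (P`_k)%:C / gauss_const (a k) (b k) ^+ n.
exists (fun x => \sum_(k < size P) c k * cgauss (a k) (b k) (dotv x x)).
  exact: schwartz_sum_cgauss.
move=> xi.
have H k := cint_gauss_rV (b k) xi (a0 k).
transitivity (cint mu (fun x => \sum_(k < size P) (c k * (expi (- dotv x xi) * cgauss (a k) (b k) (dotv x x))))).
  apply: eq_cint => x; rewrite mulr_sumr; apply: eq_bigr => k _; exact: mulrCA.
have [_ ->] := @cintegrable_sum _ _ _ mu 'I_(size P) (index_enum _)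
  (fun (k : 'I_(size P)) x => c k * (expi (- dotv x xi) * cgauss (a k) (b k) (dotv x x)))
  (fun k => cintegrableZ (c k) (H k).1).
set q := expR (- (d * dotv xi xi)).
have -> : (q * P.[q])%:C = \sum_(k < size P) (q * (P`_k * q ^+ k))%:C.
  by rewrite horner_coef mulr_sumr raddf_sum.
rewrite mulr_sumr; apply: eq_bigr => k _.
rewrite cintZ; last exact: (H k).1.
rewrite (H k).2 /c mulrA divfK; last by rewrite expf_neq0// gauss_const_neq0.
have D0 : A k ^+ 2 + t ^+ 2 != 0 by rewrite gt_eqF// ltr_pwDl ?exprn_gt0// sqr_ge0.
have -> : a k / (4 * (a k ^+ 2 + b k ^+ 2)) = A k.
  by rewrite /a /b /S; field; rewrite D0.
have -> : b k / (4 * (a k ^+ 2 + b k ^+ 2)) = t.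
  by rewrite /a /b /S; field; rewrite D0.
have E : q * (P`_k * q ^+ k) = P`_k * expR (- (A k * dotv xi xi)).
  rewrite mulrCA -exprS /q -expRM_natl; congr (_ * expR _).
  by rewrite /A; ring.
have -> : (q * (P`_k * q ^+ k))%:C = (P`_k)%:C * (expR (- (A k * dotv xi xi)))%:C.
  by rewrite E; apply: eqReIm; rewrite /= ?(mul0r, mulr0, subr0, addr0).
by rewrite /cgauss mulNr opprK; ring.
Qed.

End TestFunction.

Section WaveBounds.
Context {R : realType} {n : nat}.
Local Notation mu := (@lebesgue_rV R n).
Implicit Types (x xi : 'rV[R]_n) (rho U : 'rV[R]_n -> R).

(** Up to a power of [2 pi], the free evolution at time [- t] of the data whose Fourier transform is
    [rho]; a positive [t] is the chirp of the test function. *)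
Definition wave (t : R) rho x : R[i] :=
  cint mu (fun xi => expi (dotv x xi) * (expi (t * dotv xi xi) * (rho xi)%:C)).

Lemma realcM (a b : R) : (a * b)%:C = a%:C * b%:C :> R[i].
Proof. by apply: eqReIm; rewrite /= ?(mul0r, mulr0, subr0, addr0). Qed.

Lemma measurable_wave (t : R) rho : measurable_fun setT rho ->
  measurable_fun setT (fun x => Re (wave t rho x)) /\
  measurable_fun setT (fun x => Im (wave t rho x)).
Proof.
move=> mr; have mr2 := measurable_fun2 mr.
have mph : measurable_fun setT (fun z : 'rV[R]_n * 'rV[R]_n => dotv z.1 z.2 + t * dotv z.2 z.2).
  apply: measurable_funD; first exact: measurable_dotv2.
  by apply: measurable_funM => //; exact: (measurable_fun2 measurable_dotvv).
rewrite /wave; split.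
  under eq_fun do rewrite cint_waveE /=.
  apply: (@measurable_Rint _ _ _ _ _ mu (fun x xi => cos (dotv x xi + t * dotv xi xi) * rho xi)).
  by apply: measurable_funM => //; exact: measurable_cosf.
under eq_fun do rewrite cint_waveE /=.
apply: (@measurable_Rint _ _ _ _ _ mu (fun x xi => sin (dotv x xi + t * dotv xi xi) * rho xi)).
by apply: measurable_funM => //; exact: measurable_sinf.
Qed.

Lemma measurable_normc_wave (t : R) rho : measurable_fun setT rho ->
  measurable_fun setT (fun x => normc (wave t rho x)).
Proof.
move=> mr; have [m1 m2] := measurable_wave t mr.
rewrite (_ : (fun x => _) = (fun x => Num.sqrt (Re (wave t rho x) ^+ 2 + Im (wave t rho x) ^+ 2))).
  apply: measurableT_comp; first by apply: continuous_measurable_fun; exact: sqrt_continuous.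
  by apply: measurable_funD; exact: measurable_funX.
by apply/funext => x; case: (wave t rho x).
Qed.

Lemma normc_wave_le (t : R) rho (g : 'rV[R]_n -> R) x : measurable_fun setT rho ->
  rintegrable mu g -> (forall xi, `|rho xi| <= g xi) ->
  normc (wave t rho x) <= 2 * \int[mu]_xi g xi.
Proof.
move=> mr gi rg; apply: normc_cint_le => //; first exact: cmeasurable_wave.
by move=> xi; rewrite normc_wave.
Qed.

Lemma powR_split (p a : R) : 2 <= p -> 0 <= a -> a `^ p = a `^ (p - 2) * a ^+ 2.
Proof.
move=> p2 a0; rewrite -(powR_mulrn 2 a0) -powRD ?subrK//.
by apply/implyP => /eqP p0; exfalso; lra.
Qed.

(** For [p >= 2], [|w|^p <= (sup |w|)^{p - 2} |w|^2]. The tolerance depends on [W], hence on [d],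
    but not on [rho], so it is available before the polynomial is chosen. *)
Lemma wave_Lp_small (p t M theta : R) (W : 'rV[R]_n -> R) : 2 <= p -> 0 < theta ->
  rintegrable mu W -> (forall x, 0 <= W x <= M) ->
  exists2 eta : R, 0 < eta & forall rho, measurable_fun setT rho ->
    (forall xi, `|rho xi| <= eta * W xi) ->
    (\int[mu]_x (normc (wave t rho x) `^ p)%:E <= theta%:E)%E.
Proof.
move=> p2 th0 Wi WM.
have W2i : rintegrable mu (fun xi => W xi ^+ 2).
  under eq_fun do rewrite expr2; apply: (@rintegrable_bounded _ _ _ _ M _ _ _ _ Wi); first exact: rintegrable_measurable Wi.
  by move=> x; have /andP[w0 w1] := WM x; rewrite ger0_norm//; exact: w1.
pose I := \int[mu]_xi W xi; pose J := \int[mu]_xi (W xi ^+ 2).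
have I0 : 0 <= I by apply: Rint_ge0 => x; have /andP[] := WM x.
have J0 : 0 <= J by apply: Rint_ge0 => x; exact: sqr_ge0.
pose Q := (2 * I) `^ (p - 2).
have Q0 : 0 <= Q by exact: powR_ge0.
pose L := Q * (2 * ((2 * pi) ^+ n * J)).
have L0 : 0 <= L by rewrite !mulr_ge0// exprn_ge0// mulr_ge0// pi_ge0.
(* The final bound is [eta L]. [eta <= 1] keeps [rho] below [W] and gives [eta^2 <= eta]; [1 + L] is
   positive even when [L = 0]. *)
pose eta := Num.min 1 (theta / (1 + L)).
have eta0 : 0 < eta by rewrite lt_min ltr01 divr_gt0// ltr_pwDl.
have eta1 : eta <= 1 by rewrite ge_min lexx.
have etaL : eta * (1 + L) <= theta.
  by rewrite -ler_pdivlMr ?ltr_pwDl// ge_min lexx orbT.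
exists eta => // rho mr rW.
have ri : rintegrable mu rho.
  by apply: (rintegrable_le mr _ rW); exact: rintegrableZ.
have rM xi : `|rho xi| <= M.
  have /andP[w0 w1] := WM xi; apply: (le_trans (rW xi)); apply: le_trans w1.
  by rewrite ler_piMl.
have supb x : normc (wave t rho x) <= 2 * I.
  apply: (le_trans (normc_wave_le t x mr (rintegrableZ eta Wi) rW)).
  by rewrite RintZ// ler_wpM2l// ler_piMl.
have mw := measurable_normc_wave t mr.
have nn x : [set: 'rV[R]_n] x -> (0 <= (normc (wave t rho x) ^+ 2)%:E)%E.
  by move=> _; rewrite lee_fin sqr_ge0.
have mn : measurable_fun setT (fun x => (normc (wave t rho x) ^+ 2)%:E).
  by apply/measurable_EFinP; exact: measurable_funX.
apply: (@le_trans _ _ (\int[mu]_x (Q%:E * (normc (wave t rho x) ^+ 2)%:E))%E).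
  apply: ge0_le_integral => //.
  - by move=> x _; rewrite lee_fin powR_ge0.
  - by apply/measurable_EFinP; exact: (measurableT_comp (measurable_powR p) mw).
  - exact: measurable_funeM.
  - move=> x _; rewrite -EFinM lee_fin (powR_split p2) ?normc_ge0//.
    rewrite ler_wpM2r ?sqr_ge0//; apply: ge0_ler_powR; rewrite ?nnegrE ?normc_ge0//.
      by rewrite subr_ge0.
    by rewrite mulr_ge0.
rewrite (ge0_integralZl_EFin mu measurableT nn mn)//.
have P := plancherel_wave t ri rM.
apply: (@le_trans _ _ (Q%:E * (2 * ((2 * pi) ^+ n * \int[mu]_xi (rho xi ^+ 2)))%:E)%E).
  by rewrite lee_wpmul2l// lee_fin.
rewrite -EFinM lee_fin.
have RJ : \int[mu]_xi (rho xi ^+ 2) <= eta * J.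
  rewrite -RintZ//; apply: Rint_le.
  - by under eq_fun do rewrite expr2; exact: rintegrable_bounded rM ri.
  - exact: rintegrableZ.
  - move=> xi; rewrite -(real_normK (num_real (rho xi))).
    have /andP[w0 _] := WM xi.
    apply: (@le_trans _ _ ((eta * W xi) ^+ 2)).
      by apply: lerXn2r; rewrite ?nnegrE// mulr_ge0// ltW.
    by rewrite exprMn ler_wpM2r ?sqr_ge0// expr2 ler_piMl// ltW.
apply: (@le_trans _ _ (Q * (2 * ((2 * pi) ^+ n * (eta * J))))).
  by do 2!rewrite ler_wpM2l//; rewrite ler_wpM2l// exprn_ge0// mulr_ge0// pi_ge0.
rewrite (_ : Q * _ = eta * L); last by rewrite /L; ring.
by apply: le_trans etaL; rewrite ler_wpM2l ?ltW//; lra.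
Qed.

End WaveBounds.

(** * Focusing *)

Section LowerBound.
Context {R : realType} {n : nat}.
Local Notation mu := (@lebesgue_rV R n).
Implicit Types (x xi : 'rV[R]_n).

Lemma dotvZr (c : R) x xi : dotv x (c *: xi) = c * dotv x xi.
Proof. by rewrite /dotv mulr_sumr; apply: eq_bigr => i _; rewrite !mxE mulrCA. Qed.

(** Expand [|x - c eta|^2 >= 0], with [eta] equal to [xi] and to [- xi]. *)
Lemma dotv_small (c : R) x xi : 0 < c -> dotv x x <= c -> c * dotv xi xi <= 1 ->
  `|dotv x xi| <= 1.
Proof.
move=> c0 xc xic.
have H eta : c * dotv eta eta <= 1 -> dotv x eta <= 1.
  move=> ec; have := dotv_ge0 (x - c *: eta); rewrite dotvBB !dotvZr.
  rewrite (dotvC (c *: eta)) dotvZr => H.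
  by rewrite -(ler_pM2l c0); nra.
rewrite ler_norml H// andbT -lerN2 opprK -dotvNr H//.
by rewrite dotvNr dotvC dotvNr opprK.
Qed.

Lemma cos_small (u : R) : `|u| <= 1 -> cos 1 <= cos u.
Proof.
move=> u1; rewrite -(cos_norm u) le_eqVlt; move: u1; rewrite le_eqVlt => /predU1P[->|u1].
  by rewrite eqxx.
have p1 : 1 <= pi :> R by apply: le_trans (pi_ge2 R); lra.
have i1 : (1 : R) \in `[0, pi] by rewrite in_itv/= ler01.
have i2 : `|u| \in `[0, pi] by rewrite in_itv/= normr_ge0 (le_trans (ltW u1)).
by rewrite (ltr_cos i2 i1) u1 orbT.
Qed.

(** A crude constant good for both signs of [y]: [ln u <= u - 1] at [u = z] and at [u = z^-1] bounds
    [|ln z|] by [n + 3]. *)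
Lemma powR_lower (y z : R) : 4^-1 <= z <= n%:R + 1 ->
  expR (- (`|y| * (n%:R + 3))) <= z `^ y.
Proof.
move=> /andP[z1 z2]; have z0 : 0 < z by apply: lt_le_trans z1; rewrite invr_gt0.
rewrite /powR gt_eqF// ler_expR.
have n0 : 0 <= n%:R :> R by exact: ler0n.
have l1 : ln z <= n%:R + 3.
  have -> : z = 1 + (z - 1) by ring.
  by rewrite (le_trans (le_ln1Dx _)) //; lra.
have l2 : - ln z <= n%:R + 3.
  rewrite -lnV ?posrE// (_ : z^-1 = 1 + (z^-1 - 1)); last by ring.
  have zi : z^-1 <= 4 by rewrite -[X in _ <= X]invrK lef_pV2 ?posrE// invr_gt0.
  have zi0 : 0 < z^-1 by rewrite invr_gt0.
  by rewrite (le_trans (le_ln1Dx _)) //; lra.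
have : `|ln z| <= n%:R + 3 by rewrite ler_norml l1 andbT lerNl.
move=> H; rewrite lerNl -mulNr -normrN.
rewrite (le_trans (ler_norm _))// normrM ler_wpM2l//.
Qed.

(** Meant for [r = |xi|^2], [u = x . xi], with [b] telling whether [xi] lies in a box. For
    [c e r <= 1] the cosine is at least [cos 1]; for [c e r > 1] it is only bounded below by [-1],
    and the loss is a Gaussian carrying the small factor [c]. *)
Lemma damped_wave_pointwise (y : R) : (0 < n)%N -> exists2 M : R, 0 < M &
  forall c e r u (b : bool), 0 < c -> c * (n%:R + 1) <= 1 -> 0 < e -> e <= 1 ->
    0 <= r -> (c * (e * r) <= 1 -> `|u| <= 1) ->
    (b -> 4^-1 <= e * r <= n%:R) ->
  e `^ (- y) * (cos 1 * expR (- (n%:R)) * expR (- (`|y| * (n%:R + 3))) * b%:R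
     - c * M * expR (- (e / 2 * r))) <=
  cos u * (expR (- (e * r)) * (1 + r) `^ y).
Proof.
move=> n0; have [m Hm] := powR_bounds y.
have h0 : 0 < 2^-1 :> R by rewrite invr_gt0.
have [M M0 HM] := expR_absorb m.+1 h0.
exists M => // c e r u b c0 cn e0 e1 r0 Hu Hb.
have er0 : 0 <= e * r by rewrite mulr_ge0// ltW.
(* Rescaling: [e + e r] is comparable to 1 on the box, so the size [e^{- y}] comes out as a
   factor. *)
have scale : (1 + r) `^ y = e `^ (- y) * (e + e * r) `^ y.
  rewrite (_ : e + e * r = e * (1 + r)); last by ring.
  rewrite powRM ?(ltW e0) ?addr_ge0// mulrA -powRD ?addNr ?powRr0 ?mul1r//.
  by rewrite eqxx gt_eqF.
rewrite scale [X in _ <= X](_ : _ = e `^ (- y) *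
  (cos u * (expR (- (e * r)) * (e + e * r) `^ y))); last by ring.
rewrite ler_wpM2l ?powR_ge0//.
have E0 : 0 <= c * M * expR (- (e / 2 * r)) by rewrite !mulr_ge0 ?expR_ge0 ?ltW.
have n1 : 1 <= n%:R :> R by rewrite ler1n.
have [small|big] := leP (c * (e * r)) 1.
  have cu := cos_small (Hu small).
  apply: (@le_trans _ _ (cos 1 * (expR (- n%:R) * expR (- (`|y| * (n%:R + 3))) * b%:R))).
    by rewrite lerBlDr !mulrA lerDl.
  have c1 := ltW (cos1_gt0 R).
  apply: (@le_trans _ _ (cos 1 * (expR (- (e * r)) * (e + e * r) `^ y))); last first.
    by rewrite ler_wpM2r// mulr_ge0 ?expR_ge0 ?powR_ge0.
  rewrite ler_wpM2l//; case: b Hb => [Hb|_]; last first.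
    by rewrite mulr0 mulr_ge0 ?expR_ge0 ?powR_ge0.
  have /andP[b1 b2] := Hb isT; rewrite mulr1.
  apply: ler_pM; rewrite ?expR_ge0//.
    by rewrite ler_expR lerN2.
  by apply: powR_lower; apply/andP; split; lra.
(* On the box [e r <= n], so [c (n + 1) <= 1] keeps it inside the near regime. *)
have -> : b = false.
  apply/negP => /Hb /andP[_ b2].
  have : c * (e * r) <= c * n%:R by rewrite ler_wpM2l// ltW.
  by move: cn big; rewrite mulrDr mulr1; lra.
rewrite mulr0 sub0r; have er1 : 1 <= e * r.
  have c1 : c <= 1 by move: cn; nra.
  by rewrite ltW// (lt_le_trans big)// ler_piMl.
rewrite lerNl -mulNr; apply: (@le_trans _ _ (1 * (expR (- (e * r)) * (e + e * r) `^ y))).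
  apply: ler_wpM2r; first by rewrite mulr_ge0 ?expR_ge0 ?powR_ge0.
  by have := cos_geN1 u; lra.
rewrite mul1r (_ : - (e / 2 * r) = - (e * r) + 2^-1 * (e * r)); last by field.
rewrite expRD mulrCA ler_wpM2l ?expR_ge0//.
apply: (@le_trans _ _ ((e + e * r) ^+ m)); first by apply: Hm; lra.
apply: (@le_trans _ _ ((1 + e * r) ^+ m)).
  by apply: lerXn2r; rewrite ?nnegrE ?addr_ge0 ?(ltW e0)// lerD2r.
(* Here [1 <= c (1 + e r)]: one more power is the price of the factor [c], hence [m.+1] in the
   choice of [M]. *)
apply: (@le_trans _ _ (c * (1 + e * r) ^+ m.+1)).
  rewrite exprS mulrA ler_peMl ?exprn_ge0 ?addr_ge0//.
  by move: big; rewrite mulrDr; lra.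
by rewrite -mulrA ler_wpM2l ?(ltW c0)// HM.
Qed.

(** In units of [e^{- y} e^{- n / 2}] the box gains [K] and the far tail loses at most [c L]; [c] is
    taken so small that half of the gain survives, uniformly in [e]. *)
Lemma lower_bound (y : R) : (0 < n)%N -> exists c k : R,
  [/\ 0 < c, c <= 1, 0 < k &
   forall e x, 0 < e -> e <= 1 -> dotv x x <= c * e ->
     k * (e `^ (- y) * (Num.sqrt e)^-1 ^+ n) <=
     \int[mu]_xi (cos (dotv x xi) * (expR (- (e * dotv xi xi)) * (1 + dotv xi xi) `^ y))].
Proof.
move=> n0; have [M M0 HM] := damped_wave_pointwise y n0.
pose K := cos 1 * expR (- (n%:R)) * expR (- (`|y| * (n%:R + 3))) * 2^-1 ^+ n : R.
pose L := M * Num.sqrt (2 * pi) ^+ n.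
have K0 : 0 < K by rewrite !mulr_gt0 ?expR_gt0 ?cos1_gt0// exprn_gt0// invr_gt0.
have L0 : 0 < L.
  by rewrite mulr_gt0// exprn_gt0// sqrtr_gt0 mulr_gt0// pi_gt0.
have n10 : 0 < n%:R + 1 :> R by rewrite ltr_wpDl.
pose c := Num.min (n%:R + 1)^-1 (K / (2 * L)).
have c0 : 0 < c by rewrite lt_min invr_gt0 n10 divr_gt0//; exact: mulr_gt0.
have cn : c * (n%:R + 1) <= 1.
  by rewrite -ler_pdivlMr// mul1r ge_min lexx.
have cL : c * L <= K / 2.
  have : c <= K / (2 * L) by rewrite ge_min lexx orbT.
  by rewrite ler_pdivlMr; [move=> H; lra|exact: mulr_gt0].
exists c, (K / 2); split => //; first by move: cn (ler0n R n); nra.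
  by rewrite divr_gt0.
move=> e x e0 e1 xe.
pose la := (Num.sqrt e)^-1; have la0 : 0 < la by rewrite invr_gt0 sqrtr_gt0.
have la2 : la ^+ 2 = e^-1 by rewrite exprVn sqr_sqrtr// ltW.
(* As [la = e^{- 1 / 2}], on this box [n / 4 <= e |xi|^2 <= n]; its volume [(la / 2)^n] is the
   origin of the power of [2^-1] in [K]. *)
pose Box := [set xi : 'rV[R]_n | forall i, `[la / 2, la]%classic (xi ord0 i)].
have mBox : measurable Box.
  have -> : Box = \bigcap_(i in [set: 'I_n])
      ((fun x : 'rV[R]_n => x ord0 i) @^-1` `[la / 2, la]%classic).
    by apply/seteqP; split => z /= H i; [move=> _|]; exact: H.
  apply: fin_bigcap_measurable => // i _; rewrite -[X in measurable X]setTI.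
  by apply: measurable_rV_coord.
have muBox : mu Box = ((la / 2) ^+ n)%:E.
  rewrite (@lebesgue_rV_box R n (fun=> `[la / 2, la]%classic))//.
  rewrite (eq_bigr (fun=> (la / 2)%:E)) => [|i _].
    by rewrite prodEFin prodr_const card_ord.
  rewrite lebesgue_measure_itv/= lte_fin ifT; last by lra.
  by rewrite -EFinB; congr (_%:E); field.
have Bv : (\int[mu]_xi (\1_Box xi)%:E = ((la / 2) ^+ n)%:E)%E.
  rewrite integral_indic//; transitivity (mu Box); last exact: muBox.
  by congr (_ _); rewrite setIT.
have Bi : rintegrable mu (fun xi => \1_Box xi).
  apply/integrableP; split; first by apply/measurable_EFinP; exact: measurable_indic.
  under eq_integral do rewrite gee0_abs ?lee_fin//.
  by rewrite Bv ltry.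
have Bint : \int[mu]_xi \1_Box xi = (la / 2) ^+ n.
  by rewrite /Rintegral Bv.
have e20 : 0 < e / 2 by rewrite divr_gt0.
have [Gi Gint] := @gauss_int0_rV R n _ e20.
have Gint' : \int[mu]_xi expR (- (e / 2 * dotv xi xi)) = Num.sqrt (2 * pi) ^+ n * la ^+ n.
  rewrite Gint -exprMn; congr (_ ^+ n).
  rewrite (_ : pi / (e / 2) = (2 * pi) * e^-1); last by field; rewrite gt_eqF.
  by rewrite sqrtrM ?mulr_ge0 ?pi_ge0// sqrtrV// ltW.
pose k1 := cos 1 * expR (- (n%:R)) * expR (- (`|y| * (n%:R + 3))) : R.
have low : K / 2 * (e `^ (- y) * la ^+ n) <=
    \int[mu]_xi (e `^ (- y) * (k1 * \1_Box xi - c * M * expR (- (e / 2 * dotv xi xi)))).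
  rewrite RintZ; last by apply: rintegrableB; exact: rintegrableZ.
  rewrite RintB; [|exact: rintegrableZ..].
  rewrite RintZ// [X in _ - X]RintZ// Bint Gint'.
  rewrite (_ : _ - _ = (K - c * L) * la ^+ n); last first.
    by rewrite /K /L -/k1 exprMn; ring.
  rewrite mulrCA; apply: ler_wpM2l; first exact: powR_ge0.
  by apply: ler_wpM2r; [apply: exprn_ge0; exact: ltW|lra].
apply: (le_trans low); apply: Rint_le.
- by apply: rintegrableZ; apply: rintegrableB; exact: rintegrableZ.
- have [M' M'0 HM'] := powR_exp_absorb y e20.
  apply: (@rintegrable_le _ _ _ mu _ (fun xi => M' * expR (- (e / 2 * dotv xi xi)))).
  + apply: measurable_funM; first by apply: measurable_cosf; exact: measurable_dotvr.
    apply: measurable_funM.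
      exact: rintegrable_measurable (@gauss_int0_rV R n e e0).1.
    apply: (measurableT_comp (measurable_powR y)).
    by apply: measurable_funD => //; exact: measurable_dotvv.
  + exact: rintegrableZ.
  + move=> xi; rewrite normrM (@le_trans _ _ (1 * (expR (- (e * dotv xi xi)) * (1 + dotv xi xi) `^ y)))//.
      rewrite (ger0_norm (mulr_ge0 (expR_ge0 _) (powR_ge0 _ _))).
      by apply: ler_wpM2r; [rewrite mulr_ge0 ?expR_ge0 ?powR_ge0|exact: cos_max].
    rewrite mul1r (_ : - (e / 2 * dotv xi xi) = - (e * dotv xi xi) + e / 2 * dotv xi xi); last by field.
    rewrite expRD [X in _ <= X]mulrCA; apply: ler_wpM2l; first exact: expR_ge0.
    by apply: HM'; exact: dotv_ge0.
- move=> xi; rewrite indicE.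
  apply: HM => //; first exact: dotv_ge0.
    by move=> h; apply: (@dotv_small (c * e)); rewrite ?mulr_gt0// -mulrA.
  rewrite inE => xiB.
  have coord i : (4 * e)^-1 <= xi ord0 i * xi ord0 i <= e^-1.
    have := xiB i; rewrite /= in_itv/= => /andP[l1 l2].
    have l0 : 0 < la / 2 by rewrite divr_gt0.
    rewrite -la2 (_ : (4 * e)^-1 = (la / 2) ^+ 2); last first.
      by rewrite exprMn la2 exprVn; field; rewrite gt_eqF.
    rewrite -expr2 !lerXn2r ?nnegrE ?(ltW la0) ?(ltW l0)// ?(le_trans (ltW l0) l1)//.
  have sumE (z : R) : \sum_(i < n) z = n%:R * z.
    by rewrite sumr_const card_ord mulr_natl.
  have s1 : n%:R * (4 * e)^-1 <= dotv xi xi.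
    by rewrite -sumE; apply: ler_sum => i _; have /andP[] := coord i.
  have s2 : dotv xi xi <= n%:R * e^-1.
    by rewrite -sumE; apply: ler_sum => i _; have /andP[] := coord i.
  have n1 : 1 <= n%:R :> R by rewrite ler1n.
  apply/andP; split.
    apply: (@le_trans _ _ (e * (n%:R * (4 * e)^-1))); last by rewrite ler_pM2l.
    rewrite (_ : e * _ = n%:R / 4); last by field; rewrite gt_eqF.
    by lra.
  apply: (@le_trans _ _ (e * (n%:R * e^-1))); first by rewrite ler_pM2l.
  by rewrite mulrCA divff ?mulr1// gt_eqF.
Qed.

End LowerBound.

(** * Comparison of the norms *)

Section Operators.
Context {R : realType} {n : nat}.
Local Notation mu := (@lebesgue_rV R n).
Implicit Types (x xi : 'rV[R]_n) (P : {poly R}).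

Definition profile (d : R) P xi : R :=
  expR (- (d * dotv xi xi)) * P.[expR (- (d * dotv xi xi))].

Lemma measurable_exp_dotvv (d : R) :
  measurable_fun setT (fun xi : 'rV[R]_n => expR (- (d * dotv xi xi))).
Proof.
apply: measurableT_comp => //; apply: measurableT_comp => //.
by apply: measurable_funM => //; exact: measurable_dotvv.
Qed.

Lemma measurable_profile (d : R) P : measurable_fun setT (profile d P).
Proof.
apply: measurable_funM; first exact: measurable_exp_dotvv.
under eq_fun do rewrite horner_coef.
apply: measurable_sum => i; apply: measurable_funM => //.
by apply: measurable_funX; exact: measurable_exp_dotvv.
Qed.

Lemma measurable_power_dotvv (y : R) :
  measurable_fun setT (fun xi : 'rV[R]_n => (1 + dotv xi xi) `^ y).
Proof.
apply: (measurableT_comp (measurable_powR y)).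
by apply: measurable_funD => //; exact: measurable_dotvv.
Qed.

(** The evolution subtracts [t] from the chirp; at [t = t0] no quadratic phase is left, which is the
    focus. *)
Lemma schrodinger_wave (t t0 d : R) P (f : 'rV[R]_n -> R[i]) x :
  (forall xi, fourier f xi = expi (t0 * dotv xi xi) * (profile d P xi)%:C) ->
  schrodinger t f x = ((2 * pi) ^- n)%:C * wave (t0 - t) (profile d P) x.
Proof.
move=> Hf; congr (_ * _); apply: eq_cint => xi.
rewrite Hf enorm_sqr mulrA -expiD mulrA -expiD; congr (expi _ * _); ring.
Qed.

Lemma bessel_wave (s t0 d : R) P (f : 'rV[R]_n -> R[i]) x :
  (forall xi, fourier f xi = expi (t0 * dotv xi xi) * (profile d P xi)%:C) ->
  bessel s f x = ((2 * pi) ^- n)%:C *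
    wave t0 (fun xi => (1 + dotv xi xi) `^ (s / 2) * profile d P xi) x.
Proof.
move=> Hf; congr (_ * _); apply: eq_cint => xi.
by rewrite Hf enorm_sqr realcM; congr (_ * _); rewrite mulrCA.
Qed.

(** The chirped Gaussian has [z = 2 d - i / 2], so its transform decays at the rate
    [Re (1 / (4 z)) = 2 d / (16 d^2 + 1)]. The constant [G] per coordinate satisfies
    [G^4 (4 d^2 + 1 / 4) = pi^2], whence [G <= 2 pi]. *)
Lemma wave_gauss_bound (d : R) x : 0 < d -> d <= 4^-1 ->
  normc (wave 2^-1 (fun xi => expR (- (2 * d * dotv xi xi))) x) <=
  (2 * pi) ^+ n * expR (- (d * dotv x x)).
Proof.
move=> d0 d4; have a0 : 0 < 2 * d by rewrite mulr_gt0.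
have pi1 : 2 <= pi :> R by exact: pi_ge2.
have E : wave 2^-1 (fun xi => expR (- (2 * d * dotv xi xi))) x =
    cint mu (fun xi => expi (- dotv xi (- x)) * cgauss (2 * d) (- 2^-1) (dotv xi xi)).
  apply: eq_cint => xi; rewrite dotvNr opprK dotvC; congr (_ * _).
  by rewrite /cgauss mulNr opprK mulrC.
rewrite E (cint_gauss_rV _ _ a0).2 ComplexField.Normc.normcM normcX.
rewrite /cgauss ComplexField.Normc.normcM normc_expi mulr1 normc_real (ger0_norm (expR_ge0 _)).
set G := normc _; have G0 : 0 <= G by exact: normc_ge0.
apply: ler_pM; rewrite ?exprn_ge0 ?expR_ge0//.
  apply: lerXn2r; rewrite ?nnegrE//; first by lra.
  have := normc_gauss_const (- 2^-1) a0; rewrite -/G => HG.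
  rewrite leNgt; apply/negP => H.
  have : (2 * pi) ^+ 4 < G ^+ 4 by rewrite ltr_pXn2r// nnegrE; lra.
  have : G ^+ 4 * 4^-1 <= pi ^+ 2.
    rewrite -HG; apply: ler_wpM2l; first exact: exprn_ge0.
    by have := sqr_ge0 (2 * d); rewrite sqrrN exprVn; lra.
  have : 1 <= pi ^+ 2 :> R by rewrite expr_ge1//; lra.
  rewrite (_ : (2 * pi) ^+ 4 = 16 * (pi ^+ 2 * pi ^+ 2)); last by ring.
  by nra.
rewrite ler_expR lerN2 dotvNr dotvC dotvNr opprK.
apply: ler_wpM2r; first exact: dotv_ge0.
have S0 : 0 < 4 * ((2 * d) ^+ 2 + (- 2^-1) ^+ 2) :> R.
  by rewrite mulr_gt0// ltr_pwDl ?exprn_gt0// sqr_ge0.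
(* [2 d / (16 d^2 + 1) >= d] amounts to [16 d^2 <= 1]: the origin of the restriction [d <= 4^-1]. *)
by rewrite ler_pdivlMr// sqrrN exprVn; nra.
Qed.

Lemma powRD_le (p a b : R) : 0 <= p -> 0 <= a -> 0 <= b ->
  (a + b) `^ p <= 2 `^ p * (a `^ p + b `^ p).
Proof.
move=> p0 a0 b0; have [ab|/ltW ba] := leP a b.
  apply: (@le_trans _ _ ((2 * b) `^ p)).
    by apply: ge0_ler_powR; rewrite ?nnegrE ?addr_ge0 ?mulr_ge0//; lra.
  by rewrite powRM// ler_wpM2l ?powR_ge0// lerDr powR_ge0.
apply: (@le_trans _ _ ((2 * a) `^ p)).
  by apply: ge0_ler_powR; rewrite ?nnegrE ?addr_ge0 ?mulr_ge0//; lra.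
by rewrite powRM// ler_wpM2l ?powR_ge0// lerDl powR_ge0.
Qed.

(** The multiplier [(1 + r)^{s / 2}] cancels the inverse power in the profile and leaves
    [e^{- 2 d r}] plus the error [rho]. The error keeps one factor [e^{- d r}], half of which
    absorbs the growth of the multiplier; this gives the weight [M e^{- d r / 2}]. *)
Lemma bessel_upper (p s d : R) : 2 <= p -> 0 < d -> d <= 4^-1 ->
  exists2 eta : R, 0 < eta & forall P (f : 'rV[R]_n -> R[i]),
    (forall r, 0 <= r -> `|P.[expR (- (d * r))] -
       expR (- (d * r)) * (1 + r) `^ (- (s / 2))| <= eta) ->
    (forall xi, fourier f xi = expi (2^-1 * dotv xi xi) * (profile d P xi)%:C) ->
    (bessel_norm p s f <= ((2 `^ p * (2 * Num.sqrt (2 / d) ^+ n)) `^ p^-1)%:E)%E.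
Proof.
move=> p2 d0 d4; have p0 : 0 < p by lra.
have d20 : 0 < d / 2 by rewrite divr_gt0.
have pi1 : 2 <= pi :> R by exact: pi_ge2.
have pi4 : pi <= 4 :> R by have := @pihalf_lt2 R; lra.
have [M M0 HM] := powR_exp_absorb (s / 2) d20.
have [Gi _] := @gauss_int0_rV R n _ d20.
have Wi : rintegrable mu (fun xi => M * expR (- (d / 2 * dotv xi xi))).
  exact: rintegrableZ.
have WM xi : 0 <= M * expR (- (d / 2 * dotv xi xi)) <= M.
  rewrite mulr_ge0 ?expR_ge0 ?(ltW M0)//= ler_piMr ?(ltW M0)//.
  by rewrite expR_le1 oppr_le0; apply: mulr_ge0; [exact: ltW|exact: dotv_ge0].
(* The error is allowed a [p]-th power integral of 1, which lies below the main term
   [(2 / d)^{n / 2}]; hence the factor 2 in the bound. *)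
have [eta eta0 Heta] := wave_Lp_small 2^-1 p2 ltr01 Wi WM.
exists eta => // P f HP Hf.
pose rho xi := (1 + dotv xi xi) `^ (s / 2) * profile d P xi - expR (- (2 * d * dotv xi xi)).
have mrho : measurable_fun setT rho.
  apply: measurable_funB; last exact: measurable_exp_dotvv.
  apply: measurable_funM; [exact: measurable_power_dotvv|exact: measurable_profile].
have rhoW xi : `|rho xi| <= eta * (M * expR (- (d / 2 * dotv xi xi))).
  have q0 := dotv_ge0 xi; rewrite /rho /profile.
  set q := dotv xi xi in q0 *.
  have E1 : expR (- (2 * d * q)) = (1 + q) `^ (s / 2) * (expR (- (d * q)) *
      (expR (- (d * q)) * (1 + q) `^ (- (s / 2)))).
    rewrite powRN (_ : - (2 * d * q) = - (d * q) + - (d * q)); last by ring.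
    rewrite expRD; field; rewrite gt_eqF// powR_gt0//; lra.
  rewrite {1}E1 -!mulrBr 2!normrM (ger0_norm (powR_ge0 _ _)) (ger0_norm (expR_ge0 _)).
  rewrite mulrA mulrC; apply: ler_pM => //.
  - by rewrite mulr_ge0 ?powR_ge0 ?expR_ge0.
  - exact: HP.
  - rewrite (_ : - (d / 2 * q) = d / 2 * q + - (d * q)); last by field.
    by rewrite expRD mulrA; apply: ler_wpM2r; [exact: expR_ge0|exact: HM].
have Lp := Heta rho mrho rhoW.
have ei := (rintegrable_le mrho (rintegrableZ eta Wi) rhoW).
have split_wave x : wave 2^-1 (fun xi => (1 + dotv xi xi) `^ (s / 2) * profile d P xi) x =
    wave 2^-1 (fun xi => expR (- (2 * d * dotv xi xi))) x + wave 2^-1 rho x.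
  rewrite -[RHS]cintD.
  - apply: eq_cint => xi; rewrite -mulrDr -mulrDr; congr (_ * (_ * _)).
    by rewrite /rho; apply: eqReIm => /=; ring.
  - have a0 : 0 < 2 * d by rewrite mulr_gt0.
    have [gi _] := @gauss_int0_rV R n _ a0.
    apply: (cintegrable_le _ gi); first exact: cmeasurable_wave (rintegrable_measurable gi).
    by move=> xi; rewrite [X in X <= _](normc_wave _ (fun xi => expR (- (2 * d * dotv xi xi)))) ger0_norm ?expR_ge0.
  - apply: (cintegrable_le _ (rintegrableZ eta Wi)); first exact: cmeasurable_wave.
    by move=> xi; rewrite [X in X <= _](normc_wave _ rho); exact: rhoW.
pose w x := normc (wave 2^-1 rho x).
have w0 x : 0 <= w x by exact: normc_ge0.
have cK : 0 < ((2 * pi) ^- n : R) by rewrite invr_gt0 exprn_gt0//; lra.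
have cK1 : ((2 * pi) ^- n : R) <= 1.
  by rewrite invf_le1 ?exprn_gt0 ?exprn_ege1//; lra.
have nb x : normc (bessel s f x) <= expR (- (d * dotv x x)) + w x.
  rewrite (bessel_wave s x Hf) split_wave ComplexField.Normc.normcM normc_real (ger0_norm (ltW cK)).
  apply: (@le_trans _ _ ((2 * pi) ^- n * ((2 * pi) ^+ n * expR (- (d * dotv x x)) + w x))).
    apply: ler_wpM2l; first exact: ltW.
    apply: (le_trans (le_normcD _ _)); apply: lerD => //; exact: wave_gauss_bound.
  rewrite mulrDr mulKf; last by rewrite expf_neq0// gt_eqF//; lra.
  by rewrite lerD2l ler_piMl.
have mb : measurable_fun setT (fun x => normc (bessel s f x)).
  have mr : measurable_fun setT (fun xi => (1 + dotv xi xi) `^ (s / 2) * profile d P xi).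
    by apply: measurable_funM; [exact: measurable_power_dotvv|exact: measurable_profile].
  rewrite (_ : (fun x => _) = (fun x => (2 * pi) ^- n * normc (wave 2^-1
      (fun xi => (1 + dotv xi xi) `^ (s / 2) * profile d P xi) x))).
    by apply: measurable_funM => //; exact: measurable_normc_wave.
  apply/funext => x; rewrite (bessel_wave s x Hf) ComplexField.Normc.normcM normc_real.
  by rewrite (ger0_norm (ltW cK)).
have dp0 : 0 < d * p by rewrite mulr_gt0.
have [gi gint] := @gauss_int0_rV R n _ dp0.
have total : (\int[mu]_x (normc (bessel s f x) `^ p)%:E <=
    (2 `^ p * (2 * Num.sqrt (2 / d) ^+ n))%:E)%E.
  apply: (@le_trans _ _ (\int[mu]_x ((2 `^ p)%:E *
      ((expR (- (d * p * dotv x x)))%:E + (w x `^ p)%:E)))%E).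
    apply: ge0_le_integral => //.
    - by move=> x _; rewrite lee_fin powR_ge0.
    - by apply/measurable_EFinP; exact: (measurableT_comp (measurable_powR p) mb).
    - apply: measurable_funeM; apply: emeasurable_funD; apply/measurable_EFinP.
        exact: measurable_exp_dotvv.
      by apply: (measurableT_comp (measurable_powR p)); exact: measurable_normc_wave.
    - move=> x _; rewrite -EFinD -EFinM lee_fin.
      apply: (@le_trans _ _ ((expR (- (d * dotv x x)) + w x) `^ p)).
        apply: ge0_ler_powR; rewrite ?nnegrE ?normc_ge0 ?addr_ge0 ?expR_ge0//.
        exact: ltW.
      apply: (le_trans (powRD_le (ltW p0) (expR_ge0 _) (w0 x))).
      rewrite -expRM (_ : - (d * dotv x x) * p = - (d * p * dotv x x))//; ring.
  have g1 x : [set: 'rV[R]_n] x -> (0 <= (expR (- (d * p * dotv x x)))%:E)%E.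
    by move=> _; rewrite lee_fin expR_ge0.
  have g2 x : [set: 'rV[R]_n] x -> (0 <= (w x `^ p)%:E)%E.
    by move=> _; rewrite lee_fin powR_ge0.
  have g12 x : [set: 'rV[R]_n] x ->
      (0 <= (expR (- (d * p * dotv x x)))%:E + (w x `^ p)%:E)%E.
    by move=> _; rewrite -EFinD lee_fin addr_ge0 ?expR_ge0 ?powR_ge0.
  have m1 : measurable_fun setT (fun x : 'rV[R]_n => (expR (- (d * p * dotv x x)))%:E).
    by apply/measurable_EFinP; exact: measurable_exp_dotvv.
  have m2 : measurable_fun setT (fun x => (w x `^ p)%:E).
    apply/measurable_EFinP; apply: (measurableT_comp (measurable_powR p)).
    exact: measurable_normc_wave.
  rewrite (ge0_integralZl_EFin mu measurableT g12 (emeasurable_funD m1 m2)) ?powR_ge0//.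
  rewrite ge0_integralD// EFinM lee_wpmul2l ?lee_fin ?powR_ge0//.
  rewrite (RintE gi) gint (_ : 2 * _ = Num.sqrt (2 / d) ^+ n + Num.sqrt (2 / d) ^+ n); last by ring.
  rewrite EFinD.
  (* [pi <= 4 <= 2 p] removes [p] from the main term. *)
  have s1 : Num.sqrt (pi / (d * p)) <= Num.sqrt (2 / d).
    apply: ler_wsqrtr; rewrite invfM mulrCA [X in _ <= X]mulrC.
    apply: ler_wpM2l; first by rewrite invr_ge0 ltW.
    by rewrite ler_pdivrMr//; lra.
  apply: leeD; first by rewrite lee_fin; apply: lerXn2r; rewrite ?nnegrE.
  apply: (le_trans Lp); rewrite lee_fin exprn_ege1//.
  rewrite -[X in X <= _]sqrtr1 ler_wsqrtr// ler_pdivlMr//; lra.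
rewrite /bessel_norm Lnorm.unlock -poweR_EFin; apply: gt0_ler_poweR.
- by rewrite invr_ge0 ltW.
- by rewrite in_itv/= integral_ge0 ?leey// => x _; exact: poweR_ge0.
- by rewrite in_itv/= leey andbT lee_fin !mulr_ge0 ?powR_ge0 ?exprn_ge0.
- apply: le_trans total; rewrite le_eqVlt; apply/orP; left; apply/eqP.
  by apply: eq_integral => x _; rewrite abse_EFin ger0_norm ?normc_ge0// poweR_EFin.
Qed.

(** Dominated by [|U|] uniformly in [t]; used to pass from real to rational times. *)
Lemma wave_continuous (U : 'rV[R]_n -> R) x (t : R) : rintegrable mu U ->
  {for t, continuous (fun t : R => normc (wave t U x))}.
Proof.
move=> Ui; have mU := rintegrable_measurable Ui.
have t0 : t \in (`]t - 1, t + 1[%classic : set R).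
  by rewrite inE /= in_itv/=; apply/andP; split; lra.
have bd (h : R -> R) : (forall u, `|h u| <= 1) -> continuous h ->
    {for t, continuous (fun l : R => \int[mu]_xi (h (dotv x xi + l * dotv xi xi) * U xi))}.
  move=> h1 ch; apply: (@continuity_under_integral R _ _ mu
      (fun (l : R) xi => h (dotv x xi + l * dotv xi xi) * U xi) setT measurableT (t - 1) (t + 1)
      _ _ (fun xi => `|U xi|) _ _ t t0).
  - move=> l _; apply: (@rintegrable_bounded _ _ _ _ 1 (fun xi => h (dotv x xi + l * dotv xi xi))) => //.
    apply: measurableT_comp; first exact: continuous_measurable_fun.
    exact: measurable_wave_phase.
  - apply: aeW => xi _ l _; apply: cvgMr_tmp.
    apply: (@continuous_comp _ _ _ (fun l : R => dotv x xi + l * dotv xi xi) h); last exact: ch.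
    by apply: cvgD; [exact: cvg_cst|apply: cvgMr_tmp; exact: cvg_id].
  - exact: (integrable_norm Ui).
  - by move=> l _; apply: aeW => xi _; rewrite normrM ler_piMl.
have cc := bd _ (@cos_max R) (@continuous_cos R).
have cs := bd _ (@sin_max R) (@continuous_sin R).
rewrite (_ : (fun t => normc _) = (fun t : R => Num.sqrt (
  (\int[mu]_xi (cos (dotv x xi + t * dotv xi xi) * U xi)) ^+ 2 +
  (\int[mu]_xi (sin (dotv x xi + t * dotv xi xi) * U xi)) ^+ 2))); last first.
  by apply/funext => l; rewrite /wave cint_waveE.
apply: (@continuous_comp _ _ _ _ (@Num.sqrt R)); last exact: sqrt_continuous.
by apply: cvgD; under eq_fun do rewrite expr2; apply: cvgM.
Qed.

(** The maximal function is an uncountable supremum. By continuity, a time at which [alpha] is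
    exceeded can be moved to a rational one, so the set is a countable union; its measure can then
    be compared with that of a cube. *)
Lemma measurable_superlevel (t0 d alpha : R) P (f : 'rV[R]_n -> R[i]) :
  rintegrable mu (profile d P) ->
  (forall xi, fourier f xi = expi (t0 * dotv xi xi) * (profile d P xi)%:C) ->
  measurable [set x | (alpha%:E < `|schrodinger_max f x|)%E].
Proof.
move=> Ui Hf.
have cK0 : 0 <= ((2 * pi) ^- n : R) by rewrite invr_ge0 exprn_ge0// mulr_ge0// pi_ge0.
have nS t x : normc (schrodinger t f x) = (2 * pi) ^- n * normc (wave (t0 - t) (profile d P) x).
  by rewrite (schrodinger_wave t x Hf) ComplexField.Normc.normcM normc_real ger0_norm.
have max0 x : (0 <= schrodinger_max f x)%E.
  apply: (@le_trans _ _ (normc (schrodinger 2^-1 f x))%:E).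
    by rewrite lee_fin normc_ge0.
  apply: ereal_sup_ubound; exists 2^-1 => //=.
  by rewrite in_itv/=; apply/andP; split; lra.
have -> : [set x | (alpha%:E < `|schrodinger_max f x|)%E] =
    \bigcup_(q : rat) (if (0 < (ratr q : R) < 1) then
      [set x | alpha < normc (schrodinger (ratr q) f x)] else set0).
  apply/seteqP; split => x /=.
    rewrite gee0_abs// => /ereal_sup_gt[_ [t tI <-]]; move: tI.
    rewrite /= in_itv/= => /andP[t1 t2].
    rewrite lte_fin => at_.
    have cont : {for t, continuous (fun t : R => normc (schrodinger t f x))}.
      rewrite (_ : (fun t => _) = (fun t : R => (2 * pi) ^- n * normc (wave (t0 - t) (profile d P) x))).
        apply: cvgMl_tmp.
        apply: (@continuous_comp _ _ _ (fun t : R => t0 - t) (fun u : R => normc (wave u (profile d P) x))).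
          by apply: cvgB; [exact: cvg_cst|exact: cvg_id].
        exact: wave_continuous.
      by apply/funext => u; exact: nS.
    have N : \forall u \near t, alpha < normc (schrodinger u f x).
      exact: (cvgr_gt _ cont).
    have N1 : \forall u \near t, 0 < (u : R) by exact: lt_nbhsr.
    have N2 : \forall u \near t, (u : R) < 1 by exact: lt_nbhsl.
    have /nbhs_ballP[r /= r0 Hr] : \forall u \near t,
        [/\ alpha < normc (schrodinger u f x), 0 < u & u < 1].
      by near=> u; split; near: u.
    have [q] := @rat_in_itvoo R t (t + r) ltac:(by rewrite ltrDl).
    rewrite in_itv/= => /andP[q1 q2].
    have [h1 h2 h3] := Hr (ratr q) ltac:(by rewrite /ball/= distrC ltr_norml; apply/andP; split; lra).
    by exists q => //; rewrite h2 h3.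
  move=> [q _]; case: ifP => // /andP[q1 q2] /= aq.
  rewrite gee0_abs//; apply: (@lt_le_trans _ _ (normc (schrodinger (ratr q) f x))%:E).
    by rewrite lte_fin.
  apply: ereal_sup_ubound; exists (ratr q) => //=.
  by rewrite in_itv/= q1 q2.
apply: bigcupT_measurable_rat => q; case: ifP => // _.
have mS : measurable_fun setT (fun x => normc (schrodinger (ratr q) f x)).
  under eq_fun do rewrite nS; apply: measurable_funM => //.
  by apply: measurable_normc_wave; exact: measurable_profile.
rewrite -[X in measurable X]setTI.
have := mS measurableT _ (measurable_itv `]alpha, +oo[).
by congr (measurable (_ `&` _)); apply/seteqP; split => x /=; rewrite in_itv/= andbT.
Unshelve. all: by end_near. Qed.

End Operators.

(** * The weak norm against the Bessel norm, at fixed [d] *)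

Section Counterexample.
Context {R : realType} {n : nat}.
Local Notation mu := (@lebesgue_rV R n).
Implicit Types (x xi : 'rV[R]_n).

(** Cubes replace the balls of radius about [d^{1/2}], since their measure is a product of
    lengths. *)
Lemma cube_bounds (b : R) x : 0 <= b -> (forall i, `[- b, b]%classic (x ord0 i)) ->
  dotv x x <= n%:R * b ^+ 2.
Proof.
move=> b0 xb; have -> : n%:R * b ^+ 2 = \sum_(i < n) b ^+ 2.
  by rewrite sumr_const card_ord mulr_natl.
apply: ler_sum => i _; have := xb i; rewrite /= in_itv/= -ler_norml => h.
by rewrite -expr2 -(real_normK (num_real (x ord0 i))); apply: lerXn2r; rewrite ?nnegrE.
Qed.

Lemma cube_measure (b : R) : 0 < b ->
  let U := [set x : 'rV[R]_n | forall i, `[- b, b]%classic (x ord0 i)] in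
  measurable U /\ mu U = ((2 * b) ^+ n)%:E.
Proof.
move=> b0 U; split.
  have -> : U = \bigcap_(i in [set: 'I_n])
      ((fun x : 'rV[R]_n => x ord0 i) @^-1` `[- b, b]%classic).
    by apply/seteqP; split => z /= H i; [move=> _|]; exact: H.
  apply: fin_bigcap_measurable => // i _; rewrite -[X in measurable X]setTI.
  by apply: measurable_rV_coord.
rewrite (@lebesgue_rV_box R n (fun=> `[- b, b]%classic))//.
rewrite (eq_bigr (fun=> (2 * b)%:E)) => [|i _].
  by rewrite prodEFin prodr_const card_ord.
rewrite lebesgue_measure_itv/= lte_fin ifT; last by lra.
by rewrite -EFinB; congr (_%:E); ring.
Qed.

Lemma measurable_unit_ball : measurable (@unit_ball R n).
Proof.
have -> : @unit_ball R n = (fun x => dotv x x) @^-1` `]-oo, 1[.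
  apply/seteqP; split => x; rewrite /unit_ball /= in_itv/= => H.
    by rewrite -enorm_sqr expr_lt1// sqrtr_ge0.
  by rewrite -(@expr_lt1 _ 2) ?sqrtr_ge0// enorm_sqr.
rewrite -[X in measurable X]setTI.
by apply: measurable_dotvv => //; exact: measurable_itv.
Qed.

(** Tolerance, polynomial and [f] depend on [d] and disappear from the conclusion; [k] and [c] are
    fixed before [d], as the scaling argument requires. The absolute value covers a negative [C]. *)
Lemma key_estimate (p s C : R) : (0 < n)%N -> 2 <= p ->
  (forall f : 'rV[R]_n -> R[i], schwartz f ->
    (weak_Lnorm p unit_ball (schrodinger_max f) <= C%:E * bessel_norm p s f)%E) ->
  exists k c : R, [/\ 0 < k, 0 < c & forall d : R, 0 < d -> d <= 4^-1 ->
    k * ((2 * d) `^ (s / 2) * (Num.sqrt (2 * d))^-1 ^+ n) *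
      ((2 * (c * Num.sqrt d)) ^+ n) `^ p^-1 <=
    `|C| * (2 `^ p * (2 * Num.sqrt (2 / d) ^+ n)) `^ p^-1].
Proof.
move=> n0 p2 HC; have p0 : 0 < p by lra.
have [c [k [c0 c1 k0 low]]] := @lower_bound R n (- (s / 2)) n0.
have nR : 1 <= n%:R :> R by rewrite ler1n.
have nR0 : 0 < n%:R :> R by rewrite ltr0n.
pose K : R := (2 * pi) ^- n.
have K0 : 0 < K by rewrite invr_gt0 exprn_gt0// mulr_gt0// pi_gt0.
exists (K * k / 4), (Num.sqrt (c / n%:R)); split.
- by rewrite !mulr_gt0// invr_gt0.
- by rewrite sqrtr_gt0 divr_gt0.
move=> d d0 d4.
have [eta1 eta10 upper] := @bessel_upper R n p s d p2 d0 d4.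
pose A := k * ((2 * d) `^ (s / 2) * (Num.sqrt (2 * d))^-1 ^+ n).
have d20 : 0 < 2 * d by rewrite mulr_gt0.
have A0 : 0 < A.
  by rewrite mulr_gt0// mulr_gt0 ?powR_gt0// exprn_gt0// invr_gt0 sqrtr_gt0.
have [gi gint] := @gauss_int0_rV R n _ d0.
pose g := Num.sqrt (pi / d) ^+ n.
have g0 : 0 < g by rewrite exprn_gt0// sqrtr_gt0 divr_gt0// pi_gt0.
(* [eta1] serves the Bessel bound. At the focus the error is at most [eta] times [g], the integral
   of [e^{- d |xi|^2}], so the second entry spares half of [A]. *)
pose eta := Num.min eta1 (A / (2 * g)).
have eta0 : 0 < eta by rewrite lt_min eta10 divr_gt0// mulr_gt0.
have etag : eta * g <= A / 2.
  have : eta <= A / (2 * g) by rewrite ge_min lexx orbT.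
  rewrite ler_pdivlMr; last by rewrite mulr_gt0.
  by move=> h; lra.
have [P HP] := power_approx (- (s / 2)) d0 eta0.
have [f Sf Hf] := @fourier_surj R n P d 2^-1 d0.
have Uf : (bessel_norm p s f <= ((2 `^ p * (2 * Num.sqrt (2 / d) ^+ n)) `^ p^-1)%:E)%E.
  apply: (upper P) => // r r0; apply: (le_trans (HP r r0)).
  by rewrite ge_min lexx.
pose m xi := expR (- (2 * d * dotv xi xi)) * (1 + dotv xi xi) `^ (- (s / 2)).
have mm : measurable_fun setT m.
  by apply: measurable_funM; [exact: measurable_exp_dotvv|exact: measurable_power_dotvv].
have near_m xi : `|profile d P xi - m xi| <= eta * expR (- (d * dotv xi xi)).
  rewrite /profile /m (_ : - (2 * d * dotv xi xi) = - (d * dotv xi xi) + - (d * dotv xi xi)); last by ring.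
  rewrite expRD -mulrA -mulrBr normrM (ger0_norm (expR_ge0 _)) mulrC.
  by apply: ler_wpM2r; [exact: expR_ge0|apply: HP; exact: dotv_ge0].
have mi : rintegrable mu m.
  have [M M0 HM] := powR_exp_absorb (- (s / 2)) d0.
  apply: (@rintegrable_le _ _ _ mu _ (fun xi => M * expR (- (d * dotv xi xi)))) => //.
    exact: rintegrableZ.
  move=> xi; rewrite ger0_norm; last by rewrite mulr_ge0 ?expR_ge0 ?powR_ge0.
  rewrite /m (_ : - (2 * d * dotv xi xi) = - (d * dotv xi xi) + - (d * dotv xi xi)); last by ring.
  rewrite expRD -mulrA mulrC; apply: ler_wpM2r; first exact: expR_ge0.
  rewrite mulrC -ler_pdivlMr ?expR_gt0// -expRN opprK; apply: HM; exact: dotv_ge0.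
have mpr : measurable_fun setT (@profile R n d P) by exact: (@measurable_profile R n d P).
have di : rintegrable mu (fun xi => profile d P xi - m xi).
  apply: (@rintegrable_le _ _ _ mu _ (fun xi => eta * expR (- (d * dotv xi xi)))) => //.
    exact: measurable_funB.
  exact: rintegrableZ.
have pri : rintegrable mu (profile d P).
  have := rintegrableD di mi; congr (rintegrable mu _).
  by apply/funext => xi; rewrite subrK.
(* Half the side of a cube contained in [|x|^2 <= c d], hence within reach of the lower bound and
   inside the unit ball. *)
pose b := Num.sqrt (c / n%:R) * Num.sqrt d.
have b0 : 0 < b by rewrite mulr_gt0 ?sqrtr_gt0// divr_gt0.
have nb2 : n%:R * b ^+ 2 = c * d.
  rewrite /b exprMn !sqr_sqrtr ?(ltW d0) ?divr_ge0 ?(ltW c0)//.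
  by field; rewrite gt_eqF.
have [mU muU] := cube_measure b0.
set U := [set x : 'rV[R]_n | _] in mU muU.
have UB x : U x -> dotv x x <= c * d.
  by move=> /(cube_bounds (ltW b0)); rewrite nb2.
have big x : U x -> A / 2 <= Re (wave (2^-1 - 2^-1) (profile d P) x).
  move=> /UB xU.
  have -> : Re (wave (2^-1 - 2^-1) (profile d P) x) = \int[mu]_xi (cos (dotv x xi) * profile d P xi).
    rewrite /wave cint_waveE /=; apply: eq_Rint => xi.
    by rewrite subrr mul0r addr0.
  have i1 := rintegrable_cos x mi; have i2 := rintegrable_cos x di.
  have -> : \int[mu]_xi (cos (dotv x xi) * profile d P xi) =
      \int[mu]_xi (cos (dotv x xi) * m xi) +
      \int[mu]_xi (cos (dotv x xi) * (profile d P xi - m xi)).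
    by rewrite -RintD//; apply: eq_Rint => xi; rewrite -mulrDr addrC subrK.
  have l1 : A <= \int[mu]_xi (cos (dotv x xi) * m xi).
    have e1 : 2 * d <= 1 by lra.
    have xe : dotv x x <= c * (2 * d) by apply: (le_trans xU); nra.
    by have := low _ x d20 e1 xe; rewrite opprK.
  have l2 : `|\int[mu]_xi (cos (dotv x xi) * (profile d P xi - m xi))| <= eta * g.
    rewrite /g -gint -RintZ//; apply: Rint_norm_le.
    - exact: rintegrable_measurable i2.
    - exact: rintegrableZ.
    - move=> xi; apply: le_trans (near_m xi); rewrite normrM ler_piMl//.
      exact: cos_max.
  by move: l2; rewrite ler_norml => /andP[l2 _]; lra.
(* Half of the lower bound [K A / 2] on the cube, because the superlevel set is defined by a strict
   inequality. *)
pose alpha := K * A / 4.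
have alpha0 : 0 < alpha by apply: divr_gt0 => //; exact: mulr_gt0.
pose S := [set x | (alpha%:E < `|schrodinger_max f x|)%E].
have mS : measurable S by exact: (measurable_superlevel _ pri Hf).
have US : U `<=` unit_ball `&` S.
  move=> x xU; split.
    rewrite /unit_ball /= -(@expr_lt1 _ 2) ?sqrtr_ge0// enorm_sqr.
    by apply: (le_lt_trans (UB x xU)); nra.
  rewrite /S /=; apply: (@lt_le_trans _ _ (normc (schrodinger 2^-1 f x))%:E).
    rewrite (schrodinger_wave 2^-1 x Hf) ComplexField.Normc.normcM normc_real.
    rewrite lte_fin (ger0_norm (ltW K0)) /alpha -mulrA ltr_pM2l//.
    apply: (@lt_le_trans _ _ (A / 2)); first by lra.
    exact: (le_trans (big x xU) (le_trans (ler_norm _) (normc_ge_Re _))).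
  apply: (@le_trans _ _ (schrodinger_max f x)); last exact: lee_abs.
  apply: ereal_sup_ubound; exists 2^-1 => //=.
  by rewrite in_itv/=; apply/andP; split; lra.
have muUS : (((2 * b) ^+ n)%:E <= mu (unit_ball `&` S))%E.
  rewrite -muU; apply: le_measure => //; rewrite inE//.
  by apply: measurableI => //; exact: measurable_unit_ball.
have weak : ((alpha * ((2 * b) ^+ n) `^ p^-1)%:E <= weak_Lnorm p unit_ball (schrodinger_max f))%E.
  apply: (@le_trans _ _ (alpha%:E * (mu (unit_ball `&` S)) `^ p^-1)%E).
    rewrite EFinM lee_wpmul2l ?lee_fin ?(ltW alpha0)// -poweR_EFin.
    apply: gt0_ler_poweR => //; first by rewrite invr_ge0 ltW.
      by rewrite in_itv/= leey andbT lee_fin exprn_ge0// mulr_ge0// ltW.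
    by rewrite in_itv/= leey andbT.
  by apply: ereal_sup_ubound; exists alpha => //=; rewrite in_itv/= alpha0.
rewrite -lee_fin; have -> : K * k / 4 * ((2 * d) `^ (s / 2) * (Num.sqrt (2 * d))^-1 ^+ n) = alpha.
  by rewrite /alpha /A; ring.
apply: (le_trans weak); apply: (le_trans (HC f Sf)).
apply: (@le_trans _ _ (`|C|%:E * bessel_norm p s f)%E).
  by rewrite lee_wpmul2r ?Lnorm_ge0// lee_fin ler_norm.
by rewrite EFinM lee_wpmul2l.
Qed.

End Counterexample.

Section Scaling.
Context {R : realType} {n : nat}.

(** After [p]-th powers the two sides differ by [d^{- om}] up to constants. With [d = e^{- L}] this
    is [e^{om L} >= 1 + om L], which is unbounded. *)
Lemma scaling_contradiction (p s k c C : R) : 2 <= p ->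
  s < n%:R * (1 - 2 / p) -> 0 < k -> 0 < c -> 0 <= C ->
  ~ (forall d : R, 0 < d -> d <= 4^-1 ->
    k * ((2 * d) `^ (s / 2) * (Num.sqrt (2 * d))^-1 ^+ n) *
      ((2 * (c * Num.sqrt d)) ^+ n) `^ p^-1 <=
    C * (2 `^ p * (2 * Num.sqrt (2 / d) ^+ n)) `^ p^-1).
Proof.
move=> p2 hs k0 c0 C0 H; have p0 : 0 < p by lra.
(* The powers of [d] are [(s - n) / 2 + n / (2 p)] on the left and [- n / (2 p)] on the right; [om]
   is [p] times the right one minus the left one, and its positivity is [s < n (1 - 2 / p)]. *)
pose om := (n%:R - s) / 2 * p - n%:R.
have om0 : 0 < om.
  have : s * p < n%:R * (p - 2).
    rewrite (_ : n%:R * (p - 2) = n%:R * (1 - 2 / p) * p); last by field; rewrite gt_eqF.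
    by rewrite ltr_pM2r.
  by rewrite /om; lra.
have s20 : 0 < Num.sqrt 2 :> R by rewrite sqrtr_gt0.
pose al := k * (2 `^ (s / 2) * (Num.sqrt 2)^-1 ^+ n).
have al0 : 0 < al by rewrite mulr_gt0// mulr_gt0 ?powR_gt0// exprn_gt0// invr_gt0.
pose X := (2 * c) ^+ n; have X0 : 0 < X by rewrite exprn_gt0// mulr_gt0.
pose B := 2 `^ p * (2 * Num.sqrt 2 ^+ n).
have B0 : 0 < B by rewrite mulr_gt0 ?powR_gt0// mulr_gt0// exprn_gt0.
have key (L : R) : 3 <= L -> al `^ p * X * expR (om * L) <= C `^ p * B.
  move=> L3; pose d := expR (- L).
  have d0 : 0 < d by exact: expR_gt0.
  have d4 : d <= 4^-1.
    rewrite /d expRN lef_pV2 ?posrE ?expR_gt0//.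
    by rewrite (le_trans _ (expR_ge1Dx _))//; lra.
  pose h := expR (- (L / 2)); have h0 : 0 < h by exact: expR_gt0.
  have dh : d = h ^+ 2.
    by rewrite /d /h -expRM_natl; congr expR; field.
  have sd : Num.sqrt d = h by rewrite dh sqrtr_sqr ger0_norm// ltW.
  have s2d : Num.sqrt (2 * d) = Num.sqrt 2 * h by rewrite sqrtrM// sd.
  have s2d' : Num.sqrt (2 / d) = Num.sqrt 2 * h^-1 by rewrite sqrtrM// sqrtrV ?(ltW d0)// sd.
  have hn : h ^- n = expR (n%:R * (L / 2)) by rewrite /h -expRM_natl -expRN mulrN opprK.
  have hn' : h ^+ n = expR (- (n%:R * (L / 2))) by rewrite /h -expRM_natl mulrN.
  have := H d d0 d4; rewrite s2d s2d' sd => Hd.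
  have := Hd; set lhs := (X in X <= _); set rhs := (X in _ <= X) => lr.
  have lE : lhs = al * expR ((n%:R - s) / 2 * L) * (X * expR (- (n%:R * (L / 2)))) `^ p^-1.
    rewrite /lhs; congr (_ * _ `^ _).
      rewrite powRM// ?(ltW d0)// /d -expRM invfM exprMn /al !exprVn hn.
      rewrite (_ : (n%:R - s) / 2 * L = - L * (s / 2) + n%:R * (L / 2)); last by field.
      by rewrite expRD; ring.
    by rewrite /X -hn' -exprMn; congr (_ ^+ _); ring.
  have rE : rhs = C * (B * expR (n%:R * (L / 2))) `^ p^-1.
    rewrite /rhs /B; congr (_ * _ `^ _).
    by rewrite exprMn !exprVn hn; ring.
  have lr0 : 0 <= lhs.
    rewrite lE mulr_ge0 ?powR_ge0// mulr_ge0 ?expR_ge0//; exact: ltW.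
  have : lhs `^ p <= rhs `^ p.
    apply: ge0_ler_powR; rewrite ?nnegrE ?(ltW p0)//; exact: le_trans lr.
  have pK (z : R) : 0 <= z -> (z `^ p^-1) `^ p = z.
    by move=> z0; rewrite -powRrM mulVf ?gt_eqF// powRr1.
  set E2 := expR (- (n%:R * (L / 2))) in lE.
  set E3 := expR (n%:R * (L / 2)) in rE.
  have E20 : 0 < E2 by exact: expR_gt0.
  have E30 : 0 < E3 by exact: expR_gt0.
  have E32 : E3 * E2 = 1 by rewrite /E3 /E2 expRN mulfV// gt_eqF// expR_gt0.
  have -> : lhs `^ p = al `^ p * expR ((n%:R - s) / 2 * L * p) * (X * E2).
    rewrite lE powRM ?powR_ge0//; last by apply: mulr_ge0; [exact: ltW|exact: expR_ge0].
    rewrite pK; last by apply: mulr_ge0; exact: ltW.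
    by rewrite powRM ?expR_ge0 ?(ltW al0)// -expRM.
  have -> : rhs `^ p = C `^ p * (B * E3).
    rewrite rE powRM ?powR_ge0// pK//; apply: mulr_ge0; exact: ltW.
  move=> le; have := ler_wpM2r (ltW E20) le.
  have -> : C `^ p * (B * E3) * E2 = C `^ p * B by rewrite -!mulrA E32 mulr1.
  apply: le_trans; rewrite (_ : om * L = (n%:R - s) / 2 * L * p + (- (n%:R * (L / 2)) + - (n%:R * (L / 2)))).
    by rewrite !expRD -/E2 le_eqVlt; apply/orP; left; apply/eqP; ring.
  by rewrite /om; field.
pose a1 := al `^ p * X; have a10 : 0 < a1 by rewrite mulr_gt0// powR_gt0.
pose b1 := C `^ p * B.
(* The entry 3 makes [e^{- L} <= 1 / 4], as [e^L >= 1 + L]; the other makes [a1 om L] reach [b1]. *)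
pose L := Num.max 3 (b1 / (a1 * om)).
have L3 : 3 <= L by rewrite le_max lexx.
have Lb : b1 <= a1 * (om * L).
  have : b1 / (a1 * om) <= L by rewrite le_max lexx orbT.
  rewrite ler_pdivrMr; last exact: mulr_gt0.
  by move=> h; rewrite mulrA mulrC.
have := key L L3; rewrite -/a1 -/b1 leNgt => /negP; apply.
apply: (le_lt_trans Lb); rewrite ltr_pM2l//.
by apply: (lt_le_trans _ (expR_ge1Dx _)); lra.
Qed.

End Scaling.

Theorem theorem1p6 (R : realType) (n : nat) (p s : R)
    (hn : (1 <= n)%N) (hp : 2 <= p) (hs : s < n%:R * (1 - 2 / p)) :
  ~ exists C : R, forall f : 'rV[R]_n -> R[i], schwartz f ->
      (weak_Lnorm p unit_ball (schrodinger_max f) <= C%:E * bessel_norm p s f)%E.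
Proof.
move=> [C HC]; have [k [c [k0 c0 H]]] := key_estimate hn hp HC.
exact: (scaling_contradiction hp hs k0 c0 (normr_ge0 C) H).
Qed.
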